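(* $\textsc{Z-Weak}$ is in $P$.
   Context: A game is a pair $(A,B)$ of real $n\times m$ payoff matrices ($A$ for the row player, $B$ for the column player). A subgame is a pair $(I,J)$ with $I\subseteq\{1,\dots,n\}$, $J\subseteq\{1,\dots,m\}$. Weak dominance: $(I,J)\to_{\le}(I\setminus\{i\},J)$ if there is $i_0\in I$ with $A_{i_0,j}\ge A_{i,j}$ for all $j\in J$; $(I,J)\to_{\le}(I,J\setminus\{j\})$ if there is $j_0\in J$ with $B_{i,j_0}\ge B_{i,j}$ for all $i\in I$; $\rightrightarrows_{\le}$ is the reflexive transitive closure of $\to_{\le}$ (the dominating strategy $i_0$ resp. $j_0$ is required to belong to the current subgame; the paper allows it to be any such strategy). The problem $\textsc{Weak}$ takes an $n\times m$ game $(A,B)$ and a row strategy $1\le i\le n$, and answers yes iff there are $I,J$ with $(\{1,\dots,n\},\{1,\dots,m\})\rightrightarrows_{\le}(I,J)$ and $i\notin I$. $\textsc{Z-Weak}$ is its restriction to zero-sum games (the paper treats zero-sum and constant-sum games as equivalent). *)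

(* Defs.v *)
From HB Require Import structures.
From mathcomp Require Import all_boot all_order all_algebra.
From mathcomp Require Import reals.

Set Implicit Arguments.
Unset Strict Implicit.
Unset Printing Implicit Defensive.

Import Order.TTheory GRing.Theory Num.Theory.
Local Open Scope ring_scope.

Section Dominance.
Variables (R : realType) (n m : nat).

Definition subgame := ({set 'I_n} * {set 'I_m})%type.

(* The dominating strategy is a strategy of the current subgame other than the
   eliminated one: a strategy dominating itself would make every strategy
   eliminable.  No strict inequality is required anywhere, so either one of two
   strategies with equal payoffs may be eliminated. *)
Definition weak_step (A B : 'M[R]_(n, m)) : rel subgame := fun s t =>
  [exists i, (t == (s.1 :\ i, s.2)) &&
     [exists i0 in s.1 :\ i, [forall j in s.2, A i j <= A i0 j]]]
  || [exists j, (t == (s.1, s.2 :\ j)) &&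
     [exists j0 in s.2 :\ j, [forall i in s.1, B i j <= B i j0]]].

Definition weakly_eliminable (A B : 'M[R]_(n, m)) (i : 'I_n) : Prop :=
  exists (I : {set 'I_n}) (J : {set 'I_m}),
    connect (weak_step A B) ([set: 'I_n], [set: 'I_m]) (I, J) /\ i \notin I.

Definition zero_sum (A B : 'M[R]_(n, m)) : Prop := A + B = 0.

End Dominance.

Inductive move := MoveLeft | Stay | MoveRight.

(* A machine over the input alphabet [S] has tape cells [option (S + work)]:
   [None] is the blank, [inl] an input symbol, [inr] a work symbol. A state [q]
   is final, with verdict [b], when [verdict q = Some b]. There is at least one
   tape; tape [ord0] initially holds the input. *)
Record machine (S : finType) := Machine {
  state : finType;
  work : finType;
  extra_tapes : nat;
  start : state;
  verdict : state -> option bool;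
  delta : state -> {ffun 'I_extra_tapes.+1 -> option (S + work)} ->
          state * ('I_extra_tapes.+1 -> option (S + work) * move)
}.

(* A two-way infinite tape; both sides list cells from the head outwards and
   continue with blanks. *)
Record tape (C : Type) := Tape {
  leftward : seq (option C);
  scanned : option C;
  rightward : seq (option C)
}.

Definition tape_of C (s : seq (option C)) : tape C :=
  Tape [::] (head None s) (behead s).

Definition act C (t : tape C) (a : option C * move) : tape C :=
  let: Tape l _ r := t in
  let: (c, d) := a in
  match d with
  | MoveLeft => Tape (behead l) (head None l) (c :: r)
  | Stay => Tape l c r
  | MoveRight => Tape (c :: l) (head None r) (behead r)
  end.

Section Run.
Variables (S : finType) (M : machine S).

Definition config : Type :=
  state M * ('I_(extra_tapes M).+1 -> tape (S + work M)).

Definition init (w : seq S) : config :=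
  (start M,
   fun k => tape_of (if k == ord0 then [seq Some (inl a) | a <- w] else [::])).

Definition step (c : config) : config :=
  let: (q, ts) := c in
  if verdict q is Some _ then c
  else let: (q', a) := delta q [ffun k => scanned (ts k)] in
       (q', fun k => act (ts k) (a k)).

(* The verdict reached on input [w] within [t] steps, if any. *)
Definition outcome (w : seq S) (t : nat) : option bool :=
  verdict (iter t step (init w)).1.

End Run.

Definition language (S : finType) := seq S -> Prop.

Definition in_P (S : finType) (L : language S) : Prop :=
  exists (M : machine S) (p : {poly nat}), forall w : seq S,
    exists b : bool,
      outcome M w p.[size w] = Some b /\ (b = true <-> L w).

Inductive symbol := Bit of bool | Minus | Slash | Comma | Semicolon | Bar.

Definition symbol_code (a : symbol) : bool + 'I_5 :=
  match a with
  | Bit b => inl b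
  | Minus => inr (inord 0)
  | Slash => inr (inord 1)
  | Comma => inr (inord 2)
  | Semicolon => inr (inord 3)
  | Bar => inr (inord 4)
  end.

Definition symbol_decode (c : bool + 'I_5) : symbol :=
  match c with
  | inl b => Bit b
  | inr k => nth Bar [:: Minus; Slash; Comma; Semicolon] k
  end.

Lemma symbol_codeK : cancel symbol_code symbol_decode.
Proof. by case=> //=; rewrite inordK. Qed.

HB.instance Definition _ := Finite.copy symbol (can_type symbol_codeK).

(* Binary numerals, least significant bit first; trailing zeros are allowed. *)
Fixpoint nat_of_bits (s : seq bool) : nat :=
  if s is b :: s' then (b + (nat_of_bits s').*2)%N else 0%N.

(* Payoffs are given as fractions of binary integers, not necessarily in lowest
   terms, so one rational number has several encodings. *)
Record fraction := Fraction {
  negative : bool;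
  numerator : seq bool;
  denominator : seq bool;
  denominator_gt0 : (0 < nat_of_bits denominator)%N
}.

Definition fraction_val (R : realType) (x : fraction) : R :=
  (-1) ^+ negative x *
  ((nat_of_bits (numerator x))%:R / (nat_of_bits (denominator x))%:R).

Definition encode_fraction (x : fraction) : seq symbol :=
  (if negative x then [:: Minus] else [::]) ++
  map Bit (numerator x) ++ Slash :: map Bit (denominator x).

Definition encode_matrix n m (X : 'M[fraction]_(n, m)) : seq symbol :=
  rcons (flatten [seq
    rcons (flatten [seq rcons (encode_fraction (X i j)) Comma | j <- enum 'I_m])
      Semicolon | i <- enum 'I_n]) Bar.

(* The row strategy is written in unary, which is harmless as the rows are
   listed explicitly; it is numbered from 0. *)
Definition encode_instance n m (X Y : 'M[fraction]_(n, m)) (i : 'I_n) :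
    seq symbol :=
  nseq i (Bit true) ++ Bar :: encode_matrix X ++ encode_matrix Y.

Definition Weak (R : realType) : language symbol := fun w =>
  exists (n m : nat) (X Y : 'M[fraction]_(n, m)) (i : 'I_n),
    let A := map_mx (@fraction_val R) X in
    let B := map_mx (@fraction_val R) Y in
    w = encode_instance X Y i /\ weakly_eliminable A B i.

Definition Z_Weak (R : realType) : language symbol := fun w =>
  exists (n m : nat) (X Y : 'M[fraction]_(n, m)) (i : 'I_n),
    let A := map_mx (@fraction_val R) X in
    let B := map_mx (@fraction_val R) Y in
    [/\ w = encode_instance X Y i, zero_sum A B & weakly_eliminable A B i].

(* Main.v *)
(* In a zero-sum game two strategies that very weakly dominate each other have
   equal payoffs for both players, so exchanging them is an isomorphism.  By a
   Newman-style argument the maximal reductions that never remove two given rows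
   [i] and [k] are therefore isomorphic by a permutation fixing [i] and [k].  Hence
   [i] is eliminable iff, for some [k], it is dominated by [k] in the reduction
   obtained greedily while protecting [i] and [k].

   For the machine, everything is a term over positions of the input word, with
   comparison, counting, and iteration of a set of positions; such terms are
   evaluated by nested loops over tapes that carry a copy of the input, so the
   running time is polynomial.  Payoffs are compared without writing down any
   product: the signed carry of a long multiplication, processed from the least
   significant bit, is smaller than the input and is kept as the cardinality of a
   set of positions. *)
From HB Require Import structures.
Require Import Defs.
From mathcomp Require Import all_boot all_order all_algebra.
From mathcomp Require Import fingroup perm.
From mathcomp Require Import boolp reals.
From mathcomp Require Import zify.

Set Implicit Arguments.
Unset Strict Implicit.
Unset Printing Implicit Defensive.

(** * Structured multi-tape programs *)

(** Up to the step that eliminates [i] in favour of [k], neither has been removed, so the earlier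
    steps respect the protection of both; this is why pairs are protected and every [k] is tried. An
    isomorphism that moved [i] or [k] would say nothing about them. Antisymmetry of the payoff
    enters in one place, [iso_swap]: mutual dominance gives equality for the owner of the two
    strategies, antisymmetry gives it for the opponent. The strategies of both players are therefore
    pooled in one type. On the machine, numbers live in unary counters, so all values must be
    polynomially bounded, and what passes from one round to the next must be a set of positions. For
    comparing [n1 / d1] with [n2 / d2], a column sum of [n1 * d2] is at most the shorter of the two
    lengths; as distinct entries occupy disjoint parts of the input of length [N], the column sums
    of both products together are at most [N./2]. Hence the carry lies between [- N./2] and [N./2],
    and shifted by [N./2] it fits in [N] positions. Since [N] exceeds [n + m], [N] rounds also
    complete the greedy reduction. *)

Section Programs.
Variables (C : finType) (K : nat).
Local Notation index := 'I_K.+1.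
Local Notation tapes := (index -> tape C).
Local Notation syms := {ffun index -> option C}.

Inductive prog :=
| Act of (syms -> index -> option C * move)
| Seq of prog & prog
| If of (syms -> bool) & prog & prog
| While of (syms -> bool) & prog.

Definition reads (ts : tapes) : syms := [ffun k => scanned (ts k)].

Inductive exec : prog -> tapes -> tapes -> nat -> Prop :=
| exec_act f ts : exec (Act f) ts (fun k => act (ts k) (f (reads ts) k)) 1
| exec_seq p q ts ts1 ts2 t1 t2 :
    exec p ts ts1 t1 -> exec q ts1 ts2 t2 -> exec (Seq p q) ts ts2 (t1 + t2)
| exec_if (b : syms -> bool) p q ts ts' t :
    exec (if b (reads ts) then p else q) ts ts' t -> exec (If b p q) ts ts' t.+1
| exec_stop (b : syms -> bool) p ts : b (reads ts) = false -> exec (While b p) ts ts 1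
| exec_loop (b : syms -> bool) p ts ts1 ts2 t1 t2 :
    b (reads ts) -> exec p ts ts1 t1 -> exec (While b p) ts1 ts2 t2 ->
    exec (While b p) ts ts2 (t1 + t2).+1.

(** Control points, from which machine states are made. In the cases [If] and [While] the point
    [None] is where the test is evaluated, in one stationary step. *)
Fixpoint pos (p : prog) : finType :=
  match p with
  | Act _ => unit
  | Seq p q => (pos p + pos q)%type
  | If _ p q => option (pos p + pos q)
  | While _ p => option (pos p)
  end.

Fixpoint entry (p : prog) : pos p :=
  match p with
  | Act _ => tt
  | Seq p q => inl (entry p)
  | If _ _ _ => None
  | While _ _ => None
  end.

Definition stay (sy : syms) : index -> option C * move := fun k => (sy k, Stay).

(* The first component [None] means that the program is left. *)
Fixpoint next (p : prog) : pos p -> syms -> option (pos p) * (index -> option C * move) :=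
  match p with
  | Act f => fun _ sy => (None, f sy)
  | Seq p q => fun s sy =>
      match s with
      | inl s => let: (o, a) := next s sy in
          (if o is Some s' then Some (inl s') else Some (inr (entry q)), a)
      | inr s => let: (o, a) := next s sy in (omap inr o, a)
      end
  | If b p q => fun s sy =>
      match s with
      | None => (Some (Some (if b sy then inl (entry p) else inr (entry q))), stay sy)
      | Some (inl s) => let: (o, a) := next s sy in
          (if o is Some s' then Some (Some (inl s')) else None, a)
      | Some (inr s) => let: (o, a) := next s sy in
          (if o is Some s' then Some (Some (inr s')) else None, a)
      end
  | While b p => fun s sy =>
      match s with
      | None => (if b sy then Some (Some (entry p)) else None, stay sy)
      | Some s => let: (o, a) := next s sy in (Some o, a)
      end
  end.

Lemma act_stay ts : (fun k => act (ts k) (stay (reads ts) k)) = ts.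
Proof. by apply: funext => k; rewrite /stay ffunE; case: (ts k). Qed.

(** Stated for any step function [h] that simulates [next] through an embedding [f] and leaves to
    [e], because the exit of a subprogram depends on its context: the entry of the next program, a
    loop test, or the end. The induction re-embeds each subprogram accordingly. *)
Lemma exec_embedded p ts ts' t : exec p ts ts' t ->
  forall (Q : Type) (h : Q * tapes -> Q * tapes) (f : pos p -> Q) (e : Q),
  (forall s us, h (f s, us) =
     let: (o, a) := next s (reads us) in
     (if o is Some s' then f s' else e, fun k => act (us k) (a k))) ->
  iter t h (f (entry p), ts) = (e, ts').
Proof.
elim=> {p ts ts' t} /=.
- by move=> g ts Q h f e hE; rewrite hE.
- move=> p q ts ts1 ts2 t1 t2 _ IH1 _ IH2 Q h f e hE.
  rewrite addnC iterD (IH1 _ _ (fun s => f (inl s)) (f (inr (entry q)))).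
    apply: (IH2 _ _ (fun s => f (inr s)) e) => s us; rewrite hE /=.
    by case: next => [[]].
  by move=> s us; rewrite hE /=; case: next => [[]].
- move=> b p q ts ts' t _ IH Q h f e hE.
  rewrite -iterS iterSr hE /= act_stay; case: ifP IH => _ IH.
    apply: (IH _ _ (fun s => f (Some (inl s))) e) => s us; rewrite hE /=.
    by case: next => [[]].
  apply: (IH _ _ (fun s => f (Some (inr s))) e) => s us; rewrite hE /=.
  by case: next => [[]].
- by move=> b p ts bF Q h f e hE; rewrite hE /= bF act_stay.
- move=> b p ts ts1 ts2 t1 t2 bT _ IH1 _ IH2 Q h f e hE.
  rewrite -iterS iterSr hE /= bT act_stay addnC iterD.
  rewrite (IH1 _ _ (fun s => f (Some s)) (f None)); first exact: (IH2 _ h f e).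
  by move=> s us; rewrite hE /=; case: next => [[]].
Qed.

(** A Hoare triple for total correctness with time bound [B], at the fixed initial tapes [ts]. *)
Definition runs p ts B (Q : tapes -> Prop) :=
  exists t ts', [/\ t <= B, exec p ts ts' t & Q ts'].

Lemma runs_weaken p ts B B' (Q Q' : tapes -> Prop) :
  runs p ts B Q -> B <= B' -> (forall us, Q us -> Q' us) -> runs p ts B' Q'.
Proof.
move=> [t [us [tB pus Qus]]] BB' QQ'; exists t, us; split=> //; last exact: QQ'.
exact: leq_trans BB'.
Qed.

Lemma runs_le B p ts B' (Q : tapes -> Prop) : runs p ts B Q -> B <= B' -> runs p ts B' Q.
Proof. by move=> pB BB'; apply: runs_weaken pB BB' _. Qed.

Lemma runs_act f ts (Q : tapes -> Prop) :
  Q (fun k => act (ts k) (f (reads ts) k)) -> runs (Act f) ts 1 Q.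
Proof. by move=> Qts; exists 1, (fun k => act (ts k) (f (reads ts) k)); split=> //; constructor. Qed.

Lemma runs_seq p q ts B1 B2 (Q1 Q2 : tapes -> Prop) :
  runs p ts B1 Q1 -> (forall us, Q1 us -> runs q us B2 Q2) ->
  runs (Seq p q) ts (B1 + B2) Q2.
Proof.
move=> [t [us [tB pus /[swap] /[apply]]]] [t' [vs [t'B qvs Qvs]]].
exists (t + t'), vs; split=> //; first exact: leq_add.
exact: exec_seq qvs.
Qed.

Lemma runs_if (b : syms -> bool) p q ts B (Q : tapes -> Prop) :
  runs (if b (reads ts) then p else q) ts B Q -> runs (If b p q) ts B.+1 Q.
Proof. by move=> [t [us [tB pus Qus]]]; exists t.+1, us; split=> //; constructor. Qed.

(** The invariant is indexed by the rounds done, and their number [n] is exact. Each round costs [B]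
    steps and a test; the failing test costs one more. *)
Lemma runs_while (b : syms -> bool) p n B (J : nat -> tapes -> Prop) ts :
  J 0 ts ->
  (forall i us, i < n -> J i us -> b (reads us) /\ runs p us B (J i.+1)) ->
  (forall us, J n us -> b (reads us) = false) ->
  runs (While b p) ts (n * B.+1).+1 (J n).
Proof.
move=> J0 Jstep Jn.
suff H k us : k <= n -> J (n - k) us -> runs (While b p) us (k * B.+1).+1 (J n).
  by apply: H; rewrite ?subnn.
elim: k us => [|k IH] us kn Jus.
  rewrite subn0 in Jus; exists 1, us; split=> //; constructor; exact: Jn.
have [bT [t [vs [tB pvs Jvs]]]] : b (reads us) /\ runs p us B (J (n - k.+1).+1).
  by apply: Jstep Jus; lia.
rewrite subnSK // in Jvs.
have [t' [ws [t'B qws Jws]]] := IH vs (ltnW kn) Jvs.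
exists (t + t').+1, ws; split=> //; last exact: exec_loop qws.
by nia.
Qed.

End Programs.

Section Decide.
Variables (S W : finType) (K : nat) (p : prog (S + W)%type K).
Variable test : {ffun 'I_K.+1 -> option (S + W)} -> bool.

Definition prog_machine : machine S :=
  @Machine S (option (pos p) + bool)%type W K (inl (Some (entry p)))
    (fun s => if s is inr b then Some b else None)
    (fun s sy => match s with
       | inl (Some s) => let: (o, a) := next s sy in (inl o, a)
       | inl None => (inr (test sy), stay sy)
       | inr b => (inr b, stay sy)
       end).

Lemma verdict_iter c n b :
  verdict c.1 = Some b -> verdict (iter n (@step _ prog_machine) c).1 = Some b.
Proof.
move=> cb; have cE : step c = c by move: c cb => [q us] /= qb; rewrite /step /= qb.
by elim: n => //= n IH; rewrite -iterS iterSr cE.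
Qed.

(** The strict bound [B < T] pays for the step that evaluates [test]; later steps change nothing, as
    final configurations are fixed. *)
Lemma outcome_prog w B T b :
  runs p (init prog_machine w).2 B (fun us => test (reads us) = b) ->
  B < T -> outcome prog_machine w T = Some b.
Proof.
move=> [t [us [tB pus ub]]] BT; rewrite /outcome.
have -> : T = (T - t.+1) + (1 + t) by lia.
rewrite !iterD; apply: verdict_iter.
have := exec_embedded pus (h := @step _ prog_machine) (f := fun s => inl (Some s)) (e := inl None).
rewrite /init /= in pus *; move=> -> /=; last first.
  by move=> s vs /=; case: next => [[]].
by rewrite -[[ffun _ => _]]/(reads us) ub.
Qed.

End Decide.

(** * Tapes, counters and loops *)

(* A tape represents a counter in unary ([One]s above a [Bot]), a position
   variable (the input between [Bot] and [End], with the head on the position),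
   or a set of positions: [Cell o n] holds the membership bit in the current set
   and the one in the set being computed.  [Mark a] is an input symbol [a] to
   which a head will return. *)
Inductive glyph (S : Type) := Bot | End | One | Cell of bool & bool | Mark of S.
Arguments Bot {S}. Arguments End {S}. Arguments One {S}. Arguments Cell {S}.

Definition glyph_code S (g : glyph S) : 'I_3 + bool * bool + S :=
  match g with
  | Bot => inl (inl (inord 0))
  | End => inl (inl (inord 1))
  | One => inl (inl (inord 2))
  | Cell a b => inl (inr (a, b))
  | Mark a => inr a
  end.

Definition glyph_decode S (c : 'I_3 + bool * bool + S) : glyph S :=
  match c with
  | inl (inl i) => nth One [:: Bot; End] i
  | inl (inr (a, b)) => Cell a b
  | inr a => Mark a
  end.

Lemma glyph_codeK S : cancel (@glyph_code S) (@glyph_decode S).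
Proof. by case=> //=; rewrite inordK. Qed.

HB.instance Definition _ (S : finType) :=
  Finite.copy (glyph S) (can_type (@glyph_codeK S)).

Section Layout.
Variables (C : Type) (N : nat).
Implicit Type F : nat -> option C.

(** Exactly the cells [0] to [N.+1] are listed. As heads stay among them, moves and writes give
    equalities of tapes, with no normalisation of trailing blanks. *)
Definition ztape F p : tape C :=
  Tape (rev (mkseq F p)) (F p) (mkseq (fun i => F (p.+1 + i)) (N.+1 - p)).

Definition fset F p c : nat -> option C := fun i => if i == p then c else F i.

Lemma eq_in_mkseq T (f g : nat -> T) n : (forall i, i < n -> f i = g i) -> mkseq f n = mkseq g n.
Proof. by move=> fg; apply/eq_in_map => i; rewrite mem_iota => /fg. Qed.

Lemma mkseq_rcons T (f : nat -> T) n : mkseq f n.+1 = rcons (mkseq f n) (f n).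
Proof. by rewrite /mkseq -addn1 iotaD map_cat cats1. Qed.

Lemma mkseq_cons T (f : nat -> T) n : mkseq f n.+1 = f 0 :: mkseq (fun i => f i.+1) n.
Proof. by rewrite /mkseq /= -[iota 1 _]/(iota (1 + 0) _) iotaDl -map_comp. Qed.

Lemma ztape_ext F G p :
  p <= N.+1 -> (forall i, i <= N.+1 -> F i = G i) -> ztape F p = ztape G p.
Proof.
move=> pN FG; rewrite /ztape FG //.
by congr Tape; [congr rev|]; apply: eq_in_mkseq => i iN; apply: FG; lia.
Qed.

Lemma ztape_stay F p c : act (ztape F p) (c, Stay) = ztape (fset F p c) p.
Proof.
rewrite /ztape /= /fset eqxx.
congr Tape; [congr rev|]; apply: eq_in_mkseq => i iN; case: ifP => //; lia.
Qed.

Lemma ztape_right F p c :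
  p <= N -> act (ztape F p) (c, MoveRight) = ztape (fset F p c) p.+1.
Proof.
move=> pN; rewrite /ztape subSS subSn // mkseq_cons /=.
have -> : mkseq (fset F p c) p.+1 = rcons (mkseq F p) c.
  rewrite mkseq_rcons /fset eqxx; congr rcons.
  by apply: eq_in_mkseq => i ip; case: ifP => //; lia.
rewrite rev_rcons addn0; congr Tape; first by rewrite /fset gtn_eqF.
by apply: eq_in_mkseq => i iN; rewrite /fset; case: eqP => [|_]; [lia|congr F; lia].
Qed.

Lemma ztape_left F p c :
  p <= N -> act (ztape F p.+1) (c, MoveLeft) = ztape (fset F p.+1 c) p.
Proof.
move=> pN; rewrite /ztape /= mkseq_rcons rev_rcons /=.
rewrite subSS subSn // mkseq_cons; congr (Tape _ _ (_ :: _)).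
- by congr rev; apply: eq_in_mkseq => i iN; rewrite /fset; case: ifP => //; lia.
- by rewrite /fset ltn_eqF.
- by rewrite addn0 /fset eqxx.
by apply: eq_in_mkseq => i iN; rewrite /fset; case: ifP; [lia|move=> _; congr F; lia].
Qed.

End Layout.

Section Tapes.
Variables (C : finType) (K : nat).
Local Notation index := 'I_K.+1.
Local Notation tapes := (index -> tape C).

Definition on (k : index) (g : option C -> option C * move) : prog C K :=
  Act (fun sy k' => if k' == k then g (sy k') else (sy k', Stay)).

Definition skip : prog C K := Act (@stay _ _).

Lemma runs_on k g ts (Q : tapes -> Prop) :
  (forall us, us k = act (ts k) (g (scanned (ts k))) ->
     (forall k', k' != k -> us k' = ts k') -> Q us) ->
  runs (on k g) ts 1 Q.
Proof.
move=> HQ; apply: runs_act; apply: HQ; first by rewrite eqxx ffunE.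
by move=> k' /negPf ->; rewrite ffunE; case: (ts k').
Qed.

Lemma runs_skip ts (Q : tapes -> Prop) : Q ts -> runs skip ts 1 Q.
Proof. by move=> Qts; apply: runs_act; rewrite act_stay. Qed.

End Tapes.

Section Counters.
Variables (S : finType) (K : nat).
Local Notation cell := (S + glyph S)%type.
Local Notation index := 'I_K.+1.
Local Notation tapes := (index -> tape cell).

Definition is_bot (c : option cell) := if c is Some (inr Bot) then true else false.
Definition is_end (c : option cell) := if c is Some (inr End) then true else false.
Definition is_mark (c : option cell) := if c is Some (inr (Mark _)) then true else false.

(** The head is on the topmost [One]. The cells to its right are left free, because [pop] leaves
    blanks there and the tape may initially carry other symbols. *)
Definition counter (t : tape cell) v : Prop :=
  scanned t :: leftward t = rcons (nseq v (Some (inr One))) (Some (inr Bot)).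

Lemma counter_bot t v : counter t v -> is_bot (scanned t) = (v == 0).
Proof. by case: t v => l c r [|v] [-> _]. Qed.

Definition push (k : index) : prog cell K :=
  Seq (on k (fun c => (c, MoveRight))) (on k (fun=> (Some (inr One), Stay))).
Definition pop (k : index) : prog cell K := on k (fun=> (None, MoveLeft)).
Definition positive (k : index) (sy : {ffun index -> option cell}) := ~~ is_bot (sy k).
Definition clear (k : index) : prog cell K := While (positive k) (pop k).

Lemma runs_push k ts v (Q : tapes -> Prop) :
  counter (ts k) v ->
  (forall us, counter (us k) v.+1 -> (forall k', k' != k -> us k' = ts k') -> Q us) ->
  runs (push k) ts 2 Q.
Proof.
move=> tv HQ; apply: (@runs_seq _ _ _ _ _ 1 1); first by apply: runs_on => us u1 u2; exact: (conj u1 u2).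
move=> us [u1 u2]; apply: runs_on => vs v1 v2; apply: HQ; last first.
  by move=> k' k'k; rewrite v2 // u2.
by move: tv; rewrite v1 u1 /counter; case: (ts k) => l c r /= ->.
Qed.

Lemma runs_pop k ts v (Q : tapes -> Prop) :
  counter (ts k) v.+1 ->
  (forall us, counter (us k) v -> (forall k', k' != k -> us k' = ts k') -> Q us) ->
  runs (pop k) ts 1 Q.
Proof.
move=> tv HQ; apply: runs_on => us u1 u2; apply: HQ => //.
move: tv; rewrite u1 /counter; case: (ts k) => l c r /= [_ ->].
by case: v.
Qed.

Lemma positiveE k (ts : tapes) v : counter (ts k) v -> positive k (reads ts) = (0 < v).
Proof. by move=> tv; rewrite /positive ffunE (counter_bot tv) lt0n. Qed.

Lemma runs_clear k ts v (Q : tapes -> Prop) :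
  counter (ts k) v ->
  (forall us, counter (us k) 0 -> (forall k', k' != k -> us k' = ts k') -> Q us) ->
  runs (clear k) ts (2 * v).+1 Q.
Proof.
move=> tv HQ.
apply: (runs_weaken (runs_while (n := v) (B := 1)
  (J := fun i us => counter (us k) (v - i) /\ forall k', k' != k -> us k' = ts k') _ _ _)).
- by rewrite subn0.
- move=> i us iv [ui uk]; split; first by rewrite (positiveE ui); lia.
  have E : v - i = (v - i.+1).+1 by lia.
  rewrite E in ui; apply: (runs_pop ui) => vs v1 v2; split => // k' k'k.
  by rewrite v2 // uk.
- by move=> us [ui _]; rewrite (positiveE ui) subnn.
- by lia.
- by move=> us [ui uk]; apply: HQ; rewrite // -(subnn v).
Qed.

End Counters.

(** * A term language for polynomial time and its denotation *)

Inductive tm (S : Type) :=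
| Var of nat
| Sym of pred S & nat
| Elem of nat & nat
| Cst of nat
| Add of tm S & tm S
| IfLt of tm S & tm S & tm S & tm S
| Sum of tm S
| Iter of tm S & tm S.
Arguments Var {S}. Arguments Elem {S}. Arguments Cst {S}.

Section Meaning.
Variables (S : Type) (s0 : S) (w : seq S).
Local Notation N := (size w).

(** Variables are de Bruijn levels: a binder appends to its environment, so the tape of a variable
    is fixed by its binding depth. In [Iter f g] the body [f] binds the round number, a position and
    the current set, while [g] binds the set reached from the empty one after [N] rounds. *)
Fixpoint den (e : tm S) (rho : seq nat) (sigma : seq (pred nat)) : nat :=
  match e with
  | Var i => nth 0 rho i
  | Sym P i => P (nth s0 w (nth 0 rho i))
  | Elem j i => nth xpred0 sigma j (nth 0 rho i)
  | Cst n => n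
  | Add e1 e2 => den e1 rho sigma + den e2 rho sigma
  | IfLt e1 e2 e3 e4 =>
      if den e1 rho sigma < den e2 rho sigma then den e3 rho sigma else den e4 rho sigma
  | Sum e => \sum_(0 <= x < N) den e (rcons rho x) sigma
  | Iter f g =>
      den g rho (rcons sigma (iteri N (fun t X x =>
        (x < N) && (0 < den f (rcons (rcons rho t) x) (rcons sigma X))) xpred0))
  end.

(** [IfLt] takes the sum of its branches instead of their maximum, so that the bound is built from
    sums and products only and is a polynomial. *)
Fixpoint value_bound (e : tm S) n : nat :=
  match e with
  | Var _ => n
  | Sym _ _ | Elem _ _ => 1
  | Cst c => c
  | Add e1 e2 => value_bound e1 n + value_bound e2 n
  | IfLt _ _ e3 e4 => value_bound e3 n + value_bound e4 n
  | Sum e => n * value_bound e n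
  | Iter _ g => value_bound g n
  end.

Lemma den_bound e rho sigma : all (fun x => x < N) rho -> den e rho sigma <= value_bound e N.
Proof.
elim: e rho sigma => [i|P i|j i|n|e1 IH1 e2 IH2|e1 _ e2 _ e3 IH3 e4 IH4|e IH|f _ g IH]
  rho sigma rhoN //=; try exact: leq_b1.
- case: (ltnP i (size rho)) => [ir|ri]; last by rewrite nth_default.
  by apply: ltnW; apply: (all_nthP 0 rhoN).
- by apply: leq_add; [apply: IH1|apply: IH2].
- by case: ifP => _; [rewrite (leq_trans (IH3 _ _ rhoN)) ?leq_addr|
    rewrite (leq_trans (IH4 _ _ rhoN)) ?leq_addl].
- rewrite -[N in N * _]subn0 -sum_nat_const_nat !big_nat leq_sum // => x /andP[_ xN].
  by apply: IH; rewrite all_rcons xN.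
- exact: IH.
Qed.

(** Counters are emptied one cell at a time, which is where [value_bound] enters. The numerical
    constants are rounded up. *)
Fixpoint cost (e : tm S) n : nat :=
  match e with
  | Var _ | Sym _ _ | Elem _ _ => 20 * n + 20
  | Cst c => 2 * c + 1
  | Add e1 e2 => cost e1 n + cost e2 n
  | IfLt e1 e2 e3 e4 => cost e1 n + cost e2 n + cost e3 n + cost e4 n +
      10 * (value_bound e1 n + value_bound e2 n) + 20
  | Sum e => n * (cost e n + 10) + 20
  | Iter f g => n * (n * (cost f n + 2 * value_bound f n + 20 * n + 50) + 20 * n + 50) +
      cost g n + 20 * n + 50
  end.

End Meaning.

Definition polynomially_bounded (f : nat -> nat) :=
  exists p : {poly nat}, forall n, f n <= p.[n]%R.

Section PolynomialBounds.
Import GRing.Theory.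

Lemma pbound_cst c : polynomially_bounded (fun=> c).
Proof. by exists (c%:P)%R => n; rewrite hornerC. Qed.

Lemma pbound_id : polynomially_bounded id.
Proof. by exists 'X%R => n; rewrite hornerX. Qed.

Lemma pbound_add f g : polynomially_bounded f -> polynomially_bounded g ->
  polynomially_bounded (fun n => f n + g n).
Proof. by move=> [p fp] [q gq]; exists (p + q)%R => n; rewrite hornerD leq_add. Qed.

Lemma pbound_mul f g : polynomially_bounded f -> polynomially_bounded g ->
  polynomially_bounded (fun n => f n * g n).
Proof. by move=> [p fp] [q gq]; exists (p * q)%R => n; rewrite hornerM leq_mul. Qed.

End PolynomialBounds.

Ltac pbound := repeat first [ apply: pbound_cst | apply: pbound_id | assumption
  | apply: pbound_add | apply: pbound_mul ].

Lemma pbound_value S (e : tm S) : polynomially_bounded (value_bound e).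
Proof. by elim: e => /= *; pbound. Qed.

Lemma pbound_cost S (e : tm S) : polynomially_bounded (cost e).
Proof. by elim: e => /= *; pbound; apply: pbound_value. Qed.

(** * Compilation of terms into programs *)

Section Compile.
Variables (S : finType) (H : nat).
Local Notation cell := (S + glyph S)%type.
Local Notation K := (3 * H).
Local Notation index := 'I_K.+1.
Local Notation tapes := (index -> tape cell).

(** Tape [0] is the input. Each [i < H] owns three further tapes: [j = 0] for a position variable,
    [1] for a counter, [2] for a set variable. *)
Definition tp j i : index := inord (1 + 3 * i + j).

Lemma tp_eq j j' i i' : j < 3 -> j' < 3 -> i < H -> i' < H ->
  (tp j i == tp j' i') = (j == j') && (i == i').
Proof.
move=> j3 j'3 iH i'H; rewrite -val_eqE /= !inordK; [|lia..].
by apply/eqP/andP => [E|[/eqP-> /eqP->] //]; split; apply/eqP; lia.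
Qed.

Definition to_mark (c : option cell) : option cell :=
  if c is Some (inl a) then Some (inr (Mark a)) else c.
Definition un_mark (c : option cell) : option cell :=
  if c is Some (inr (Mark a)) then Some (inl a) else c.

Definition right k : prog cell K := on k (fun c => (c, MoveRight)).
Definition left k : prog cell K := on k (fun c => (c, MoveLeft)).

(* Marks the cell under head [k], walks back to the left end doing [b] at each
   cell passed, does [m], and returns to the mark doing [r] at each step. *)
Definition walk k (b m r : prog cell K) : prog cell K :=
  Seq (on k (fun c => (to_mark c, MoveLeft)))
  (Seq (While (fun sy => ~~ is_bot (sy k)) (Seq b (left k)))
  (Seq m
  (Seq (While (fun sy => ~~ is_mark (sy k)) (Seq r (right k)))
  (on k (fun c => (un_mark c, Stay)))))).

(** With [g = id] this binds a position variable; with another [g] it sweeps a set tape. The head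
    starts and ends at the left end. *)
Definition loop k (g : option cell -> option cell) (b : prog cell K) : prog cell K :=
  Seq (right k)
  (Seq (While (fun sy => ~~ is_end (sy k)) (Seq b (on k (fun c => (g c, MoveRight)))))
  (While (fun sy => ~~ is_bot (sy k)) (left k))).

(** The head on the set tape mirrors the walk: it moves right while head [k] moves left, and so
    stands on the desired position when [k] is at the left end. The initial [right j] compensates
    for the first move of [walk], which is made without [b]. *)
Definition with_set (j : index) k (m : prog cell K) : prog cell K :=
  Seq (right j) (walk k (right j) m (left j)).

Definition write_new b (c : option cell) : option cell :=
  if c is Some (inr (Cell o _)) then Some (inr (Cell o b)) else c.
Definition commit (c : option cell) : option cell :=
  if c is Some (inr (Cell _ n)) then Some (inr (Cell n false)) else c.
Definition erase (c : option cell) : option cell :=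
  if c is Some (inr (Cell _ _)) then Some (inr (Cell false false)) else c.
Definition old_bit (c : option cell) := if c is Some (inr (Cell o _)) then o else false.

(** The code adds the value of the term to counter [a]; the counters above [a] are scratch, zero
    before and after. [d] and [k] count the bound position and set variables and thus name the next
    free tapes. In [Iter] new membership bits go to the second component of the cells, so that the
    old set stays readable until [commit]. *)
Fixpoint compile (e : tm S) (d k a : nat) : prog cell K :=
  match e with
  | Var i => walk (tp 0 i) (push _ (tp 1 a)) (skip _ _) (skip _ _)
  | Sym P i => If (fun sy => if sy (tp 0 i) is Some (inl s) then P s else false)
                 (push _ (tp 1 a)) (skip _ _)
  | Elem j i => with_set (tp 2 j) (tp 0 i)
                 (If (fun sy => old_bit (sy (tp 2 j))) (push _ (tp 1 a)) (skip _ _))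
  | Cst n => iter n (fun p => Seq (push _ (tp 1 a)) p) (skip _ _)
  | Add e1 e2 => Seq (compile e1 d k a) (compile e2 d k a)
  | IfLt e1 e2 e3 e4 =>
      Seq (compile e1 d k a.+1)
      (Seq (compile e2 d k a.+2)
      (Seq (While (fun sy => positive (tp 1 a.+1) sy && positive (tp 1 a.+2) sy)
             (Seq (pop _ (tp 1 a.+1)) (pop _ (tp 1 a.+2))))
      (If (positive (tp 1 a.+2))
        (Seq (clear _ (tp 1 a.+2)) (compile e3 d k a))
        (Seq (clear _ (tp 1 a.+1)) (compile e4 d k a)))))
  | Sum e => loop (tp 0 d) id (compile e d.+1 k a)
  | Iter f g =>
      Seq (loop (tp 0 d) id
        (Seq (loop (tp 0 d.+1) id
          (Seq (compile f d.+2 k.+1 a.+1)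
            (If (positive (tp 1 a.+1))
              (Seq (clear _ (tp 1 a.+1)) (with_set (tp 2 k) (tp 0 d.+1)
                 (on (tp 2 k) (fun c => (write_new true c, Stay)))))
              (with_set (tp 2 k) (tp 0 d.+1)
                 (on (tp 2 k) (fun c => (write_new false c, Stay)))))))
          (loop (tp 2 k) commit (skip _ _))))
      (Seq (compile g d k.+1 a) (loop (tp 2 k) erase (skip _ _)))
  end.

Fixpoint fits (e : tm S) (d k a : nat) : bool :=
  match e with
  | Var i | Sym _ i => i < d
  | Elem j i => (j < k) && (i < d)
  | Cst _ => true
  | Add e1 e2 => fits e1 d k a && fits e2 d k a
  | IfLt e1 e2 e3 e4 => [&& a.+2 < H, fits e1 d k a.+1, fits e2 d k a.+2,
      fits e3 d k a & fits e4 d k a]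
  | Sum e => (d < H) && fits e d.+1 k a
  | Iter f g => [&& d.+1 < H, k < H, a.+1 < H, fits f d.+2 k.+1 a.+1 & fits g d k.+1 a]
  end.

Section Loops.
Variable N : nat.

Definition framed (F : nat -> option cell) :=
  [/\ F 0 = Some (inr Bot), F N.+1 = Some (inr End)
    & forall q, 0 < q <= N -> is_bot (F q) = false /\ is_end (F q) = false].

Definition replace (ts : tapes) k t : tapes := fun k' => if k' == k then t else ts k'.

(** A frame condition: [loop] and [walk] move head [k] themselves, and assertions independent of
    tape [k] survive these moves. *)
Definition blind k (P : tapes -> Prop) :=
  forall us vs, (forall k', k' != k -> us k' = vs k') -> P us -> P vs.

Lemma runs_loop k F g b B (G : nat -> tapes -> Prop) ts :
  framed F -> (forall q, 0 < q <= N -> is_bot (g (F q)) = false /\ is_end (g (F q)) = false) ->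
  (forall x, blind k (G x)) ->
  ts k = ztape N F 0 -> G 0 ts ->
  (forall x us, x < N -> G x us -> us k = ztape N (fun q => if 0 < q <= x then g (F q) else F q) x.+1 ->
     runs b us B (fun vs => G x.+1 vs /\ vs k = us k)) ->
  runs (loop k g b) ts (N * (B + 4) + 10)
    (fun us => us k = ztape N (fun q => if 0 < q <= N then g (F q) else F q) 0 /\ G N us).
Proof.
move=> [F0 FE Fm] Fg Gk tk G0 Gstep.
set Fx := fun x q => if 0 < q <= x then g (F q) else F q.
apply: (runs_le (B := 1 + ((N * (B + 1).+1).+1 + (N.+1 * 2).+1))); [|lia].
apply: (runs_seq (Q1 := fun us => us k = ztape N (Fx 0) 1 /\ G 0 us)).
  apply: runs_on => us uk uo; split; last by apply: Gk G0 => k' /uo.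
  by rewrite uk tk ztape_right.
move=> us [uk Gu].
apply: (runs_seq (Q1 := fun us => us k = ztape N (Fx N) N.+1 /\ G N us)).
  apply: (runs_while (n := N) (B := B + 1)
    (J := fun i us => us k = ztape N (Fx i) i.+1 /\ G i us)) => //.
    move=> x vs xN [vk Gv]; split.
      by rewrite ffunE vk /= /Fx ltnn ?andbF (proj2 (Fm _ _)).
    apply: (runs_seq (Gstep _ _ xN Gv vk)) => ws [Gw wk].
    apply: runs_on => zs zk zo; split; last by apply: Gk Gw => k' /zo.
    rewrite zk wk vk ztape_right //; apply: ztape_ext => [|q qN]; first by lia.
    rewrite /fset /Fx /=.
    case: (q =P x.+1) => [->|qx]; first by rewrite !ltnn ?andbF ltnS leqnn.
    by congr (if _ then _ else _); lia.
  by move=> vs [vk _]; rewrite ffunE vk /= /Fx ltnn ?andbF FE.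
move=> vs [vk Gv].
apply: (runs_weaken (runs_while (n := N.+1) (B := 1)
    (J := fun i us => us k = ztape N (Fx N) (N.+1 - i) /\ G N us) _ _ _)) => //.
- move=> i ws iN [wk Gw]; have E : N.+1 - i = (N - i).+1 by lia.
  rewrite E in wk; split.
    rewrite ffunE wk /= /Fx.
    case: i iN wk E => [|i] iN wk E; first by rewrite subn0 ltnn ?andbF FE.
    by case: ifP => qN; [rewrite (proj1 (Fg _ _)) //|]; lia.
  apply: runs_on => zs zk zo; split; last by apply: Gk Gw => k' /zo.
  rewrite zk wk ztape_left; last by lia.
  rewrite subSS; apply: ztape_ext => [|q qN]; first by lia.
  by rewrite /fset; case: (q =P _) => // ->.
- by move=> ws [wk _]; rewrite ffunE wk subnn /= /Fx /= F0.
- by move=> ws; rewrite subnn.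
Qed.

(** [b] runs [x] times but [r] runs [x.+1] times: the move that leaves the mark precedes the first
    [b], whereas the return starts at the left end and repeats [r] up to the mark. *)
Lemma runs_walk k x F b m r BB BM BR (G G' : nat -> tapes -> Prop) ts :
  framed F -> (forall q, 0 < q <= N -> exists s, F q = Some (inl s)) -> x < N ->
  (forall i, blind k (G i)) -> (forall i, blind k (G' i)) ->
  ts k = ztape N F x.+1 -> G 0 ts ->
  (forall i us, i < x -> G i us -> runs b us BB (fun vs => G i.+1 vs /\ vs k = us k)) ->
  (forall us, G x us -> runs m us BM (fun vs => G' 0 vs /\ vs k = us k)) ->
  (forall i us, i < x.+1 -> G' i us -> runs r us BR (fun vs => G' i.+1 vs /\ vs k = us k)) ->
  runs (walk k b m r) ts (x * (BB + 2) + x.+1 * (BR + 2) + BM + 4)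
    (fun us => us k = ztape N F x.+1 /\ G' x.+1 us).
Proof.
move=> [F0 FE Fm] Fl xN Gk G'k tk G0 Gb Gm Gr.
have [s Fs] : exists s, F x.+1 = Some (inl s) by apply: Fl.
set F' := fset F x.+1 (Some (inr (Mark s))).
apply: (runs_le (B := 1 + ((x * (BB + 1).+1).+1 + (BM + ((x.+1 * (BR + 1).+1).+1 + 1))))); [|lia].
apply: (runs_seq (Q1 := fun us => us k = ztape N F' x /\ G 0 us)).
  apply: runs_on => us uk uo; split; last by apply: Gk G0 => k' /uo.
  by rewrite uk tk [scanned _]/= Fs [to_mark _]/= ztape_left // ltnW.
move=> us [uk Gu].
apply: (runs_seq (Q1 := fun us => us k = ztape N F' 0 /\ G x us)).
  apply: (runs_weaken (runs_while (n := x) (B := BB + 1)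
    (J := fun i us => us k = ztape N F' (x - i) /\ G i us) _ _ _)) => //.
  - by rewrite subn0.
  - move=> i vs ix [vk Gv]; have E : x - i = (x - i.+1).+1 by lia.
    rewrite E in vk; split.
      rewrite ffunE vk /= /F' /fset; case: eqP => [|_] //.
      by rewrite (proj1 (Fm _ _)) //; lia.
    apply: (runs_seq (Gb _ _ ix Gv)) => ws [Gw wk].
    apply: runs_on => zs zk zo; split; last by apply: Gk Gw => k' /zo.
    rewrite zk wk vk ztape_left; last by lia.
    apply: ztape_ext => [|q qN]; first by lia.
    by rewrite /fset; case: (q =P _) => // ->.
  - by move=> vs [vk _]; rewrite ffunE vk subnn /= /F' /fset /= F0.
  - by move=> vs; rewrite subnn.
move=> vs [vk Gv].
apply: (runs_seq (Q1 := fun us => us k = ztape N F' 0 /\ G' 0 us)).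
  by apply: (runs_weaken (Gm _ Gv)) => // ws [Gw wk]; rewrite wk.
move=> ws [wk Gw].
apply: (runs_seq (Q1 := fun us => us k = ztape N F' x.+1 /\ G' x.+1 us)).
  apply: (runs_while (n := x.+1) (B := BR + 1)
    (J := fun i us => us k = ztape N F' i /\ G' i us)) => //.
    move=> i zs ix [zk Gz]; split.
      rewrite ffunE zk /= /F' /fset; case: eqP => [|_]; first by lia.
      case: i ix {zk Gz} => [|i] ix; first by rewrite F0.
      by have [|s' ->] := Fl i.+1; [lia|].
    apply: (runs_seq (Gr _ _ ix Gz)) => ys [Gy yk].
    apply: runs_on => xs xk xo; split; last by apply: G'k Gy => k' /xo.
    rewrite xk yk zk ztape_right; last by lia.
    apply: ztape_ext => [|q qN]; first by lia.
    by rewrite /fset; case: (q =P _) => // ->.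
  by move=> zs [zk _]; rewrite ffunE zk /= /F' /fset eqxx.
move=> zs [zk Gz].
apply: runs_on => ys yk yo; split; last by apply: G'k Gz => k' /yo.
have E : un_mark (scanned (ztape N F' x.+1)) = Some (inl s) by rewrite /= /F' /fset eqxx.
rewrite yk zk E ztape_stay; apply: ztape_ext => [|q qN]; first by lia.
by rewrite /F' /fset; case: (q =P _) => // ->.
Qed.

End Loops.
End Compile.

Section Correctness.
Variables (S : finType) (H : nat) (s0 : S) (w : seq S).
Local Notation N := (size w).
Local Notation cell := (S + glyph S)%type.
Local Notation K := (3 * H).
Local Notation index := 'I_K.+1.
Local Notation tapes := (index -> tape cell).
Local Notation tp := (@tp H).

Definition input_cell q : option cell :=
  if q == 0 then Some (inr Bot) else if q == N.+1 then Some (inr End)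
  else Some (inl (nth s0 w q.-1)).

Definition set_cell (X : nat -> bool * bool) q : option cell :=
  if q == 0 then Some (inr Bot) else if q == N.+1 then Some (inr End)
  else Some (inr (Cell (X q.-1).1 (X q.-1).2)).

Lemma input_framed : framed N input_cell.
Proof.
split=> // [|q qN]; first by rewrite /input_cell /= eqxx.
by rewrite /input_cell !ifF //; lia.
Qed.

Lemma input_letter q : 0 < q <= N -> exists s, input_cell q = Some (inl s).
Proof. by move=> qN; rewrite /input_cell !ifF; [eexists|lia..]. Qed.

Lemma set_framed X : framed N (set_cell X).
Proof.
split=> // [|q qN]; first by rewrite /set_cell /= eqxx.
by rewrite /set_cell !ifF //; lia.
Qed.

Local Notation vtape := (ztape N input_cell).
Local Notation stape X := (ztape N (set_cell X)).

Lemma runs_with_set j k x m BM X X' (P : tapes -> Prop) (ts : tapes) :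
  j != k -> x < N -> blind j P -> blind k P ->
  ts j = stape X 0 -> ts k = vtape x.+1 ->
  (forall us, us j = stape X x.+1 ->
     (forall k', k' != j -> k' != k -> us k' = ts k') ->
     runs m us BM (fun vs => [/\ P vs, vs j = stape X' x.+1 & vs k = us k])) ->
  runs (with_set j k m) ts (6 * N + BM + 10)
    (fun us => [/\ P us, us j = stape X' 0 & us k = ts k]).
Proof.
move=> jk xN Pj Pk tj tk Hm.
pose G i (us : tapes) := us j = stape X i.+1 /\ forall k', k' != j -> k' != k -> us k' = ts k'.
pose G' i (us : tapes) := us j = stape X' (x.+1 - i) /\ P us.
apply: (@runs_le _ _ (1 + (x * (1 + 2) + x.+1 * (1 + 2) + BM + 4))); last by lia.
apply: (runs_seq (Q1 := fun us => us k = vtape x.+1 /\ G 0 us)).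
  apply: runs_on => us uj uo; split; first by rewrite uo // eq_sym.
  split; last by move=> k' k'j k'k; rewrite uo.
  by rewrite uj tj ztape_right.
move=> us [uk Gu].
apply: (runs_weaken (runs_walk (F := input_cell) (G := G) (G' := G') (x := x) input_framed
  input_letter xN _ _ uk Gu _ _ _)) => //.
- move=> i vs ws vw [v1 v2]; split; first by rewrite -vw.
  by move=> k' k'j k'k; rewrite -vw // v2.
- move=> i vs ws vw [v1 v2]; split; first by rewrite -vw.
  exact: Pk v2.
- move=> i vs ix [vj vo]; apply: runs_on => ws wj wo; split; last by rewrite wo // eq_sym.
  split; last by move=> k' k'j k'k; rewrite wo // vo.
  rewrite wj vj ztape_right; last by lia.
  by apply: ztape_ext => [|q qN]; [lia|rewrite /fset; case: (q =P _) => // ->].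
- move=> vs [vj vo]; apply: (runs_weaken (Hm vs vj vo)) => // ws [Pw wj wk].
  by split=> //; split=> //; rewrite subn0.
- move=> i vs ix [vj Pv]; apply: runs_on => ws wj wo; split; last by rewrite wo // eq_sym.
  split; last by apply: Pj Pv => k' /wo.
  have E : x.+1 - i = (x - i).+1 by lia.
  rewrite wj vj E subSS ztape_left; last by lia.
  by apply: ztape_ext => [|q qN]; [lia|rewrite /fset; case: (q =P _) => // ->].
- by move=> vs [vk [vj Pv]]; rewrite subnn in vj; split; rewrite ?vk.
Qed.

Definition no_bits (x : nat) := (false, false).

(* Tape cell [0] is the left end, where the heads of unbound variables rest. *)
Definition vpos (rho : seq nat) i := if i < size rho then (nth 0 rho i).+1 else 0.

(** Free tapes are specified as well: heads of unbound variables are at the left end and unbound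
    sets are empty. Binding a variable thus needs no initialisation, but every scope must restore
    this state. *)
Definition rep (rho : seq nat) (sigma : seq (nat -> bool * bool)) (c : nat -> nat) (ts : tapes) :=
  forall i, i < H -> [/\ ts (tp 0 i) = vtape (vpos rho i), counter (ts (tp 1 i)) (c i)
                       & ts (tp 2 i) = stape (nth no_bits sigma i) 0].

Lemma rep_acc i0 c' rho sigma c us (vs : tapes) : rep rho sigma c us -> i0 < H ->
  (forall k, k != tp 1 i0 -> vs k = us k) -> counter (vs (tp 1 i0)) (c' i0) ->
  (forall i, i < H -> i != i0 -> c' i = c i) -> rep rho sigma c' vs.
Proof.
move=> R i0H vu v0 cc i iH; have [ui uc us'] := R i iH.
split; try by rewrite vu // tp_eq.
by have [->//|ii0] := eqVneq i i0; rewrite vu ?cc // tp_eq // (negPf ii0).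
Qed.

Lemma rep_var i0 rho' rho sigma c us (vs : tapes) : rep rho sigma c us -> i0 < H ->
  (forall k, k != tp 0 i0 -> vs k = us k) -> vs (tp 0 i0) = vtape (vpos rho' i0) ->
  (forall i, i < H -> i != i0 -> vpos rho' i = vpos rho i) -> rep rho' sigma c vs.
Proof.
move=> R i0H vu v0 cc i iH; have [ui uc us'] := R i iH.
split; try by rewrite vu // tp_eq.
by have [->//|ii0] := eqVneq i i0; rewrite vu ?cc // tp_eq // (negPf ii0).
Qed.

Lemma rep_set i0 sigma' rho sigma c us (vs : tapes) : rep rho sigma c us -> i0 < H ->
  (forall k, k != tp 2 i0 -> vs k = us k) -> vs (tp 2 i0) = stape (nth no_bits sigma' i0) 0 ->
  (forall i, i < H -> i != i0 -> nth no_bits sigma' i = nth no_bits sigma i) ->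
  rep rho sigma' c vs.
Proof.
move=> R i0H vu v0 cc i iH; have [ui uc us'] := R i iH.
split; try by rewrite vu // tp_eq.
by have [->//|ii0] := eqVneq i i0; rewrite vu ?cc // tp_eq // (negPf ii0).
Qed.

Lemma rep_ext rho sigma c c' us : (forall i, c i = c' i) -> rep rho sigma c us -> rep rho sigma c' us.
Proof. by move=> /funext ->. Qed.

Lemma vpos_rcons rho x i : i != size rho -> vpos (rcons rho x) i = vpos rho i.
Proof. by rewrite /vpos size_rcons nth_rcons ltnS leq_eqVlt => /negPf->; case: ltnP. Qed.

Lemma vpos_last rho x : vpos (rcons rho x) (size rho) = x.+1.
Proof. by rewrite /vpos size_rcons ltnSn nth_rcons ltnn eqxx. Qed.

Lemma vpos_size rho : vpos rho (size rho) = 0.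
Proof. by rewrite /vpos ltnn. Qed.

Lemma rep_bind_var rho sigma c x us (vs : tapes) : rep rho sigma c us -> size rho < H ->
  (forall k, k != tp 0 (size rho) -> vs k = us k) -> vs (tp 0 (size rho)) = vtape x.+1 ->
  rep (rcons rho x) sigma c vs.
Proof.
move=> R rH vu v0; apply: (rep_var R rH vu); first by rewrite v0 vpos_last.
by move=> i _; apply: vpos_rcons.
Qed.

Lemma rep_unbind_var rho sigma c x us (vs : tapes) : rep (rcons rho x) sigma c us -> size rho < H ->
  (forall k, k != tp 0 (size rho) -> vs k = us k) -> vs (tp 0 (size rho)) = vtape 0 ->
  rep rho sigma c vs.
Proof.
move=> R rH vu v0; apply: (rep_var R rH vu); first by rewrite v0 vpos_size.
by move=> i _ /vpos_rcons.
Qed.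

Lemma nth_rcons_neq T (x0 x : T) s i : i != size s -> nth x0 (rcons s x) i = nth x0 s i.
Proof.
by move=> /negPf E; rewrite nth_rcons E; case: ltnP => // /(nth_default x0) ->.
Qed.

Lemma nth_rcons_last T (x0 x : T) s : nth x0 (rcons s x) (size s) = x.
Proof. by rewrite nth_rcons ltnn eqxx. Qed.

Lemma rep_bind_set rho sigma c X us (vs : tapes) : rep rho sigma c us -> size sigma < H ->
  (forall k, k != tp 2 (size sigma) -> vs k = us k) -> vs (tp 2 (size sigma)) = stape X 0 ->
  rep rho (rcons sigma X) c vs.
Proof.
move=> R sH vu v0; apply: (rep_set R sH vu); first by rewrite v0 nth_rcons_last.
by move=> i _; apply: nth_rcons_neq.
Qed.

Lemma rep_rebind_set rho sigma c X X' us (vs : tapes) : rep rho (rcons sigma X) c us -> size sigma < H ->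
  (forall k, k != tp 2 (size sigma) -> vs k = us k) -> vs (tp 2 (size sigma)) = stape X' 0 ->
  rep rho (rcons sigma X') c vs.
Proof.
move=> R sH vu v0; apply: (rep_set R sH vu); first by rewrite v0 nth_rcons_last.
by move=> i _ i0; rewrite !nth_rcons_neq.
Qed.

Lemma rep_unbind_set rho sigma c X us (vs : tapes) : rep rho (rcons sigma X) c us -> size sigma < H ->
  (forall k, k != tp 2 (size sigma) -> vs k = us k) -> vs (tp 2 (size sigma)) = stape no_bits 0 ->
  rep rho sigma c vs.
Proof.
move=> R sH vu v0; apply: (rep_set R sH vu); first by rewrite v0 nth_default.
by move=> i _ i0; rewrite nth_rcons_neq.
Qed.

(** Substituting a fixed [t] for tape [k] makes the assertion independent of the actual tape [k], so
    that [rep] can serve as an invariant while head [k] travels. *)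
Lemma blind_rep k t rho sigma c : blind k (fun us => rep rho sigma c (replace us k t)).
Proof.
move=> us vs uv R; have <- // : replace us k t = replace vs k t.
by apply: funext => k'; rewrite /replace; case: eqVneq => // /uv.
Qed.

Lemma runs_for d b B (G : nat -> tapes -> Prop) ts :
  (forall x, blind (tp 0 d) (G x)) -> ts (tp 0 d) = vtape 0 -> G 0 ts ->
  (forall x us, x < N -> G x us -> us (tp 0 d) = vtape x.+1 ->
     runs b us B (fun vs => G x.+1 vs /\ vs (tp 0 d) = us (tp 0 d))) ->
  runs (loop (tp 0 d) id b) ts (N * (B + 4) + 10)
    (fun us => us (tp 0 d) = vtape 0 /\ G N us).
Proof.
move=> Gk td G0 Gb; have [_ _ Fm] := input_framed.
apply: (runs_weaken (runs_loop (F := input_cell) (g := id) input_framed Fm Gk td G0 _)) => //.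
  move=> x us xN Gu ud; apply: Gb => //; rewrite ud.
  by apply: ztape_ext => [|q _]; [lia|case: ifP].
by move=> us [ud Gu]; split=> //; rewrite ud; apply: ztape_ext => // q _; case: ifP.
Qed.

Lemma runs_sweep k g X X' (ts : tapes) :
  (forall o n, exists o' n', g (Some (inr (Cell o n))) = Some (inr (Cell o' n'))) ->
  (forall x, x < N -> g (Some (inr (Cell (X x).1 (X x).2))) = Some (inr (Cell (X' x).1 (X' x).2))) ->
  ts k = stape X 0 ->
  runs (loop k g (skip _ _)) ts (5 * N + 10)
    (fun us => us k = stape X' 0 /\ forall k', k' != k -> us k' = ts k').
Proof.
move=> gC gX tk.
apply: (runs_weaken (runs_loop (F := set_cell X) (g := g) (B := 1)
  (G := fun _ us => forall k', k' != k -> us k' = ts k') (set_framed X) _ _ tk _ _)) => //.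
- move=> q qN; rewrite /set_cell !ifF; [|lia..].
  by have [o [n ->]] := gC (X q.-1).1 (X q.-1).2.
- by move=> _ us vs uv uo k' k'k; rewrite -uv ?uo.
- by move=> x us xN uo uk; apply: runs_skip.
- by lia.
- move=> us [uk uo]; split=> //; rewrite uk; apply: ztape_ext => // q qN.
  rewrite /set_cell; case: q qN => // q qN /=; rewrite eqSS.
  case: (q =P N) => [->|qN']; first by rewrite ltnn.
  by rewrite ifT; [rewrite gX //; lia|lia].
Qed.

(** Both counters fall in lockstep until one is empty, hence [minn v1 v2] rounds; afterwards counter
    [a.+2] is positive just when [v1 < v2]. *)
Lemma runs_while_pops a v1 v2 rho sigma c ts : a.+2 < H ->
  rep rho sigma c ts -> c a.+1 = v1 -> c a.+2 = v2 ->
  runs (While (fun sy => positive (tp 1 a.+1) sy && positive (tp 1 a.+2) sy)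
             (Seq (pop _ (tp 1 a.+1)) (pop _ (tp 1 a.+2)))) ts (3 * v1).+1
    (rep rho sigma (fun i => if i == a.+1 then v1 - minn v1 v2
                             else if i == a.+2 then v2 - minn v1 v2 else c i)).
Proof.
move=> aH R c1 c2.
apply: (runs_le (B := (minn v1 v2 * (1 + 1).+1).+1)); last by lia.
apply: (runs_while (n := minn v1 v2) (B := 1 + 1) (J := fun n => rep rho sigma
  (fun i => if i == a.+1 then v1 - n else if i == a.+2 then v2 - n else c i))).
- by apply: rep_ext R => i; rewrite !subn0; case: eqP => [->//|_]; case: eqP => [->//|_].
- move=> n us nv Ru; have [|_ u1 _] := Ru a.+1; first by lia.
  have [|_ u2 _] := Ru a.+2; first by lia.
  rewrite eqxx in u1; rewrite eqxx ifF in u2; last by lia.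
  split; first by rewrite (positiveE u1) (positiveE u2); lia.
  rewrite (_ : v1 - n = (v1 - n.+1).+1) in u1; last by lia.
  rewrite (_ : v2 - n = (v2 - n.+1).+1) in u2; last by lia.
  apply: (runs_seq (runs_pop u1 (Q := fun vs => counter (vs (tp 1 a.+1)) (v1 - n.+1) /\
    forall k', k' != tp 1 a.+1 -> vs k' = us k') _)) => [vs v1' vo //|vs [v1' vo]].
  rewrite -vo in u2; last by rewrite tp_eq //; lia.
  apply: (runs_pop u2) => ws w2 wo.
  have Rv := rep_acc (c' := fun i => if i == a.+1 then v1 - n.+1 else if i == a.+2 then v2 - n else c i)
    Ru (i0 := a.+1) _ vo.
  apply: (rep_acc (i0 := a.+2) (Rv _ _ _) _ wo) => //; try by lia.
  - by rewrite eqxx.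
  - by move=> i _ /negPf->.
  - by rewrite eqxx ifF //; lia.
  - by move=> i _ /negPf->.
- move=> us Ru; have [|_ u1 _] := Ru a.+1; first by lia.
  have [|_ u2 _] := Ru a.+2; first by lia.
  rewrite eqxx in u1; rewrite eqxx ifF in u2; last by lia.
  by rewrite (positiveE u1) (positiveE u2); lia.
Qed.

End Correctness.

(** * Evaluation of terms in polynomial time *)

Section CompCorrect.
Variables (S : finType) (H : nat) (s0 : S) (w : seq S).
Local Notation N := (size w).
Local Notation cell := (S + glyph S)%type.
Local Notation K := (3 * H).
Local Notation index := 'I_K.+1.
Local Notation tapes := (index -> tape cell).
Local Notation tp := (@tp H).
Local Notation vtape := (ztape N (input_cell s0 w)).
Local Notation stape X := (ztape N (set_cell w X)).
Local Notation rep := (@rep S H s0 w).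
Local Notation den := (den s0 w).

Definition addc (c : nat -> nat) a x i := if i == a then c i + x else c i.

(** Only the committed component is visible to a term; the other one is scratch while a new set is
    computed. *)
Definition olds (sigma : seq (nat -> bool * bool)) : seq (pred nat) :=
  [seq (fun x => (X x).1) | X <- sigma].

Lemma replace_id k (ts : tapes) t : ts k = t -> replace ts k t = ts.
Proof. by move=> tk; apply: funext => k'; rewrite /replace; case: eqVneq => // ->. Qed.

Lemma replaceE k (ts : tapes) t : replace ts k t k = t.
Proof. by rewrite /replace eqxx. Qed.

Lemma replace_neq k k' (ts : tapes) t : k' != k -> replace ts k t k' = ts k'.
Proof. by rewrite /replace => /negPf ->. Qed.

Lemma rep_counter rho sigma c ts a : rep rho sigma c ts -> a < H -> counter (ts (tp 1 a)) (c a).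
Proof. by move=> R aH; have [] := R a aH. Qed.

Lemma runs_push_rep rho sigma c ts a : a < H -> rep rho sigma c ts ->
  runs (push S (tp 1 a)) ts 2 (fun us => rep rho sigma (addc c a 1) us /\
     forall k', k' != tp 1 a -> us k' = ts k').
Proof.
move=> aH R; apply: (runs_push (rep_counter R aH)) => us ua uo; split => //.
apply: (rep_acc R aH uo) => [|i iH /negPf ia]; rewrite /addc ?ia //.
by rewrite eqxx addn1.
Qed.

Lemma runs_push_under k t rho sigma c us a : a < H -> k != tp 1 a ->
  rep rho sigma c (replace us k t) ->
  runs (push S (tp 1 a)) us 2 (fun vs => rep rho sigma (addc c a 1) (replace vs k t) /\ vs k = us k).
Proof.
move=> aH ka R; have := rep_counter R aH; rewrite replace_neq; last by rewrite eq_sym.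
move=> ua; apply: (runs_push ua) => vs va vo; split; last by rewrite vo.
apply: (rep_acc (i0 := a) R aH) => [k' k'a||i iH /negPf ia]; rewrite /addc ?ia //.
  by rewrite /replace; case: ifP => // _; apply: vo.
by rewrite replace_neq ?eqxx ?addn1 // eq_sym.
Qed.

Lemma addc0 c a : addc c a 0 = c.
Proof. by apply: funext => i; rewrite /addc addn0 if_same. Qed.

Lemma addcD c a x y : addc (addc c a x) a y = addc c a (x + y).
Proof. by apply: funext => i; rewrite /addc; case: (i == a); rewrite ?addnA. Qed.

Definition correct (e : tm S) := forall rho sigma c a ts,
  all (fun x => x < N) rho -> size rho <= H -> size sigma <= H -> a < H ->
  fits H e (size rho) (size sigma) a -> (forall i, a < i -> c i = 0) ->
  rep rho sigma c ts ->
  runs (@compile S H e (size rho) (size sigma) a) ts (cost e N)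
    (rep rho sigma (addc c a (den e rho (olds sigma)))).

(** The head of the variable is on cell [x.+1], and its walk to the left end passes [x] cells, each
    contributing one [push]; the way back changes nothing. *)
Lemma correct_Var i : correct (Var i).
Proof.
move=> rho sigma c a ts rhoN rH sH aH /= ir c0 R.
have iH := leq_trans ir rH.
have [ti _ _] := R i iH; rewrite /vpos ir in ti; set x := nth 0 rho i in ti *.
have xN : x < N by exact: (all_nthP 0 rhoN).
pose T := ts (tp 0 i); pose G n us := rep rho sigma (addc c a n) (replace us (tp 0 i) T).
have kk : tp 0 i != tp 1 a by rewrite tp_eq.
apply: (runs_le (B := x * (2 + 2) + x.+1 * (1 + 2) + 1 + 4)); last by lia.
apply: (runs_weaken (runs_walk (G := G) (G' := fun=> G x) (input_framed s0 w)
   (@input_letter _ s0 w) xN _ _ ti _ _ _ _)) => //.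
- by move=> n; apply: blind_rep.
- by move=> _; apply: blind_rep.
- by rewrite /G addc0 replace_id.
- move=> n us nx Gn; apply: (runs_weaken (runs_push_under aH kk Gn)) => // vs.
  by rewrite addcD addn1.
- by move=> us Gx; apply: runs_skip.
- by move=> n us _ Gx; apply: runs_skip.
- by move=> us [uk]; rewrite /G replace_id // uk.
Qed.

Lemma correct_Sym P i : correct (Sym P i).
Proof.
move=> rho sigma c a ts rhoN rH sH aH /= ir c0 R.
have iH := leq_trans ir rH.
have [ti _ _] := R i iH; rewrite /vpos ir in ti; set x := nth 0 rho i in ti *.
have xN : x < N by exact: (all_nthP 0 rhoN).
apply: (runs_le (B := 3)); last by lia.
have E : input_cell s0 w x.+1 = Some (inl (nth s0 w x)) by rewrite /input_cell eqSS (ltn_eqF xN).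
apply: runs_if; rewrite ffunE ti [scanned _]/= E.
case: ifP => Px.
  by apply: (runs_weaken (runs_push_rep aH R)) => // us [].
by rewrite addc0; apply: (runs_le (B := 1)) => //; apply: runs_skip.
Qed.

Lemma nth_olds sigma j x : j < size sigma ->
  nth xpred0 (olds sigma) j x = (nth no_bits sigma j x).1.
Proof. by move=> js; rewrite (nth_map no_bits). Qed.

Lemma correct_Elem j i : correct (Elem j i).
Proof.
move=> rho sigma c a ts rhoN rH sH aH /= /andP[js ir] c0 R.
have iH := leq_trans ir rH; have jH := leq_trans js sH.
have [ti _ _] := R i iH; rewrite /vpos ir in ti; set x := nth 0 rho i in ti *.
have xN : x < N by exact: (all_nthP 0 rhoN).
have [_ _ tj] := R j jH.
(* Both travelling tapes are replaced by their original contents, which makes [P] blind to both. *)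
pose P us := rep rho sigma (addc c a (nth xpred0 (olds sigma) j x))
  (replace (replace us (tp 2 j) (ts (tp 2 j))) (tp 0 i) (ts (tp 0 i))).
have kj : tp 2 j != tp 0 i by rewrite tp_eq.
apply: (runs_le (B := 6 * N + 3 + 10)); last by lia.
apply: (runs_weaken (runs_with_set (P := P) (X := nth no_bits sigma j) (X' := nth no_bits sigma j) kj xN _ _ tj ti _)) => //.
- move=> us vs uv; rewrite /P; have -> // : replace us (tp 2 j) (ts (tp 2 j)) = replace vs (tp 2 j) (ts (tp 2 j)).
  by apply: funext => k'; rewrite /replace; case: eqVneq => // /uv.
- move=> us vs uv; rewrite /P; set u1 := replace (replace us _ _) _ _.
  have -> // : u1 = replace (replace vs (tp 2 j) (ts (tp 2 j))) (tp 0 i) (ts (tp 0 i)).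
  by rewrite /u1; apply: funext => k'; rewrite /replace; case: eqVneq => // /uv ->.
- move=> us uj uo; apply: runs_if; rewrite ffunE uj [scanned _]/=.
  rewrite /set_cell [x.+1 == 0]/= eqSS (ltn_eqF xN) //.
  have uPE : rep rho sigma c (replace (replace us (tp 2 j) (ts (tp 2 j))) (tp 0 i) (ts (tp 0 i))).
    have -> // : replace (replace us (tp 2 j) (ts (tp 2 j))) (tp 0 i) (ts (tp 0 i)) = ts.
    apply: funext => k'; rewrite /replace; case: eqVneq => [->//|ki].
    by case: eqVneq => [->//|kj']; rewrite uo.
  rewrite /= /P nth_olds //; case: ifP => Xx.
    have := rep_counter uPE aH; rewrite !replace_neq ?tp_eq // => ua.
    apply: (runs_push ua) => vs va vo; split; rewrite ?vo ?tp_eq //.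
    apply: (rep_acc (i0 := a) uPE aH) => [k' ka||n nH /negPf na]; rewrite /addc ?na //.
      by rewrite /replace; case: ifP => // _; case: ifP => // _; apply: vo.
    by rewrite !replace_neq ?tp_eq // eqxx addn1.
  by apply: (runs_le (B := 1)) => //; apply: runs_skip; split=> //; rewrite addc0.
- by move=> us [Pu uj uk]; rewrite /P !replace_id // ?uk ?uj ?tj // in Pu.
Qed.

Lemma correct_Cst n : correct (Cst n).
Proof.
move=> rho sigma c a ts rhoN rH sH aH /= _ c0 R.
elim: n c ts R {c0} => [|n IH] c ts R /=.
  by rewrite addc0; apply: runs_skip.
apply: (runs_le (B := 2 + (2 * n + 1))); last by lia.
apply: (runs_seq (runs_push_rep aH R)) => us [Ru _].
by apply: (runs_weaken (IH _ _ Ru)) => // vs; rewrite addcD.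
Qed.

Lemma correct_Add e1 e2 : correct e1 -> correct e2 -> correct (Add e1 e2).
Proof.
move=> IH1 IH2 rho sigma c a ts rhoN rH sH aH /= /andP[f1 f2] c0 R.
apply: (runs_seq (IH1 _ _ _ _ _ rhoN rH sH aH f1 c0 R)) => us Ru.
apply: (runs_weaken (IH2 _ _ _ _ _ rhoN rH sH aH f2 _ Ru)) => // [i ai|vs].
  by rewrite /addc gtn_eqF // c0.
by rewrite addcD.
Qed.

Lemma runs_clear_rep rho sigma c ts a : a < H -> rep rho sigma c ts ->
  runs (clear _ (tp 1 a)) ts (2 * c a).+1 (rep rho sigma (fun i => if i == a then 0 else c i)).
Proof.
move=> aH R; apply: (runs_clear (rep_counter R aH)) => us ua uo.
by apply: (rep_acc R aH uo); rewrite ?eqxx // => i _ /negPf->.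
Qed.

Lemma correct_IfLt e1 e2 e3 e4 : correct e1 -> correct e2 -> correct e3 -> correct e4 ->
  correct (IfLt e1 e2 e3 e4).
Proof.
move=> IH1 IH2 IH3 IH4 rho sigma c a ts rhoN rH sH aH /= /and5P[a2H f1 f2 f3 f4] c0 R.
set v1 := den e1 _ _; set v2 := den e2 _ _.
have v1b : v1 <= value_bound e1 N by apply: den_bound.
have v2b : v2 <= value_bound e2 N by apply: den_bound.
apply: (runs_le (B := cost e1 N + (cost e2 N + ((3 * v1).+1 +
  ((2 * (v1 + v2)).+1 + (cost e3 N + cost e4 N)).+1)))); last by lia.
apply: (runs_seq (IH1 _ _ c a.+1 _ rhoN rH sH (ltnW a2H) f1 _ R)) => [i ai|us Ru].
  by apply: c0; lia.
(* Counter [a.+1] now holds the value of [e1], so [e2] accumulates in [a.+2]. *)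
apply: (runs_seq (IH2 _ _ _ a.+2 _ rhoN rH sH a2H f2 _ Ru)) => [i ai|{R us Ru ts}us Ru].
  by rewrite /addc ifF ?c0 //; lia.
rewrite -/v1 -/v2 in Ru.
apply: (runs_seq (runs_while_pops a2H Ru (v1 := v1) (v2 := v2) _ _)).
- by rewrite /addc ifF ?eqxx ?c0 //; lia.
- by rewrite /addc eqxx ifF ?c0 //; lia.
move=> {us Ru}us Ru; apply: runs_if.
have E : (a.+2 == a.+1) = false by lia.
rewrite (positiveE (rep_counter Ru a2H)) E eqxx.
rewrite subn_gt0 gtn_min ltnn orbF.
case: (ltnP v1 v2) => v12.
  apply: (runs_le (B := (2 * (v2 - minn v1 v2)).+1 + cost e3 N)); last by lia.
  apply: (runs_seq (Q1 := rep rho sigma c)).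
    have := runs_clear_rep a2H Ru; rewrite E eqxx.
    move=> Q; apply: (runs_weaken Q) => // vs; apply: rep_ext => i.
    rewrite /addc; case: eqP => [->|_]; first by rewrite c0 //; lia.
    by case: eqP => [->|_] //; rewrite c0; lia.
  by move=> vs Rv; apply: IH3.
apply: (runs_le (B := (2 * (v1 - minn v1 v2)).+1 + cost e4 N)); last by lia.
apply: (runs_seq (Q1 := rep rho sigma c)).
  have := runs_clear_rep (ltnW a2H) Ru; rewrite eqxx.
  move=> Q; apply: (runs_weaken Q) => // vs; apply: rep_ext => i.
  rewrite /addc; case: eqP => [->|_]; first by rewrite c0 //; lia.
  by case: eqP => [->|_] //; rewrite c0; lia.
by move=> vs Rv; apply: IH4.
Qed.

Lemma correct_Sum e : correct e -> correct (Sum e).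
Proof.
move=> IH rho sigma c a ts rhoN rH sH aH /= /andP[dH fe] c0 R.
have [td _ _] := R _ dH; rewrite vpos_size in td.
pose v n := \sum_(0 <= x < n) den e (rcons rho x) (olds sigma).
pose G n us := rep rho sigma (addc c a (v n)) (replace us (tp 0 (size rho)) (vtape 0)).
apply: (runs_le (B := N * (cost e N + 4) + 10)); last by lia.
apply: (runs_weaken (runs_for (G := G) _ td _ _)) => //.
- by move=> n; apply: blind_rep.
- by rewrite /G /v big_geq // addc0 replace_id.
- move=> x us xN Gx ud.
  have Rx : rep (rcons rho x) sigma (addc c a (v x)) us.
    by apply: (rep_bind_var Gx dH) => // k kd; rewrite replace_neq.
  have := IH _ _ _ a _ _ _ sH aH _ _ Rx; rewrite size_rcons => Q.
  have /Q {}Q : all (fun x => x < N) (rcons rho x) by rewrite all_rcons xN.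
  have := Q dH fe => {}Q.
  apply: (runs_weaken (Q _)) => // [i ai|vs Rv].
    by rewrite /addc gtn_eqF // c0.
  have [vd _ _] := Rv _ dH; rewrite vpos_last in vd.
  split; last by rewrite vd ud.
  rewrite /G /v big_nat_recr //= -/(v x) -addcD.
  by apply: (rep_unbind_var Rv dH) => [k kd|]; rewrite ?replaceE // replace_neq.
- by move=> us [ud]; rewrite /G replace_id.
Qed.

Lemma runs_write_new b x (j k : index) X X' (ts : tapes) : j != k -> x < N ->
  (forall y, y < N -> X' y = if y == x then ((X y).1, b) else X y) ->
  ts j = stape X 0 -> ts k = vtape x.+1 ->
  runs (with_set j k (on j (fun c => (write_new b c, Stay)))) ts (6 * N + 11)
    (fun us => us j = stape X' 0 /\ forall k', k' != j -> us k' = ts k').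
Proof.
move=> jk xN X'E tj tk.
apply: (runs_le (B := 6 * N + 1 + 10)); last by lia.
apply: (runs_weaken (runs_with_set (X' := X') (P := fun us => forall k', k' != j -> k' != k -> us k' = ts k')
  jk xN _ _ tj tk _)) => //.
- by move=> us vs uv uo k' kj kk; rewrite -uv // uo.
- by move=> us vs uv uo k' kj kk; rewrite -uv // uo.
- move=> us uj uo; apply: runs_on => vs vj vo; split.
  + by move=> k' kj kk; rewrite vo // uo.
  + rewrite vj uj ztape_stay; apply: ztape_ext => [|q qN]; first by lia.
    rewrite /fset [scanned _]/=; case: (q =P x.+1) => [->|qx].
      by rewrite /set_cell /= eqSS (ltn_eqF xN) // X'E // eqxx.
    rewrite /set_cell; case: (q =P 0) => // q0; case: (q =P N.+1) => // qN'.
    by rewrite X'E; [rewrite ifF //; lia|lia].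
  + by rewrite vo // eq_sym.
- move=> us [uo uj uk]; split=> // k' kj.
  by case: (eqVneq k' k) => [->|kk] //; rewrite uo.
Qed.

Lemma olds_rcons sigma X : olds (rcons sigma X) = rcons (olds sigma) (fun x => (X x).1).
Proof. by rewrite /olds map_rcons. Qed.

Lemma correct_Iter f g : correct f -> correct g -> correct (Iter f g).
Proof.
move=> IHf IHg rho sigma c a ts rhoN rH sH aH /= /and5P[dH kH a1H ff fg] c0 R.
pose d := size rho; pose k := size sigma.
pose phi t (X : pred nat) x := den f (rcons (rcons rho t) x) (rcons (olds sigma) X).
pose Xs n : pred nat := iteri n (fun t X x => (x < N) && (0 < phi t X x)) xpred0.
have dH' := ltnW dH.
pose Gt t us := rep rho (rcons sigma (fun x => (Xs t x, false))) c (replace us (tp 0 d) (vtape 0)).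
pose Bx := cost f N + (2 * value_bound f N + 1 + (6 * N + 11)).+1.
apply: (runs_le (B := N * ((N * (Bx + 4) + 10) + (5 * N + 10) + 4) + 10 + (cost g N + (5 * N + 10))));
  last by rewrite /Bx; lia.
have td : ts (tp 0 d) = vtape 0 by have [-> _ _] := R _ dH'; rewrite /d vpos_size.
apply: (runs_seq (runs_for (G := Gt) _ td _ _)).
- by move=> t; apply: blind_rep.
- rewrite /Gt replace_id //; have [_ _ tk] := R _ kH; apply: (rep_bind_set R kH) => //.
  by rewrite tk nth_default.
- move=> t us tN Gtu ud.
  have Rt : rep (rcons rho t) (rcons sigma (fun x => (Xs t x, false))) c us.
    by apply: (rep_bind_var Gtu) => // k' kd; rewrite replace_neq.
  (* During the sweep the first component remains the set of round [t], which [f] still reads, and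
     the second already holds the next set on the positions below [x]. *)
  pose Y x y := (Xs t y, (y < x) && Xs t.+1 y).
  pose Gx x us := rep (rcons rho t) (rcons sigma (Y x)) c (replace us (tp 0 d.+1) (vtape 0)).
  have sr : size (rcons rho t) = d.+1 by rewrite size_rcons.
  have ud1 : us (tp 0 d.+1) = vtape 0 by have [-> _ _] := Rt _ dH; rewrite -sr vpos_size.
  apply: (runs_seq (runs_for (G := Gx) _ ud1 _ _)).
  + by move=> x; apply: blind_rep.
  + by rewrite /Gx replace_id.
  + move=> x {Rt Gtu ud ud1}us xN Gxu ud.
    have Rx : rep (rcons (rcons rho t) x) (rcons sigma (Y x)) c us.
      by apply: (rep_bind_var Gxu); rewrite ?sr // => k' kd; rewrite replace_neq.
    pose vx := phi t (Xs t) x.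
    have vxb : vx <= value_bound f N by apply: den_bound; rewrite !all_rcons xN tN.
    have XE : Xs t.+1 x = (0 < vx) by rewrite /Xs /= xN.
    have fE : den f (rcons (rcons rho t) x) (olds (rcons sigma (Y x))) = vx by rewrite olds_rcons.
    have := IHf (rcons (rcons rho t) x) _ c a.+1 us _ _ _ a1H _ _ Rx; rewrite fE.
    rewrite !size_rcons -/d -/k !all_rcons xN tN => /(_ rhoN dH kH ff) Q.
    apply: (runs_seq (Q _)) => [i ai|{Q Gxu}vs Rv]; first by apply: c0; lia.
    (* Both branches write the truth value of [0 < vx]; they differ only in that a positive counter
       has to be cleared first. *)
    have R1 us' : rep (rcons (rcons rho t) x) (rcons sigma (Y x)) c us' ->
      runs (with_set (tp 2 k) (tp 0 d.+1) (on (tp 2 k) (fun c => (write_new (0 < vx) c, Stay)))) us' (6 * N + 11)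
        (fun ws => Gx x.+1 ws /\ ws (tp 0 d.+1) = us (tp 0 d.+1)).
      move=> Ru'; have [u1 _ _] := Ru' _ dH; have [_ _ u2] := Ru' _ kH.
      rewrite -sr vpos_last sr in u1; rewrite nth_rcons_last in u2.
      apply: (runs_weaken (runs_write_new (X' := Y x.+1) _ xN _ u2 u1)) => //.
      * by rewrite tp_eq.
      * move=> y yN; rewrite /Y ltnS leq_eqVlt; case: eqP => [->|//].
        by rewrite orTb andTb XE.
      * move=> ws [w2 wo]; split; last by rewrite wo ?tp_eq // u1 ud.
        apply: (@rep_unbind_var _ _ _ _ (rcons rho t) _ _ x ws); rewrite ?sr //; last by rewrite replaceE.
          by apply: (rep_rebind_set Ru') => //.
        by move=> k' kd; rewrite replace_neq.
    apply: runs_if; rewrite (positiveE (rep_counter Rv a1H)) /addc eqxx c0 ?add0n //.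
    case: (posnP vx) => vx0; last first.
      have := runs_clear_rep a1H Rv; rewrite /addc eqxx c0 ?add0n // => Q.
      apply: (runs_le (B := (2 * vx).+1 + (6 * N + 11))); last by lia.
      apply: (runs_seq Q) => ws Rw; have := R1 ws; rewrite vx0; apply.
      by apply: rep_ext Rw => i; case: eqP => // ->; rewrite c0.
    have := R1 vs; rewrite vx0 /= => Q; apply: (runs_le (B := 6 * N + 11)); last by lia.
    by apply: Q; apply: rep_ext Rv => i; rewrite /addc vx0 addn0 if_same.
  + move=> vs [vd1 GN].
    have Rv : rep (rcons rho t) (rcons sigma (Y N)) c vs by rewrite /Gx replace_id in GN.
    have [_ _ v2] := Rv _ kH; rewrite nth_rcons_last in v2.
    apply: (runs_weaken (runs_sweep (X' := fun x => (Xs t.+1 x, false)) _ _ v2)) => //.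
    * by move=> o n; exists n, false.
    * by move=> x xN; rewrite /= xN.
    * move=> ws [w2 wo]; have [vd _ _] := Rv _ dH'; rewrite vpos_last in vd.
      split; last by rewrite wo ?tp_eq // vd ud.
      apply: (@rep_unbind_var _ _ _ _ rho _ _ t ws) => //; last by rewrite replaceE.
        exact: (rep_rebind_set Rv).
      by move=> k' kd; rewrite replace_neq.
- move=> us [ud GN]; have Ru : rep rho (rcons sigma (fun x => (Xs N x, false))) c us.
    by rewrite /Gt replace_id in GN.
  have := IHg _ _ c a us rhoN rH _ aH _ c0 Ru; rewrite size_rcons olds_rcons => /(_ kH fg) Q.
  apply: (runs_seq Q) => {Q} vs Rv.
  have [_ _ v2] := Rv _ kH; rewrite nth_rcons_last in v2.
  (* Erasing restores the empty set that [rep] demands of an unbound set tape. *)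
  apply: (runs_weaken (runs_sweep (X' := no_bits) _ _ v2)) => //.
    by move=> o n; exists false, false.
  by move=> ws [w2 wo]; apply: (rep_unbind_set Rv).
Qed.

Lemma compile_correct e : correct e.
Proof.
elim: e => *; [exact: correct_Var|exact: correct_Sym|exact: correct_Elem|exact: correct_Cst
  |exact: correct_Add|exact: correct_IfLt|exact: correct_Sum|exact: correct_Iter].
Qed.

End CompCorrect.

(** * Copying the input to the work tapes *)

Section Prepare.
Variables (S : finType) (H : nat) (s0 : S).
Hypothesis H0 : 0 < H.
Local Notation cell := (S + glyph S)%type.
Local Notation K := (3 * H).
Local Notation index := 'I_K.+1.
Local Notation tapes := (index -> tape cell).
Local Notation tp := (@tp H).

Definition but_input (f : index -> option cell -> option cell -> option cell * move) (m : move) : prog cell K :=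
  Act (fun sy k => if k == ord0 then (sy k, m) else f k (sy ord0) (sy k)).

(** The tape [tp 2 i] has number [3 * i.+1]. Number [0] passes the test too, but that is the input
    tape, which [but_input] treats apart. *)
Definition is_set_tape (k : index) := 3 %| k.

Definition copy_cell (k : index) (c : option cell) : option cell :=
  if is_set_tape k then Some (inr (Cell false false)) else c.

(** Counter tapes receive a copy of the input as well and still represent zero, since [counter]
    ignores the cells to the right of the head. *)
Definition prepare : prog cell K :=
  Seq (but_input (fun _ _ _ => (Some (inr Bot), MoveRight)) Stay)
  (Seq (While (fun sy => sy ord0 != None) (but_input (fun k c _ => (copy_cell k c, MoveRight)) MoveRight))
  (Seq (but_input (fun _ _ _ => (Some (inr End), Stay)) Stay)
  (While (fun sy => ~~ is_bot (sy (tp 0 0))) (but_input (fun _ _ c => (c, MoveLeft)) Stay)))).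

Lemma runs_but_input f m ts (Q : tapes -> Prop) :
  (forall us, us ord0 = act (ts ord0) (scanned (ts ord0), m) ->
    (forall k, k != ord0 -> us k = act (ts k) (f k (scanned (ts ord0)) (scanned (ts k)))) -> Q us) ->
  runs (but_input f m) ts 1 Q.
Proof.
move=> HQ; apply: runs_act; apply: HQ; first by rewrite ffunE eqxx.
by move=> k /negPf k0; rewrite !ffunE k0.
Qed.

Lemma tp_input j i : j < 3 -> i < H -> tp j i != ord0.
Proof. by move=> j3 iH; rewrite -val_eqE /= inordK //; lia. Qed.

Lemma is_set_tape_tp j i : j < 3 -> i < H -> is_set_tape (tp j i) = (j == 2).
Proof. by move=> j3 iH; rewrite /is_set_tape inordK; lia. Qed.

Definition init_cell (w : seq S) (k : index) :=
  if is_set_tape k then set_cell w no_bits else input_cell s0 w.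

Lemma runs_prepare w ts :
  ts ord0 = tape_of [seq Some (inl a) | a <- w] ->
  (forall k, k != ord0 -> ts k = tape_of [::]) ->
  runs prepare ts (4 * size w + 10) (rep s0 w [::] [::] (fun=> 0)).
Proof.
move=> t0 tk; set N := size w; set W := [seq Some (inl a) | a <- w] in t0.
pose F := init_cell w.
have Fbot k : F k 0 = Some (inr Bot) by rewrite /F /init_cell; case: ifP.
have Fend k : F k N.+1 = Some (inr End).
  by rewrite /F /init_cell; case: ifP => _; rewrite /set_cell /input_cell /= eqxx.
have k00 : tp 0 0 != ord0 by apply: tp_input.
apply: (@runs_le _ _ (1 + ((N * 2).+1 + (1 + (N.+1 * 2).+1)))); last by rewrite -/N; lia.
pose J i (us : tapes) := (exists l, us ord0 = Tape l (head None (drop i W)) (behead (drop i W))) /\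
  forall k, k != ord0 -> us k = Tape (rev (mkseq (F k) i.+1)) None [::].
apply: (runs_seq (Q1 := J 0)).
  apply: runs_but_input => us u0 uk; split.
    by exists [::]; rewrite drop0 u0 t0.
  by move=> k kk; rewrite uk // tk // /mkseq /= Fbot.
move=> us J0; apply: (runs_seq (runs_while (n := N) (B := 1) (J := J) J0 _ _)).
- move=> i vs iN [[l v0] vk].
  have Di : drop i W = Some (inl (nth s0 w i)) :: drop i.+1 W.
    by rewrite /W -!map_drop (drop_nth s0).
  split; first by rewrite ffunE v0 Di.
  apply: runs_but_input => ws w0 wk; split.
    by rewrite w0 v0 /=; eexists; rewrite Di.
  move=> k kk; rewrite wk // vk // v0 Di [in RHS]mkseq_rcons rev_rcons.
  congr (Tape (_ :: _) _ _); rewrite /copy_cell /F /init_cell; case: ifP => _ //.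
    by rewrite /set_cell /= eqSS ltn_eqF.
  by rewrite /input_cell /= eqSS ltn_eqF.
- by move=> vs [[l v0] vk]; rewrite ffunE v0 drop_oversize ?size_map.
move=> vs [_ vk]; apply: (runs_seq (Q1 := fun us => forall k, k != ord0 -> us k = ztape N (F k) N.+1)).
  apply: runs_but_input => ws _ wk k kk; rewrite wk // vk //=.
  by rewrite /ztape subnn /= Fend.
move=> ws wk.
apply: (runs_weaken (runs_while (n := N.+1) (B := 1)
  (J := fun i us => forall k, k != ord0 -> us k = ztape N (F k) (N.+1 - i)) _ _ _)) => //.
- move=> i zs iN zk; have E : N.+1 - i = (N - i).+1 by lia.
  split.
    rewrite ffunE zk // [scanned _]/= /F /init_cell E; case: ifP => _.
      by case: i iN E {zk} => [|i] iN E; [rewrite subn0 /set_cell /= eqxx|rewrite /set_cell /= ifF //; lia].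
    by case: i iN E {zk} => [|i] iN E; [rewrite subn0 /input_cell /= eqxx|rewrite /input_cell /= ifF //; lia].
  apply: runs_but_input => ys _ yk k kk; rewrite yk // zk // E ztape_left; last by lia.
  rewrite subSS; apply: ztape_ext => [|q qN]; first by lia.
  by rewrite /fset; case: (q =P _) => // ->.
- by move=> zs zk; rewrite ffunE zk // subnn /= Fbot.
move=> zs; rewrite subnn => zk i iH; rewrite !zk ?tp_input // /F /init_cell !is_set_tape_tp //=.
by rewrite nth_nil.
Qed.

End Prepare.

Theorem in_P_of_term (S : finType) (s0 : S) (L : language S) (e : tm S) (H : nat) :
  0 < H -> fits H e 0 0 0 ->
  (forall w, (0 < den s0 w e [::] [::]) <-> L w) -> in_P L.
Proof.
move=> H0 eH eL.
(* The last summand pays for the step that evaluates the verdict. *)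
have [p pB] : polynomially_bounded (fun n => 4 * n + 10 + cost e n + 1).
  by pbound; apply: pbound_cost.
exists (prog_machine (Seq (prepare S H) (compile H e 0 0 0)) (positive (tp H 1 0))), p => w.
exists (0 < den s0 w e [::] [::]); split; last exact: eL.
have B : 4 * size w + 10 + cost e (size w) < p.[size w]%R.
  by apply: leq_trans (pB (size w)); rewrite addn1.
apply: (outcome_prog _ B); apply: (runs_seq (Q1 := rep s0 w [::] [::] (fun=> 0))).
  apply: runs_prepare => //=.
  by move=> k /negPf ->.
move=> us Ru; apply: (runs_weaken (compile_correct (c := fun=> 0) (a := 0) (rho := [::]) (sigma := [::]) _ _ _ H0 eH _ Ru)) => //.
by move=> vs Rv; rewrite (positiveE (rep_counter Rv H0)) /addc.
Qed.

(** * Syntax of encoded instances *)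

Definition is_bit (z : symbol) := if z is Bit _ then true else false.
Definition is_one (z : symbol) := if z is Bit b then b else false.
Definition is_minus (z : symbol) := if z is Minus then true else false.
Definition is_slash (z : symbol) := if z is Slash then true else false.
Definition is_comma (z : symbol) := if z is Comma then true else false.
Definition is_semi (z : symbol) := if z is Semicolon then true else false.
Definition is_bar (z : symbol) := if z is Bar then true else false.
Definition is_sep (z : symbol) := match z with Comma | Semicolon | Bar => true | _ => false end.
Definition is_row_end (z : symbol) := match z with Semicolon | Bar => true | _ => false end.
Definition is_part_end (z : symbol) := is_sep z || is_slash z.
Definition is_no_bit (z : symbol) := ~~ is_bit z.

Section Count.
Variable T : Type.
Implicit Types (A R : pred T) (u v : seq T).

(* The number of symbols in [A] since the last symbol in [R]. *)
Definition cnt A R u := foldl (fun k z => if R z then 0 else k + A z) 0 u.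

Lemma cnt_rcons A R u z : cnt A R (rcons u z) = if R z then 0 else cnt A R u + A z.
Proof. by rewrite /cnt -cats1 foldl_cat. Qed.

Lemma cnt_cat A R u v : ~~ has R v -> cnt A R (u ++ v) = cnt A R u + count A v.
Proof.
elim/last_ind: v => [|v z IH]; first by rewrite cats0 addn0.
rewrite has_rcons negb_or -rcons_cat cnt_rcons => /andP[/negPf-> /IH->].
by rewrite -cats1 count_cat /= addn0 addnA.
Qed.

Lemma cnt_count A R v : ~~ has R v -> cnt A R v = count A v.
Proof. exact: (cnt_cat A [::]). Qed.

Lemma cnt_reset A R u v : (exists u' z, R z /\ u = rcons u' z) -> cnt A R (u ++ v) = cnt A R v.
Proof. by move=> [u' [z [Rz ->]]]; rewrite /cnt foldl_cat foldl_rcons Rz. Qed.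

End Count.

Definition bars := cnt is_bar xpred0.
Definition rows := cnt is_semi is_bar.
Definition cols := cnt is_comma is_row_end.
Definition len := cnt xpredT is_sep.
Definition slashes := cnt is_slash is_sep.
Definition ones := cnt is_one is_part_end.
Definition exps := cnt is_bit is_no_bit.
(** Address of the entry to which the next symbol belongs: matrix [1] or [2], row and column,
    obtained by counting separators. In the initial unary block the matrix number is [0]. *)
Definition key u := (bars u, rows u, cols u).

(** A local grammar: each symbol is judged by counts over the prefix before it, so that validity is
    a statement about all positions, which a term can test. As [ones] restarts at a slash, the
    condition on a comma demands a nonzero denominator; [bars u < 3] lets nothing follow the third
    bar. *)
Definition allowed n m i (u : seq symbol) (z : symbol) : bool :=
  ((bars u == 0) && (is_one z || (is_bar z && (len u == i))))
  || ((0 < bars u) && (bars u < 3) &&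
  [|| is_bit z, is_minus z && (len u == 0), is_slash z && (slashes u == 0),
      is_comma z && ((0 < slashes u) && (0 < ones u)),
      is_semi z && ((len u == 0) && (cols u == m))
    | is_bar z && ((len u == 0) && ((cols u == 0) && (rows u == n)))]).

Section Valid.
Variables (n m i : nat).

Fixpoint allowed_from (u s : seq symbol) : bool :=
  if s is z :: s' then allowed n m i u z && allowed_from (rcons u z) s' else true.

Lemma allowed_from_cat u s t : allowed_from u (s ++ t) = allowed_from u s && allowed_from (u ++ s) t.
Proof. by elim: s u => [|z s IH] u /=; rewrite ?cats0 // IH cat_rcons andbA. Qed.

Lemma allowed_fromP u s :
  reflect (forall x, x < size s -> allowed n m i (u ++ take x s) (nth Bar s x)) (allowed_from u s).
Proof.
elim: s u => [|z s IH] u /=; first by apply: (iffP idP).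
apply: (iffP andP) => [[zu /IH su] [|x] xs /=|H].
- by rewrite cats0.
- by rewrite -cat_rcons; apply: su.
split; first by have := H 0 isT; rewrite /= cats0.
by apply/IH => x xs; have := H x.+1 xs; rewrite /= cat_rcons.
Qed.

Definition encode_row l := rcons (flatten [seq rcons (encode_fraction x) Comma | x <- l]) Semicolon.
Definition encode_rows L := rcons (flatten [seq encode_row l | l <- L]) Bar.

Definition ends_with_sep (u : seq symbol) := exists u' z, is_sep z /\ u = rcons u' z.

Lemma ends_rcons u z : is_sep z -> ends_with_sep (rcons u z).
Proof. by exists u, z. Qed.

Lemma ends_reset A R u v : subpred is_sep R -> ends_with_sep u -> cnt A R (u ++ v) = cnt A R v.
Proof. by move=> sR [u' [z [/sR Rz ->]]]; apply: cnt_reset; exists u', z. Qed.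

Lemma encode_fraction_nosep x : ~~ has is_sep (encode_fraction x).
Proof.
rewrite /encode_fraction !has_cat /= !has_map.
have bits (s : seq bool) : has (preim Bit is_sep) s = false by elim: s.
by case: (negative x); rewrite /= !bits.
Qed.

Lemma nosep_sub (R : pred symbol) s : subpred R is_sep -> ~~ has is_sep s -> ~~ has R s.
Proof. by move=> Rs; apply: contra => /(sub_has Rs). Qed.

Lemma key_nosep u v : ~~ has is_sep v -> key (u ++ v) = key u.
Proof.
move=> vs; rewrite /key /bars /rows /cols !cnt_cat ?has_pred0 //; last 2 first.
- by apply: nosep_sub vs => -[].
- by apply: nosep_sub vs => -[].
have H (A : pred symbol) : subpred A is_sep -> count A v = 0.
  by move=> As; apply/eqP; rewrite -leqn0 leqNgt -has_count; apply: nosep_sub vs.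
by rewrite !H ?addn0 //; case.
Qed.

Lemma bars_nosep u v : ~~ has is_sep v -> bars (u ++ v) = bars u.
Proof. by move=> /(key_nosep u); rewrite /key => -[]. Qed.

(** Every separator changes the key and no continuation restores it: a bar raises the first
    component for good; without bars a semicolon raises the second; without either a comma raises
    the third. *)
Lemma key_sep u v : key (u ++ v) = key u -> ~~ has is_sep v.
Proof.
have E : is_sep =1 predU is_bar (predU is_semi is_comma) by case.
rewrite /key /bars /rows /cols => -[eb er ec].
rewrite (eq_has E) !has_predU !negb_or.
have nb : ~~ has is_bar v.
  by move: eb; rewrite cnt_cat ?has_pred0 // has_count; lia.
have ns : ~~ has is_semi v by move: er; rewrite cnt_cat // has_count; lia.
rewrite nb ns /=; move: ec; rewrite cnt_cat ?has_count; first by lia.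
have E' : is_row_end =1 predU is_bar is_semi by case.
by rewrite -has_count (eq_has E') has_predU negb_or nb.
Qed.

Lemma allowed_from_encode_fraction u x : 0 < bars u < 3 -> ends_with_sep u ->
  allowed_from u (rcons (encode_fraction x) Comma).
Proof.
move=> bu eu; set s := if negative x then [:: Minus] else [::].
have bits v t : ~~ has is_sep v -> allowed_from (u ++ v) (map Bit t).
  elim: t v => [//|b t IH] v vs /=.
  rewrite rcons_cat IH ?has_rcons // andbT.
  by rewrite /allowed bars_nosep // bu /= orbT.
have nob (t : seq bool) : has is_sep (map Bit t) = false by elim: t.
have ss : ~~ has is_sep s by rewrite /s; case: ifP.
rewrite /encode_fraction -/s -cats1 -!catA cat_cons !allowed_from_cat [allowed_from _ (_ :: _)]/= !allowed_from_cat.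
rewrite [allowed_from _ [:: Comma]]/=.
have vs1 : ~~ has is_sep (s ++ map Bit (numerator x)) by rewrite has_cat nob orbF.
set v2 := rcons (s ++ map Bit (numerator x)) Slash.
have vs2 : ~~ has is_sep v2 by rewrite has_rcons.
have vs3 : ~~ has is_sep (v2 ++ map Bit (denominator x)) by rewrite has_cat nob orbF.
apply/and5P; split.
- rewrite /s; case: ifP => //= _; rewrite andbT /allowed bu /=.
  by rewrite /len -[u]cats0 ends_reset //= ?orbT.
- exact: bits.
- rewrite /allowed -catA; rewrite (bars_nosep u vs1) bu /=.
  rewrite /slashes ends_reset // cnt_count // count_cat count_map.
  have -> : count (preim Bit is_slash) (numerator x) = 0 by elim: (numerator x).
  by rewrite /s; case: ifP; rewrite /= ?orbT.
- by rewrite -catA rcons_cat -/v2; apply: bits.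
- rewrite andbT /allowed -[(u ++ s) ++ _]catA rcons_cat -/v2 -catA; rewrite (bars_nosep u vs3) bu /=.
  rewrite /slashes ends_reset // cnt_count // {1}/v2 -cats1 !count_cat /= addn1.
  rewrite /ones ends_reset; [|by case|by []].
  rewrite cnt_reset; last by exists (s ++ map Bit (numerator x)), Slash.
  rewrite cnt_count; last by elim: (denominator x).
  rewrite addSn andbF andTb orbF orFb count_map -has_count /=.
  (* [ones] counts from the slash on, so a one bit in the denominator is needed; positivity supplies
     it. *)
  have := denominator_gt0 x; elim: (denominator x) => [//|[] t IH] //=.
  by rewrite double_gt0.
Qed.

Lemma bars_rcons u z : bars (rcons u z) = bars u + is_bar z.
Proof. by rewrite /bars cnt_rcons. Qed.

Lemma rows_rcons u z : rows (rcons u z) = if is_bar z then 0 else rows u + is_semi z.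
Proof. by rewrite /rows cnt_rcons. Qed.

Lemma cols_rcons u z : cols (rcons u z) = if is_row_end z then 0 else cols u + is_comma z.
Proof. by rewrite /cols cnt_rcons. Qed.

Lemma len_ends u : ends_with_sep u -> len u = 0.
Proof. by move=> [u' [z [zs ->]]]; rewrite /len cnt_rcons zs. Qed.

Lemma keyE u b r c : key u = (b, r, c) <-> [/\ bars u = b, rows u = r & cols u = c].
Proof. by rewrite /key; split=> [[-> -> ->]|[-> -> ->]]. Qed.

Definition encode_entries l := flatten [seq rcons (encode_fraction x) Comma | x <- l].

Lemma encode_entries_rcons l x :
  encode_entries (rcons l x) = rcons (encode_entries l ++ encode_fraction x) Comma.
Proof. by rewrite /encode_entries map_rcons flatten_rcons rcons_cat. Qed.

Lemma allowed_entries u l b r : 0 < b < 3 -> ends_with_sep u -> key u = (b, r, 0) ->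
  [/\ allowed_from u (encode_entries l), ends_with_sep (u ++ encode_entries l)
    & key (u ++ encode_entries l) = (b, r, size l)].
Proof.
move=> b3 eu ku; elim/last_ind: l => [|l x [ok e k]]; first by rewrite cats0.
rewrite encode_entries_rcons size_rcons -rcons_cat catA.
have nx := encode_fraction_nosep x.
have /keyE[kb kr kc] := k; have := key_nosep (u ++ encode_entries l) nx; rewrite k => /keyE[xb xr xc].
split.
- rewrite rcons_cat allowed_from_cat ok /=; apply: allowed_from_encode_fraction => //.
  by rewrite kb.
- exact: ends_rcons.
- apply/keyE; rewrite bars_rcons rows_rcons cols_rcons /=.
  by rewrite xb xr xc !addn0 addn1.
Qed.

Lemma allowed_row u l b r : 0 < b < 3 -> ends_with_sep u -> key u = (b, r, 0) -> size l = m ->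
  [/\ allowed_from u (encode_row l), ends_with_sep (u ++ encode_row l)
    & key (u ++ encode_row l) = (b, r.+1, 0)].
Proof.
move=> b3 eu ku lm; have [ok e k] := allowed_entries l b3 eu ku.
have /keyE[kb kr kc] := k.
rewrite /encode_row -/(encode_entries l) -rcons_cat; split.
- rewrite -cats1 allowed_from_cat ok /= andbT /allowed kb b3 /= kc lm eqxx.
  by rewrite len_ends //= ?orbT.
- exact: ends_rcons.
- apply/keyE; rewrite bars_rcons rows_rcons cols_rcons /=.
  by rewrite kb kr addn0 addn1.
Qed.

Definition encode_body L := flatten [seq encode_row l | l <- L].

Lemma allowed_body u L b r : 0 < b < 3 -> ends_with_sep u -> key u = (b, r, 0) ->
  all (fun l => size l == m) L ->
  [/\ allowed_from u (encode_body L), ends_with_sep (u ++ encode_body L)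
    & key (u ++ encode_body L) = (b, r + size L, 0)].
Proof.
move=> b3; elim: L u r => [|l L IH] u r eu ku /= => [_|/andP[/eqP lm Lm]].
  by rewrite cats0 addn0.
have [ok e k] := allowed_row b3 eu ku lm.
have [ok' e' k'] := IH _ _ e k Lm.
rewrite /encode_body /= -/(encode_body L) catA allowed_from_cat ok ok'; split=> //.
by rewrite k' addSnnS.
Qed.

Lemma allowed_rows u L b : 0 < b < 3 -> ends_with_sep u -> key u = (b, 0, 0) ->
  all (fun l => size l == m) L -> size L = n ->
  [/\ allowed_from u (encode_rows L), ends_with_sep (u ++ encode_rows L)
    & key (u ++ encode_rows L) = (b.+1, 0, 0)].
Proof.
move=> b3 eu ku Lm Ln; have [ok e k] := allowed_body b3 eu ku Lm.
have /keyE[kb kr kc] := k.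
rewrite /encode_rows -/(encode_body L) -rcons_cat; split.
- rewrite -cats1 allowed_from_cat ok /= andbT /allowed kb b3 /= kc kr Ln eqxx.
  by rewrite len_ends //= add0n eqxx orbT.
- exact: ends_rcons.
- apply/keyE; rewrite bars_rcons rows_rcons cols_rcons /=.
  by rewrite kb addn1.
Qed.

Definition encode_lists L1 L2 :=
  rcons (nseq i (Bit true)) Bar ++ encode_rows L1 ++ encode_rows L2.

Lemma allowed_prefix : let u := rcons (nseq i (Bit true)) Bar in
  [/\ allowed_from [::] u, ends_with_sep u & key u = (1, 0, 0)].
Proof.
have H t : bars (nseq t (Bit true)) = 0 /\ len (nseq t (Bit true)) = t.
  rewrite /bars /len !cnt_count ?has_pred0 // ?has_nseq ?andbF //.
  by rewrite !count_nseq mul1n.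
split=> /=.
- rewrite -cats1 allowed_from_cat /= andbT; apply/andP; split.
    suff G t k : allowed_from (nseq k (Bit true)) (nseq t (Bit true)) by have := G i 0.
    elim: t k => [//|t IH] k /=.
    have -> : rcons (nseq k (Bit true)) (Bit true) = nseq k.+1 (Bit true) by elim: k => //= k ->.
    by rewrite IH; have [b0 _] := H k; rewrite /allowed b0.
  by have [b0 l0] := H i; rewrite /allowed b0 l0 !eqxx.
- exact: ends_rcons.
- by apply/keyE; rewrite bars_rcons rows_rcons cols_rcons /=; have [-> _] := H i.
Qed.

Lemma allowed_encode L1 L2 :
  all (fun l => size l == m) L1 -> all (fun l => size l == m) L2 -> size L1 = n -> size L2 = n ->
  allowed_from [::] (encode_lists L1 L2) /\ bars (encode_lists L1 L2) = 3.
Proof.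
move=> L1m L2m L1n L2n; have [ok0 e0 k0] := allowed_prefix.
have [ok1 e1 k1] := allowed_rows (isT : 0 < 1 < 3) e0 k0 L1m L1n.
have [ok2 e2 k2] := allowed_rows (isT : 0 < 2 < 3) e1 k1 L2m L2n.
rewrite /encode_lists !allowed_from_cat ok0 ok1 ok2; split=> //.
by rewrite catA; have /keyE[] := k2.
Qed.

End Valid.

(** * Recovering the matrices from a valid word *)

Section Parse.
Variables (n m i : nat).
Local Notation allowed := (allowed n m i).
Local Notation allowed_from := (allowed_from n m i).

Lemma first_occurrence T (P : pred T) s : has P s ->
  exists a z b, [/\ s = a ++ z :: b, ~~ has P a & P z].
Proof.
elim: s => [//|z s IH] /=; case: (boolP (P z)) => [Pz _|Pz /IH[a [y [b [-> Pa Py]]]]].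
  by exists [::], z, s.
by exists (z :: a), y, b; split=> //=; rewrite negb_or Pz.
Qed.

Lemma has_take_has T (P : pred T) s q : has P (take q s) -> has P s.
Proof. by rewrite -{2}(cat_take_drop q s) has_cat => ->. Qed.

Lemma sub_all_take T (P : pred T) s q : all P s -> all P (take q s).
Proof. by rewrite -{1}(cat_take_drop q s) all_cat => /andP[]. Qed.

Lemma all_bits a : all is_bit a -> a = map Bit (map is_one a).
Proof. by elim: a => [//|[] // b a IH] /= /IH <-. Qed.

Lemma parse_fraction u s : 0 < bars u < 3 -> ends_with_sep u -> ~~ has is_sep s ->
  allowed_from u (rcons s Comma) -> exists x, s = encode_fraction x.
Proof.
move=> bu eu ss; rewrite -cats1 allowed_from_cat /= andbT => /andP[/allowed_fromP os oc].
have bq q : bars (u ++ take q s) = bars u.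
  by rewrite bars_nosep //; apply: contra ss; apply: has_take_has.
have {}os q : q < size s -> [|| is_bit (nth Bar s q), is_minus (nth Bar s q) && (q == 0)
    | is_slash (nth Bar s q) && ~~ has is_slash (take q s)].
  move=> qs; have := os q qs; rewrite /allowed bq bu.
  have tq : ~~ has is_sep (take q s) by apply: contra ss; apply: has_take_has.
  have -> : (bars u == 0) = false by lia.
  rewrite /len /slashes !ends_reset // !cnt_count // count_predT size_take qs.
  have zs : ~~ is_sep (nth Bar s q).
    by apply: contra ss => zs; apply/(has_nthP Bar); exists q.
  rewrite has_count -eqn0Ngt.
  by case: (nth Bar s q) zs => //=; rewrite ?orbF.
have [os1 os2] : 0 < count is_slash s /\ 0 < ones (u ++ s).
  move: oc; rewrite /allowed bars_nosep // bu /=.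
  rewrite /slashes ends_reset // cnt_count //.
  have -> : (bars u == 0) = false by lia.
  by rewrite /= orbF => /andP.
(* A minus is allowed only at offset [0], so [s] is an optional minus followed by a word [t] of bits
   around one slash. *)
pose sg := if s is Minus :: _ then [:: Minus] else [::].
pose t := if s is Minus :: s' then s' else s.
have sE : s = sg ++ t by rewrite /sg /t; case: (s) => [//|[]].
have ot q : q < size t -> is_bit (nth Bar t q) || (is_slash (nth Bar t q) && ~~ has is_slash (take q t)).
  rewrite /t; move: os; clear; case: s => [//|z s] os.
  case: z os => [b|||||] os qs; try by have := os q qs; case: q qs => [|q] //= qs; rewrite ?andbF.
  by have := os q.+1 qs; rewrite /= andbF.
have : has is_slash t.
  by move: os1; rewrite -has_count {1}sE has_cat /sg; case: (s) => [//|[]].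
move=> /first_occurrence[a [z [b [tE sa sz]]]].
have {}zE : z = Slash by case: z sz {tE}.
rewrite {z sz}zE in tE.
have ba : all is_bit a.
  apply/(all_nthP Bar) => q qa; have := ot q; rewrite tE nth_cat qa size_cat => H.
  have /orP[//|/andP[sl _]] := H (ltn_addr _ qa).
  by case/negP: sa; apply/(has_nthP Bar); exists q.
have bb : all is_bit b.
  apply/(all_nthP Bar) => q qb; have := ot (size a + q.+1).
  have F : (size a + q.+1 < size a) = false by lia.
  rewrite tE nth_cat take_cat F addKn /= size_cat /= ltn_add2l ltnS => /(_ qb).
  by rewrite has_cat /= orbT andbF orbF.
(* The condition imposed on the comma becomes the positivity proof required by [Fraction]. *)
have d0 : 0 < nat_of_bits (map is_one b).
  move: os2; rewrite sE tE /ones.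
  have -> : u ++ sg ++ a ++ Slash :: b = rcons (u ++ sg ++ a) Slash ++ b.
    by rewrite cat_rcons -!catA.
  rewrite cnt_reset; last by exists (u ++ sg ++ a), Slash.
  rewrite cnt_count -?has_count; last first.
    by rewrite -all_predC; apply: sub_all bb => -[].
  elim: (b) => [//|z b' IH] /= /orP[->|/IH]; first by [].
  by case: (is_one z) => //; rewrite /= double_gt0.
exists (Fraction (sg != [::]) (map is_one a) d0).
rewrite /encode_fraction /= -(all_bits ba) -(all_bits bb) -tE {1}sE; congr (_ ++ _).
by rewrite /sg; case: (s) => [|[]].
Qed.

Lemma parse_entries u s : 0 < bars u < 3 -> ends_with_sep u -> has is_bar s -> allowed_from u s ->
  exists l z t, [/\ s = encode_entries l ++ z :: t, is_row_end z & allowed (u ++ encode_entries l) z].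
Proof.
elim: {s}(size s) {-2}s (leqnn (size s)) u => [|k IH] s sk u bu eu hs os.
  by case: s sk hs {os}.
have /first_occurrence[a [z [b [sE sa sz]]]] : has is_sep s by apply: sub_has hs => -[].
have : allowed_from u (a ++ z :: b) by rewrite -sE.
rewrite allowed_from_cat /= => /andP[oa /andP[oz ob]].
case zc: (is_comma z); last first.
  have zr : is_row_end z by case: (z) sz zc.
  (* A row end needs [len] to be [0], so nothing stands between the last separator and it. *)
  exists [::], z, b; rewrite cats0; suff a0 : a = [::].
    by rewrite a0 in sE oz; rewrite cats0 in oz; split.
  move: oz; rewrite /allowed /len ends_reset // cnt_count // count_predT bars_nosep //.
  have -> : (bars u == 0) = false by lia.
  by rewrite bu; case: (z) zr => //= _; case: (a).
have zE : z = Comma by case: (z) zc.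
rewrite {}zE in sE oz ob.
have [x ax] : exists x, a = encode_fraction x.
  by apply: (parse_fraction bu eu sa); rewrite -cats1 allowed_from_cat oa /= oz.
have [|||||l [y [t [bE yr oy]]]] := IH b _ (rcons (u ++ a) Comma).
- by move: sk; rewrite sE size_cat /=; lia.
- by rewrite bars_rcons addn0 bars_nosep.
- exact: ends_rcons.
- by move: hs; rewrite sE has_cat /= => /orP[/(sub_has (a2 := is_sep))|//]; rewrite (negPf sa) => /(_ ltac:(by case)).
- exact: ob.
exists (x :: l), y, t; rewrite /encode_entries /= -/(encode_entries l) -ax; split=> //.
  by rewrite sE bE -catA cat_rcons.
by move: oy; rewrite rcons_cat -catA.
Qed.

Lemma has_bar_entries l : has is_bar (encode_entries l) = false.
Proof.
rewrite /encode_entries; elim: l => //= x l IH; rewrite has_cat {}IH orbF has_rcons /=.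
by apply/negbTE; apply: contra (encode_fraction_nosep x); apply: sub_has => -[].
Qed.

Lemma parse_rows u s b r : 0 < b < 3 -> ends_with_sep u -> key u = (b, r, 0) ->
  has is_bar s -> allowed_from u s ->
  exists L t, [/\ s = encode_rows L ++ t, all (fun l => size l == m) L & r + size L = n].
Proof.
move=> b3; elim: {s}(size s) {-2}s (leqnn (size s)) u r => [|k IH] s sk u r eu ku hs os.
  by case: s sk hs {os}.
have /keyE[kb kr kc] := ku.
have bu : 0 < bars u < 3 by rewrite kb.
have [l [z [t [sE zr oz]]]] := parse_entries bu eu hs os.
have [_ e' k'] := @allowed_entries n m i u l b r b3 eu ku.
have /keyE[kb' kr' kc'] := k'.
move: oz; rewrite /allowed kb' kc' kr' b3; have -> : (b == 0) = false by lia.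
case: z sE zr => // sE _ /=; rewrite ?orbF => /andP[_]; last first.
  move=> /andP[/eqP l0 /eqP rn]; exists [::], t; split; rewrite ?addn0 //.
  by rewrite sE (size0nil l0).
move=> /eqP lm; have [_ e k2] := @allowed_row n m i u l b r b3 eu ku lm.
have sE' : s = encode_row l ++ t by rewrite sE /encode_row cat_rcons.
have [|||L [t' [tE Lm Ln]]] := IH t _ (u ++ encode_row l) r.+1 e k2.
- move: sk; rewrite sE size_cat /=; lia.
- by move: hs; rewrite sE has_cat has_bar_entries.
- by move: os; rewrite sE' allowed_from_cat => /andP[].
exists (l :: L), t'; split=> //=; rewrite ?lm ?eqxx //; last by rewrite addnS.
by rewrite sE' tE /encode_rows /= rcons_cat catA.
Qed.

Lemma parse_lists w : allowed_from [::] w -> bars w = 3 ->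
  exists L1 L2, [/\ w = encode_lists i L1 L2, all (fun l => size l == m) L1,
    all (fun l => size l == m) L2, size L1 = n & size L2 = n].
Proof.
move=> ow bw.
have cw : count is_bar w = 3 by rewrite -bw /bars cnt_count // has_pred0.
have /first_occurrence[p [z [s [wE pb zb]]]] : has is_bar w by rewrite has_count cw.
have zE : z = Bar by case: (z) zb.
rewrite {z zb}zE in wE.
have : allowed_from [::] (p ++ Bar :: s) by rewrite -wE.
rewrite allowed_from_cat => /andP[/allowed_fromP op] /= /andP[ob os].
have pE : p = nseq (size p) (Bit true).
  apply: (@eq_from_nth _ Bar); rewrite ?size_nseq // => q qp; rewrite nth_nseq qp.
  have := op q qp; rewrite /allowed cat0s.
  have -> : bars (take q p) = 0.
    rewrite /bars cnt_count ?has_pred0 //; apply/eqP; rewrite -leqn0 leqNgt -has_count.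
    by apply: contra pb; apply: has_take_has.
  have : ~~ is_bar (nth Bar p q) by apply: contra pb => ?; apply/(has_nthP Bar); exists q.
  by case: (nth Bar p q) => //= -[].
have pi : size p = i.
  have b0 : bars p = 0 by rewrite /bars cnt_count ?has_pred0 //; apply/eqP; rewrite -leqn0 leqNgt -has_count.
  move: ob; rewrite /allowed b0 /= orbF => /eqP <-.
  by rewrite pE /len cnt_count ?has_nseq ?andbF // count_nseq size_nseq mul1n.
rewrite {}pi in pE; rewrite {}pE in wE os.
have [_ e0 k0] := @allowed_prefix n m i.
move: wE; rewrite -cat_rcons => wE.
set u0 := rcons (nseq i (Bit true)) Bar in e0 k0 wE os.
have cb u v : bars (u ++ v) = bars u + count is_bar v by rewrite /bars cnt_cat ?has_pred0.
have /keyE[k0b _ _] := k0.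
have cs : count is_bar s = 2 by move: bw; rewrite wE cb k0b; lia.
have [|L1 [t [sE L1m L1n]]] := parse_rows (isT : 0 < 1 < 3) e0 k0 _ os; first by rewrite has_count cs.
have [_ e1 k1] := @allowed_rows n m i u0 L1 1 isT e0 k0 L1m L1n.
have /keyE[k1b _ _] := k1.
have ct : count is_bar t = 1 by move: bw; rewrite wE sE catA cb k1b; lia.
have /andP[_ ot] : allowed_from u0 (encode_rows L1) && allowed_from (u0 ++ encode_rows L1) t.
  by rewrite -allowed_from_cat -sE.
have [|L2 [t' [tE L2m L2n]]] := parse_rows (isT : 0 < 2 < 3) e1 k1 _ ot; first by rewrite has_count ct.
have [_ e2 k2] := @allowed_rows n m i _ L2 2 isT e1 k1 L2m L2n.
have /keyE[k2b _ _] := k2.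
exists L1, L2; split=> //; rewrite wE sE tE /encode_lists; congr (_ ++ (_ ++ _)).
(* No symbol is allowed once three bars have been read. *)
case: t' tE => [|z t'] tE; first by rewrite cats0.
by move: ot; rewrite tE allowed_from_cat /= /allowed k2b /= ?andbF.
Qed.

Lemma locate_entry u L b r c x0 : 0 < b < 3 -> ends_with_sep u -> key u = (b, 0, 0) ->
  all (fun l => size l == m) L -> size L = n -> r < n -> c < m ->
  exists u' v, [/\ u ++ encode_rows L = u' ++ encode_fraction (nth x0 (nth [::] L r) c) ++ Comma :: v,
    key u' = (b, r, c) & ends_with_sep u'].
Proof.
move=> b3 eu ku Lm Ln rn cm; rewrite -Ln in rn.
have lm : size (nth [::] L r) = m by apply/eqP/(all_nthP [::] Lm).
set l := nth _ _ _ in lm *; rewrite -lm in cm.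
have [_ e1 k1] := @allowed_body n m 0 u (take r L) b 0 b3 eu ku (sub_all_take _ Lm).
rewrite size_take rn add0n in k1.
have [_ e2 k2] := @allowed_entries n m 0 _ (take c l) b r b3 e1 k1.
rewrite size_take cm in k2.
have LE : encode_rows L = encode_body (take r L) ++ encode_row l ++ encode_rows (drop r.+1 L).
  rewrite -{1}(cat_take_drop r L) (drop_nth [::]) // -/l /encode_rows /encode_body.
  by rewrite map_cat flatten_cat /= !rcons_cat.
have lE : encode_row l = encode_entries (take c l) ++ encode_fraction (nth x0 l c) ++
    Comma :: encode_row (drop c.+1 l).
  rewrite -{1}(cat_take_drop c l) (drop_nth x0) // /encode_row /encode_entries.
  by rewrite map_cat flatten_cat rcons_cat; congr (_ ++ _); rewrite /= rcons_cat cat_rcons.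
exists ((u ++ encode_body (take r L)) ++ encode_entries (take c l)).
exists (encode_row (drop c.+1 l) ++ encode_rows (drop r.+1 L)); split=> //.
by rewrite LE lE -!catA /= -?catA.
Qed.

End Parse.

(** * Column sums of products and their signed carry *)

Section Digits.
Implicit Types a b : seq bool.

Lemma nat_of_bits_sum a : nat_of_bits a = \sum_(0 <= i < size a) nth false a i * 2 ^ i.
Proof.
elim: a => [|c a IH]; first by rewrite big_geq.
rewrite big_nat_recl //= muln1 IH; congr (_ + _).
rewrite -mul2n big_distrr /=; apply: eq_bigr => i _.
by rewrite expnS mulnCA.
Qed.

(** The column of weight [2 ^ t] in long multiplication, before any carry. *)
Definition conv a b t :=
  \sum_(0 <= i < size a) \sum_(0 <= j < size b) (nth false a i && (nth false b j && (i + j == t))).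

Lemma sum_eq_le1 n k (F : nat -> bool) (g : nat -> nat) : injective g ->
  \sum_(0 <= j < n) (F j && (g j == k)) <= 1.
Proof.
move=> gI; elim: n => [|n IH]; first by rewrite big_geq.
rewrite big_nat_recr //=; case: (F n) => /=; last by rewrite addn0.
case: eqP => [gn|_] /=; last by rewrite addn0.
rewrite big_nat big1 // => j jn; case: eqP => [gj|]; last by rewrite andbF.
by move: jn; rewrite (gI j n) ?ltnn ?andbF // gj gn.
Qed.

(** Each [i] meets at most one [j] in column [t]. Together with [conv_sizer] this bounds a column by
    the shorter factor, which later keeps two columns within half the input length. *)
Lemma conv_sizel a b t : conv a b t <= size a.
Proof.
apply: (@leq_trans (\sum_(0 <= i < size a) 1)); last by rewrite sum_nat_const_nat subn0 muln1.
apply: leq_sum => i _.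
case: (nth false a i); last by rewrite big1.
by apply: sum_eq_le1 => x y; lia.
Qed.

Lemma conv_sizer a b t : conv a b t <= size b.
Proof.
rewrite /conv exchange_big /=.
apply: (@leq_trans (\sum_(0 <= j < size b) 1)); last by rewrite sum_nat_const_nat subn0 muln1.
apply: leq_sum => j _; under eq_bigr do rewrite andbA.
by apply: sum_eq_le1 => x y; lia.
Qed.

Lemma sum_conv n a b : size a + size b <= n ->
  \sum_(0 <= t < n) 2 ^ t * conv a b t = nat_of_bits a * nat_of_bits b.
Proof.
move=> abn; rewrite !nat_of_bits_sum big_distrl /=.
under eq_bigr do rewrite big_distrr /=.
rewrite exchange_big !big_nat /=; apply: eq_bigr => i ia.
under eq_bigr do rewrite big_distrr /=.
rewrite exchange_big /= big_distrr /= !big_nat; apply: eq_bigr => j jb.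
rewrite (bigD1_seq (i + j)) ?mem_iota ?iota_uniq //=; last by lia.
rewrite eqxx andbT big1 ?addn0 => [|t /negPf tij]; last by rewrite eq_sym tij !andbF muln0.
by case: nth; case: nth; rewrite /= ?mul0n ?muln0 ?mul1n // expnD muln1.
Qed.

Lemma sum_shift n s a (F : nat -> nat) : s + size a <= n ->
  \sum_(0 <= x < n) ((s <= x) && nth false a (x - s)) * F x =
  \sum_(0 <= i < size a) nth false a i * F (s + i).
Proof.
move=> san; rewrite (@big_cat_nat _ _ _ s) //=; last by lia.
rewrite big_nat big1 ?add0n => [|x xs]; last by rewrite leqNgt (_ : x < s) //; lia.
rewrite (@big_cat_nat _ _ _ (s + size a)) //=; last by lia.
rewrite [X in _ + X]big_nat [X in _ + X]big1 ?addn0 => [|x xs]; last first.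
  by rewrite nth_default ?andbF //; lia.
have -> : index_iota s (s + size a) = index_iota (0 + s) (s + size a) by [].
rewrite big_addn addKn; apply: eq_bigr => i _.
by rewrite leq_addl addnK addnC.
Qed.

End Digits.

Section Carry.
Variables (K : nat) (P M s : nat -> nat).
Hypotheses (PK : forall t, P t <= K) (MK : forall t, M t <= K).
(** Writing [s t = K + c], the carry [c] becomes the floor of half of [c + P t - M t]; adding [K]
    back gives this formula. [M t <= K] keeps the truncated subtraction exact. *)
Hypotheses (s0 : s 0 = K) (sS : forall t, s t.+1 = (s t + P t + K - M t)./2).

(* [s t - K] is the carry after [t] digits of the difference, with the floor
   convention, so that the remainder [r] is nonnegative. *)
Lemma carry_invariant t : exists r, [/\ r < 2 ^ t,
  \sum_(0 <= i < t) 2 ^ i * P i + 2 ^ t * K = \sum_(0 <= i < t) 2 ^ i * M i + 2 ^ t * s t + r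
  & s t <= K + K].
Proof.
elim: t => [|t [r [rt E sK]]].
  by exists 0; rewrite !big_geq // s0 leq_addr expn0 addn0.
have Pt := PK t; have Mt := MK t; set y := s t + P t + K - M t.
have yE : y + M t = s t + P t + K by rewrite /y; lia.
(* The bit dropped by halving [y] becomes bit [t] of the remainder. *)
exists (odd y * 2 ^ t + r); split.
- by rewrite expnS; case: (odd y); lia.
- rewrite !big_nat_recr //= sS -/y expnS.
  have y2 : y = odd y + 2 * y./2 by rewrite -{1}(odd_double_half y) -mul2n.
  have : 2 ^ t * (y + M t) = 2 ^ t * (s t + P t + K) by rewrite yE.
  by rewrite {1}y2 !mulnDr; nia.
- by rewrite sS; lia.
Qed.

(** The difference of the two sums is [2 ^ t] times the carry plus a nonnegative remainder below
    [2 ^ t], so it is nonnegative exactly when the carry is. *)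
Lemma carry_sign t :
  (K <= s t) = (\sum_(0 <= i < t) 2 ^ i * M i <= \sum_(0 <= i < t) 2 ^ i * P i).
Proof.
have [r [rt E _]] := carry_invariant t.
have t0 : 0 < 2 ^ t by rewrite expn_gt0.
by apply/idP/idP => H; nia.
Qed.

End Carry.

(** The condition amounts to [x < (y - m)./2]: halving a difference is counting an initial
    segment. *)
Lemma sum_below n m y : \sum_(0 <= x < n) (x + x + 1 + m < y) = minn n ((y - m)./2).
Proof.
elim: n => [|n IH]; first by rewrite big_geq // min0n.
by rewrite big_nat_recr //= IH; lia.
Qed.

(* The word at position [x] is a one in the numerator, resp. denominator, of
   the entry with key [e]. *)
Definition num_bit (w : seq symbol) e x :=
  [&& is_one (nth Bar w x), key (take x w) == e & slashes (take x w) == 0].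
Definition den_bit (w : seq symbol) e x :=
  [&& is_one (nth Bar w x), key (take x w) == e & 0 < slashes (take x w)].
Definition minus_at (w : seq symbol) e x := is_minus (nth Bar w x) && (key (take x w) == e).

(** * Reading one entry off the word *)

Section Located.
Variables (w u v : seq symbol) (x : fraction) (e : nat * nat * nat).
Hypotheses (wE : w = u ++ encode_fraction x ++ Comma :: v) (ue : key u = e) (us : ends_with_sep u).

Let sg := if negative x then [:: Minus] else [::].
(** [s] and [s'] are the first positions of the numerator and of the denominator; the [1] in [s']
    skips the slash. *)
Let s := size u + size sg.
Let s' := s + size (numerator x) + 1.

Lemma size_encode_fraction :
  size (encode_fraction x) = size sg + size (numerator x) + 1 + size (denominator x).
Proof. by clear s' s wE ue us; rewrite /encode_fraction -/sg !size_cat /= !size_map; lia. Qed.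

Lemma take_inside q : q <= size (encode_fraction x) ->
  take (size u + q) w = u ++ take q (encode_fraction x).
Proof. by move=> qs; rewrite wE takeD take_size_cat // drop_size_cat // takel_cat. Qed.

(** The key is constant from the beginning of the entry through the position of its comma. Elsewhere
    it differs by [key_sep], because a separator lies in between: the last symbol of [u], or that
    comma. *)
Lemma key_located y : y < size w ->
  (key (take y w) == e) = (size u <= y <= size u + size (encode_fraction x)).
Proof.
move=> yw; apply/eqP/idP => [ke|yu]; last first.
  have -> : y = size u + (y - size u) by lia.
  rewrite take_inside ?key_nosep //; last by lia.
  by apply: contra (encode_fraction_nosep x); apply: has_take_has.
case: (ltnP y (size u)) => [yu|uy].
  have uE : u = take y w ++ drop y u by rewrite wE takel_cat ?cat_take_drop // ltnW.
  have := key_sep (u := take y w) (v := drop y u); rewrite -uE ke ue => /(_ erefl).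
  have [u' [z [zs u'E]]] := us.
  move: yu; rewrite u'E size_rcons => yu.
  by rewrite -cats1 drop_cat; case: ltnP => [_|]; [rewrite has_cat /= zs orbT|
    move=> ?; rewrite (_ : y - _ = 0) /= ?zs //; lia].
rewrite /= leqNgt; apply/negP => uy2.
have E : take y w = u ++ take (y - size u) (encode_fraction x ++ Comma :: v).
  by rewrite wE take_cat ltnNge uy.
have := key_sep (u := u) (v := take (y - size u) (encode_fraction x ++ Comma :: v)).
rewrite -E ke ue => /(_ erefl); rewrite take_cat; case: ltnP => [|_]; first by lia.
rewrite has_cat; case Ey : (y - size u - size (encode_fraction x)) => [|k] /=; last by rewrite orbT.
by lia.
Qed.

Lemma nth_located q : nth Bar w (size u + q) = nth Bar (encode_fraction x ++ Comma :: v) q.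
Proof. by rewrite wE nth_cat ltnNge leq_addr /= addKn. Qed.

Lemma slashes_located q : q <= size (encode_fraction x) ->
  slashes (take (size u + q) w) = (size sg + size (numerator x) < q).
Proof.
move=> qs; rewrite take_inside // /slashes ends_reset // cnt_count; last first.
  by apply: contra (encode_fraction_nosep x); apply: has_take_has.
have bits (t : seq bool) k : count is_slash (take k (map Bit t)) = 0.
  by rewrite -map_take count_map; elim: (take k t).
have sg0 k : count is_slash (take k sg) = 0 by rewrite /sg; case: ifP; case: k => [|[]].
have sg1 : count is_slash sg = 0 by rewrite /sg; case: ifP.
have bits1 (t : seq bool) : count is_slash (map Bit t) = 0 by rewrite count_map; elim: t.
rewrite /encode_fraction -/sg take_cat; case: ltnP => [q1|q1].
  by rewrite sg0; case: ltnP => //; lia.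
rewrite count_cat sg1 take_cat size_map; case: ltnP => [q2|q2].
  by rewrite bits; case: ltnP => //; lia.
rewrite count_cat bits1; case E : (q - size sg - size (numerator x)) => [|k] /=.
  by case: ltnP => //; lia.
by rewrite bits; case: ltnP => //; lia.
Qed.

Lemma nth_encode q : q <= size (encode_fraction x) ->
  is_one (nth Bar (encode_fraction x ++ Comma :: v) q) =
  (if q <= size sg + size (numerator x) then (size sg <= q) && nth false (numerator x) (q - size sg)
   else nth false (denominator x) (q - (size sg + size (numerator x) + 1))).
Proof.
have one (t : seq bool) k : k < size t -> is_one (nth Bar (map Bit t) k) = nth false t k.
  by move=> kt; rewrite (nth_map false).
have sg0 k : k < size sg -> is_one (nth Bar sg k) = false by rewrite /sg; case: ifP; case: k.
rewrite size_encode_fraction => qs.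
rewrite /encode_fraction -/sg -!catA nth_cat; case: ltnP => [q1|q1].
  by rewrite sg0 //; case: leqP => //; lia.
rewrite nth_cat size_map; case: ltnP => [q2|q2].
  by rewrite one // ifT //; lia.
case E : (q - size sg - size (numerator x)) => [|k] /=.
  by rewrite ifT ?nth_default //; lia.
rewrite ifF; last by lia.
rewrite (_ : q - _ = k); last by lia.
rewrite nth_cat size_map; case: ltnP => [kd|kd]; first by rewrite one.
rewrite [RHS]nth_default; last by lia.
by have -> : k - size (denominator x) = 0 by lia.
Qed.

Lemma size_located : size w = s' + size (denominator x) + 1 + size v.
Proof. by rewrite wE size_cat (size_cat (encode_fraction x)) size_encode_fraction /= /s' /s; lia. Qed.

Lemma num_bit_located y : y < size w -> num_bit w e y = (s <= y) && nth false (numerator x) (y - s).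
Proof.
move=> yw; rewrite /num_bit key_located //.
case: (boolP (size u <= y <= _)) => [yu|yu] /=; last first.
  rewrite andbF; case: (leqP s y) => //= sy; rewrite nth_default //.
  by move: yu; rewrite size_encode_fraction; lia.
have yE : y = size u + (y - size u) by lia.
have qs : y - size u <= size (encode_fraction x) by lia.
rewrite {1 2}yE nth_located slashes_located // nth_encode //.
have -> : y - s = y - size u - size sg by lia.
have -> : (s <= y) = (size sg <= y - size u) by lia.
case: (leqP (y - size u) (size sg + size (numerator x))) => [le|lt]; first by rewrite andbT.
by rewrite andbF [RHS]andbC nth_default //; lia.
Qed.

Lemma den_bit_located y : y < size w -> den_bit w e y = (s' <= y) && nth false (denominator x) (y - s').
Proof.
move=> yw; rewrite /den_bit key_located //.
case: (boolP (size u <= y <= _)) => [yu|yu] /=; last first.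
  rewrite andbF; case: (leqP s' y) => //= sy; rewrite nth_default //.
  by move: yu; rewrite size_encode_fraction; lia.
have yE : y = size u + (y - size u) by lia.
have qs : y - size u <= size (encode_fraction x) by lia.
rewrite {1 2}yE nth_located slashes_located // nth_encode //.
have -> : (s' <= y) = (size sg + size (numerator x) < y - size u) by lia.
case: (leqP (y - size u) (size sg + size (numerator x))) => [le|lt] /=; first by rewrite andbF.
by rewrite andbT /s' /s !subnDA.
Qed.

(** Numerals start with the least significant bit, so the number of bits read since the last non-bit
    is the exponent of the next one. *)
Lemma exps_num q : q <= size (numerator x) -> exps (take (s + q) w) = q.
Proof.
move=> qn; rewrite /s -addnA take_inside; last by rewrite size_encode_fraction; lia.
have -> : take (size sg + q) (encode_fraction x) = sg ++ map Bit (take q (numerator x)).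
  by rewrite /encode_fraction -/sg takeD take_size_cat // drop_size_cat // takel_cat ?size_map // map_take.
rewrite catA /exps cnt_reset; last first.
  have [u' [z [zs u'E]]] := us; rewrite /sg; case: ifP => _.
    by exists u, Minus; rewrite cats1.
  by exists u', z; rewrite cats0; split=> //; case: (z) zs.
rewrite cnt_count; last by elim: (take q _).
by rewrite count_map (@eq_count _ _ predT) // count_predT size_takel.
Qed.

Lemma exps_den q : q <= size (denominator x) -> exps (take (s' + q) w) = q.
Proof.
move=> qn; rewrite /s' /s -!addnA take_inside; last by rewrite size_encode_fraction; lia.
have -> : take (size sg + (size (numerator x) + (1 + q))) (encode_fraction x) =
    rcons (sg ++ map Bit (numerator x)) Slash ++ map Bit (take q (denominator x)).
  rewrite /encode_fraction -/sg takeD take_size_cat // drop_size_cat // takeD.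
  rewrite take_size_cat ?size_map // drop_size_cat ?size_map //= -map_take.
  by rewrite cat_rcons -catA.
rewrite catA /exps cnt_reset; last by exists (u ++ sg ++ map Bit (numerator x)), Slash; rewrite !rcons_cat.
rewrite cnt_count; last by elim: (take q _).
by rewrite count_map (@eq_count _ _ predT) // count_predT size_takel.
Qed.

Lemma minus_located : has (minus_at w e) (iota 0 (size w)) = negative x.
Proof.
apply/hasP/idP => [[y]|nx].
  rewrite mem_iota => /= yw /andP[my]; rewrite key_located // => yu.
  have yE : y = size u + (y - size u) by lia.
  move: my; rewrite yE nth_located /encode_fraction -/sg.
  case: (boolP (negative x)) => // nx; rewrite /sg (negPf nx) cat0s -catA nth_cat size_map.
  have nob (t : seq bool) k : k < size t -> is_minus (nth Bar (map Bit t) k) = false.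
    by move=> kt; rewrite (nth_map false).
  case: ltnP => [k|k]; first by rewrite nob.
  case E : (_ - size (numerator x)) => [|k'] //=; rewrite nth_cat size_map.
  case: ltnP => [k2|k2]; first by rewrite nob.
  move: yu; rewrite size_encode_fraction /sg (negPf nx) /= => yu.
  by have -> : k' - size (denominator x) = 0 by lia.
exists (size u); first by rewrite mem_iota size_located /s' /s; lia.
rewrite /minus_at key_located ?leqnn ?leq_addr ?andbT; last by rewrite size_located /s' /s; lia.
by rewrite -{1}[size u]addn0 nth_located /encode_fraction nx.
Qed.

End Located.

(** * Comparison of payoffs *)

Notation formula := (tm symbol).

Definition fnot (e : formula) := IfLt (Cst 0) e (Cst 0) (Cst 1).
Definition fand (e f : formula) := IfLt (Cst 0) e f (Cst 0).
Definition fdisj (e f : formula) := IfLt (Cst 0) e (Cst 1) f.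
Definition fimp (e f : formula) := IfLt (Cst 0) e f (Cst 1).
(** Counting truth values with [Sum] needs them to be [0] or [1], whereas [fand] may return any
    positive value. *)
Definition fbool (e : formula) := IfLt (Cst 0) e (Cst 1) (Cst 0).
Definition flt (e f : formula) := IfLt e f (Cst 1) (Cst 0).
Definition fle (e f : formula) := IfLt f e (Cst 0) (Cst 1).
Definition feq (e f : formula) := fand (fle e f) (fle f e).
Definition fall (e : formula) := fnot (Sum (fnot e)).

(* In the following terms the last argument [d] is the number of position
   variables in scope, so that [Var d] is the next variable to be bound. *)
Definition cnt_tm (A R : pred symbol) p d : formula :=
  Sum (fbool (fand (fand (flt (Var d) (Var p)) (Sym A d))
    (fall (fnot (fand (fand (fle (Var d) (Var d.+1)) (flt (Var d.+1) (Var p))) (Sym R d.+1)))))).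

Definition key_tm b r c p d :=
  fand (feq (cnt_tm is_bar xpred0 p d) (Cst b))
    (fand (feq (cnt_tm is_semi is_bar p d) (Var r)) (feq (cnt_tm is_comma is_row_end p d) (Var c))).
Definition num_tm b r c x d :=
  fand (Sym is_one x) (fand (key_tm b r c x d) (feq (cnt_tm is_slash is_sep x d) (Cst 0))).
Definition den_tm b r c x d :=
  fand (Sym is_one x) (fand (key_tm b r c x d) (flt (Cst 0) (cnt_tm is_slash is_sep x d))).
(** The column sum [conv] of a numerator and a denominator, taken over positions of the input
    instead of bit lists. *)
Definition prod_tm b r c b' r' c' t d :=
  Sum (Sum (fbool (fand (num_tm b r c d d.+2) (fand (den_tm b' r' c' d.+1 d.+2)
    (feq (Add (cnt_tm is_bit is_no_bit d d.+2) (cnt_tm is_bit is_no_bit d.+1 d.+2)) (Var t)))))).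
Definition minus_tm b r c d := Sum (fand (Sym is_minus d) (key_tm b r c d d.+1)).
(** The flag [f] negates the payoff, so that an entry can be compared with the opposite of
    another. *)
Definition sign_tm b r c (f : bool) d := if f then fnot (minus_tm b r c d) else minus_tm b r c d.
(** By [sum_below] with [m = 0] this is half the word length, the offset of the carry. *)
Definition half_tm d := Sum (flt (Add (Add (Var d) (Var d)) (Cst 1)) (Sum (Cst 1))).

(** Cross-multiplied, the right side minus the left side is split into products [P] that count
    positively and [M] that count negatively. The iterated set has as many elements as the shifted
    carry. [Iter] starts from the empty set but the shifted carry starts at [N./2], hence the case
    distinction on the round [Var d]. *)
Definition le_tm b1 r1 c1 f1 b2 r2 c2 f2 d k : formula :=
  let D := d.+2 in
  let p21 := prod_tm b2 r2 c2 b1 r1 c1 d D in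
  let p12 := prod_tm b1 r1 c1 b2 r2 c2 d D in
  let s1 := sign_tm b1 r1 c1 f1 D in
  let s2 := sign_tm b2 r2 c2 f2 D in
  let P := Add (IfLt (Cst 0) s2 (Cst 0) p21) (IfLt (Cst 0) s1 p12 (Cst 0)) in
  let M := Add (IfLt (Cst 0) s2 p21 (Cst 0)) (IfLt (Cst 0) s1 (Cst 0) p12) in
  Iter (flt (Add (Add (Add (Var d.+1) (Var d.+1)) (Cst 1)) M)
            (Add (Add (IfLt (Cst 0) (Var d) (Sum (Elem k D)) (half_tm D)) P) (half_tm D)))
       (fle (half_tm d) (Sum (Elem k d))).

Lemma nth_rcons_lt (rho : seq nat) x i : i < size rho -> nth 0 (rcons rho x) i = nth 0 rho i.
Proof. by move=> ir; rewrite nth_rcons ir. Qed.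

Lemma nth_rcons_eq (rho : seq nat) x i : i = size rho -> nth 0 (rcons rho x) i = x.
Proof. by move=> ->; rewrite nth_rcons ltnn eqxx. Qed.

Ltac nthr := repeat match goal with
  | |- context [nth 0 (rcons ?r ?x) ?i] =>
    first [ rewrite (@nth_rcons_lt r x i); [|rewrite ?size_rcons; lia]
          | rewrite (@nth_rcons_eq r x i); [|rewrite ?size_rcons; lia] ] end.

Section Semantics.
Variable w : seq symbol.
Local Notation N := (size w).
Local Notation den := (den Bar w).

Definition holds e rho sigma := 0 < den e rho sigma.

Lemma den_sum e rho sigma :
  den (Sum e) rho sigma = \sum_(0 <= x < N) den e (rcons rho x) sigma.
Proof. by []. Qed.

Lemma den_add e f rho sigma : den (Add e f) rho sigma = den e rho sigma + den f rho sigma.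
Proof. by []. Qed.

Lemma den_iter f g rho sigma : den (Iter f g) rho sigma =
  den g rho (rcons sigma (iteri N (fun t X x =>
    (x < N) && holds f (rcons (rcons rho t) x) (rcons sigma X)) xpred0)).
Proof. by []. Qed.

Lemma holds_not e rho sigma : holds (fnot e) rho sigma = ~~ holds e rho sigma.
Proof. by rewrite /holds /=; case: (0 < den e _ _). Qed.

Lemma holds_and e f rho sigma : holds (fand e f) rho sigma = holds e rho sigma && holds f rho sigma.
Proof. by rewrite /holds /=; case: (0 < den e _ _). Qed.

Lemma holds_or e f rho sigma : holds (fdisj e f) rho sigma = holds e rho sigma || holds f rho sigma.
Proof. by rewrite /holds /=; case: (0 < den e _ _). Qed.

Lemma holds_imp e f rho sigma : holds (fimp e f) rho sigma = (holds e rho sigma ==> holds f rho sigma).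
Proof. by rewrite /holds /=; case: (0 < den e _ _). Qed.

Lemma holds_lt e f rho sigma : holds (flt e f) rho sigma = (den e rho sigma < den f rho sigma).
Proof. by rewrite /holds /=; case: (_ < den f _ _). Qed.

Lemma holds_le e f rho sigma : holds (fle e f) rho sigma = (den e rho sigma <= den f rho sigma).
Proof. by rewrite /holds /= [RHS]leqNgt; case: (_ < den e _ _). Qed.

Lemma holds_eq e f rho sigma : holds (feq e f) rho sigma = (den e rho sigma == den f rho sigma).
Proof. by rewrite holds_and !holds_le eqn_leq. Qed.

Lemma holds_sym P i rho sigma : holds (Sym P i) rho sigma = P (nth Bar w (nth 0 rho i)).
Proof. by rewrite /holds /=; case: P. Qed.

Lemma holds_elem j i rho sigma : holds (Elem j i) rho sigma = nth xpred0 sigma j (nth 0 rho i).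
Proof. by rewrite /holds /=; case: nth. Qed.

Lemma holds_sum e rho sigma :
  holds (Sum e) rho sigma = has (fun x => holds e (rcons rho x) sigma) (iota 0 N).
Proof.
rewrite /holds /= lt0n sum_nat_seq_neq0 /index_iota subn0.
by apply: eq_in_has => x _ /=; rewrite lt0n.
Qed.

Lemma holds_all e rho sigma :
  holds (fall e) rho sigma = all (fun x => holds e (rcons rho x) sigma) (iota 0 N).
Proof.
rewrite holds_not holds_sum -all_predC; apply: eq_all => x /=.
by rewrite holds_not negbK.
Qed.

Definition holdsE := (holds_not, holds_and, holds_or, holds_imp, holds_lt, holds_le, holds_eq,
  holds_sym, holds_elem, holds_sum, holds_all).

Lemma den_bool e rho sigma : den (fbool e) rho sigma = holds e rho sigma.
Proof. by rewrite /holds /=; case: (0 < den e _ _). Qed.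

Lemma den_if e f g rho sigma :
  den (IfLt (Cst 0) e f g) rho sigma = if holds e rho sigma then den f rho sigma else den g rho sigma.
Proof. by []. Qed.

(** Makes the fold expressible by quantifiers: a symbol at [q] stays in the count when no reset
    occurs from [q] on and before [p]. Position [q] is included, since a reset symbol is not counted
    itself. *)
Lemma cnt_sum A R p : cnt A R (take p w) =
  \sum_(0 <= q < N) ((q < p) && A (nth Bar w q) &&
    all (fun x => ~~ ((q <= x) && (x < p) && R (nth Bar w x))) (iota 0 N)).
Proof.
elim: p => [|p IH]; first by rewrite take0 big1.
case: (ltnP p N) => pN; last first.
  rewrite take_oversize; last by lia.
  rewrite take_oversize // in IH; rewrite IH !big_nat; apply: eq_bigr => q qN.
  congr (nat_of_bool (_ && _ && _)); first by lia.
  apply: eq_in_all => x; rewrite mem_iota => xN; congr (~~ (_ && _ && _)); lia.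
rewrite (take_nth Bar) // cnt_rcons IH.
case: (boolP (R (nth Bar w p))) => Rp.
  rewrite big_nat big1 // => q qN; case: (ltnP q p.+1) => //= qp.
  apply/eqP; rewrite eqb0 negb_and orbC -implybE; apply/implyP => /allP/(_ p).
  by rewrite mem_iota pN leq0n ltnSn Rp -[q <= p]ltnS qp => /(_ isT).
rewrite [RHS](bigD1_seq p) ?mem_iota ?iota_uniq //=; last by rewrite subn0 pN.
rewrite ltnSn andTb.
have -> : all (fun x => ~~ ((p <= x) && (x < p.+1) && R (nth Bar w x))) (iota 0 N).
  apply/allP => x _; case: (eqVneq x p) => [->|xp]; first by rewrite (negPf Rp) andbF.
  by rewrite ltnS -eqn_leq eq_sym (negPf xp).
rewrite andbT addnC; congr (_ + _).
rewrite (bigD1_seq p) ?mem_iota ?iota_uniq //=; last by rewrite subn0 pN.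
rewrite ltnn add0n; apply: eq_bigr => q qp; congr (nat_of_bool (_ && _ && _)).
  by move: qp; lia.
apply: eq_all => x; case: (eqVneq x p) => [->|xp]; first by rewrite (negPf Rp) !andbF.
by have -> : (x < p.+1) = (x < p) by move: xp; lia.
Qed.

Lemma cnt_tmE A R p d rho sigma : size rho = d -> p < d ->
  den (cnt_tm A R p d) rho sigma = cnt A R (take (nth 0 rho p) w).
Proof.
move=> rd pd; rewrite cnt_sum den_sum; apply: eq_bigr => q _; rewrite den_bool.
rewrite !holdsE /=; nthr; congr (nat_of_bool (_ && _)).
by apply: eq_all => x; rewrite !holdsE /=; nthr.
Qed.

Lemma key_tmE b r c p d rho sigma : size rho = d -> p < d ->
  holds (key_tm b r c p d) rho sigma =
  (key (take (nth 0 rho p) w) == (b, nth 0 rho r, nth 0 rho c)).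
Proof. by move=> rd pd; rewrite !holdsE !cnt_tmE //= /key !xpair_eqE andbA. Qed.

Lemma num_tmE b r c x d rho sigma : size rho = d -> x < d ->
  holds (num_tm b r c x d) rho sigma = num_bit w (b, nth 0 rho r, nth 0 rho c) (nth 0 rho x).
Proof. by move=> rd xd; rewrite 2!holds_and holds_sym key_tmE // holds_eq cnt_tmE. Qed.

Lemma den_tmE b r c x d rho sigma : size rho = d -> x < d ->
  holds (den_tm b r c x d) rho sigma = den_bit w (b, nth 0 rho r, nth 0 rho c) (nth 0 rho x).
Proof. by move=> rd xd; rewrite 2!holds_and holds_sym key_tmE // holds_lt cnt_tmE. Qed.

Definition prod_word e e' t := \sum_(0 <= x < N) \sum_(0 <= y < N)
  (num_bit w e x && (den_bit w e' y && (exps (take x w) + exps (take y w) == t))).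

Lemma prod_tmE b r c b' r' c' t d rho sigma : size rho = d ->
  r < d -> c < d -> r' < d -> c' < d -> t < d ->
  den (prod_tm b r c b' r' c' t d) rho sigma =
  prod_word (b, nth 0 rho r, nth 0 rho c) (b', nth 0 rho r', nth 0 rho c') (nth 0 rho t).
Proof.
move=> rd rl cl r'l c'l tl; rewrite den_sum; apply: eq_bigr => x _; rewrite den_sum; apply: eq_bigr => y _.
have sd : size (rcons (rcons rho x) y) = d.+2 by rewrite !size_rcons rd.
rewrite den_bool 2!holds_and num_tmE // den_tmE // holds_eq den_add.
by rewrite !cnt_tmE // [den (Var _) _ _]/=; nthr.
Qed.

Definition minus_word e := has (minus_at w e) (iota 0 N).

Lemma minus_tmE b r c d rho sigma : size rho = d -> r < d -> c < d ->
  holds (minus_tm b r c d) rho sigma = minus_word (b, nth 0 rho r, nth 0 rho c).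
Proof.
move=> rd rl cl; rewrite holds_sum; apply: eq_has => x.
have sd : size (rcons rho x) = d.+1 by rewrite size_rcons rd.
rewrite -[LHS]/(holds (fand (Sym is_minus d) (key_tm b r c d d.+1)) (rcons rho x) sigma).
by rewrite holds_and holds_sym key_tmE // /minus_at; nthr.
Qed.

Lemma sign_tmE b r c f d rho sigma : size rho = d -> r < d -> c < d ->
  holds (sign_tm b r c f d) rho sigma = minus_word (b, nth 0 rho r, nth 0 rho c) (+) f.
Proof.
move=> rd rl cl; rewrite /sign_tm; case: f; rewrite ?holds_not minus_tmE // ?addbT ?addbF //.
Qed.

Lemma half_tmE d rho sigma : size rho = d -> den (half_tm d) rho sigma = N./2.
Proof.
move=> rd; rewrite den_sum -[RHS](_ : minn N ((N - 0)./2) = _); last by lia.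
rewrite -sum_below; apply: eq_bigr => x _; rewrite /=; nthr.
by rewrite sum_nat_const_nat subn0 muln1 addn0; case: ltnP.
Qed.

Section LeWord.
Variables (e1 : nat * nat * nat) (f1 : bool) (e2 : nat * nat * nat) (f2 : bool).

Let s1 := minus_word e1 (+) f1.
Let s2 := minus_word e2 (+) f2.
Definition plus_digit t := (if s2 then 0 else prod_word e2 e1 t) + (if s1 then prod_word e1 e2 t else 0).
Definition minus_digit t := (if s2 then prod_word e2 e1 t else 0) + (if s1 then 0 else prod_word e1 e2 t).

Definition carry_set n : pred nat := iteri n (fun t (X : pred nat) x => (x < N) &&
  (x + x + 1 + minus_digit t <
   (if 0 < t then \sum_(0 <= y < N) X y else N./2) + plus_digit t + N./2)) xpred0.

Definition le_word := N./2 <= \sum_(0 <= x < N) carry_set N x.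

(** For positive [t] the set [carry_set t] has [s t] elements; for [t = 0] it is empty although
    [s 0] is [N./2], hence the assumption that [N] is positive. *)
Lemma le_wordE : 0 < N -> (forall t, plus_digit t <= N./2) -> (forall t, minus_digit t <= N./2) ->
  le_word = (\sum_(0 <= t < N) 2 ^ t * minus_digit t <= \sum_(0 <= t < N) 2 ^ t * plus_digit t).
Proof.
move=> N0 PK MK.
pose s := fix s t := if t is t'.+1 then (s t' + plus_digit t' + N./2 - minus_digit t')./2 else N./2.
(* The shifted carry is at most twice [N./2], so its initial segment is not cut off by the end of
   the word. *)
have sb t : s t <= N.
  have [//|r [_ _]] := carry_invariant PK MK (s := s) (erefl _) _ t; lia.
have sE t : 0 < t -> \sum_(0 <= x < N) carry_set t x = s t.
  elim: t => [//|t IH] _.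
  have E : (if 0 < t then \sum_(0 <= y < N) carry_set t y else N./2) = s t.
    by case: t IH => [//|t] ->.
  transitivity (\sum_(0 <= x < N) (x + x + 1 + minus_digit t < s t + plus_digit t + N./2)).
    by rewrite !big_nat; apply: eq_bigr => x /andP[_ xN]; rewrite {1}/carry_set /= -/(carry_set t) E xN.
  by rewrite sum_below; have := sb t.+1; rewrite /=; lia.
rewrite /le_word sE //; exact: (carry_sign PK MK (s := s)).
Qed.

End LeWord.

Lemma le_tmE b1 r1 c1 f1 b2 r2 c2 f2 d k rho sigma : size rho = d -> size sigma = k ->
  r1 < d -> c1 < d -> r2 < d -> c2 < d ->
  holds (le_tm b1 r1 c1 f1 b2 r2 c2 f2 d k) rho sigma =
  le_word (b1, nth 0 rho r1, nth 0 rho c1) f1 (b2, nth 0 rho r2, nth 0 rho c2) f2.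
Proof.
move=> rd sk r1l c1l r2l c2l.
rewrite /holds den_iter -/(holds _ _ _) holds_le half_tmE // den_sum.
set phi := flt _ _; pose Y n : pred nat :=
  iteri n (fun t X x => (x < N) && holds phi (rcons (rcons rho t) x) (rcons sigma X)) xpred0.
have XE n : Y n =1 carry_set (b1, nth 0 rho r1, nth 0 rho c1) f1 (b2, nth 0 rho r2, nth 0 rho c2) f2 n.
  elim: n => [//|n IH] x; rewrite /Y /carry_set !iteriS -/(carry_set _ _ _ _ n) -/(Y n).
  congr (_ && _).
  have sd : size (rcons (rcons rho n) x) = d.+2 by rewrite !size_rcons rd.
  rewrite holds_lt !den_add !den_if half_tmE // !sign_tmE ?prod_tmE //; try lia.
  rewrite den_sum; nthr.
  rewrite -[den (Var d.+1) _ _]/(nth 0 (rcons (rcons rho n) x) d.+1).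
  rewrite -[holds (Var d) _ _]/(0 < nth 0 (rcons (rcons rho n) x) d); nthr.
  congr (_ < (if _ then _ else _) + _ + _); apply: eq_bigr => y _.
  by rewrite -[LHS]/(nat_of_bool (nth xpred0 (rcons sigma (Y n)) k (nth 0 (rcons _ y) d.+2)));
    nthr; rewrite nth_rcons sk ltnn eqxx IH.
congr (_ <= _); apply: eq_bigr => x _.
by rewrite /= -/(Y N); nthr; rewrite nth_rcons sk ltnn eqxx XE.
Qed.

End Semantics.

Import Order.TTheory GRing.Theory Num.Theory.

(** * Order independence of elimination in zero-sum games *)

Section Reduction.
Local Open Scope ring_scope.
Variables (R : realDomainType) (M : nat).
Local Notation T := 'I_M.
Variables (side : T -> bool) (u : T -> T -> R).
Hypothesis u_anti : forall x y, u x y = - u y x.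

Implicit Types (P S : {set T}).

(** The quantifier ranges over both sides: in the application two strategies of one player have
    payoff [0], so only the opponent's strategies constrain anything. *)
Definition dominated S a b := [&& b \in S, b != a, side b == side a & [forall y in S, u a y <= u b y]].

Definition removable P S a := [&& a \in S, a \notin P & [exists b, dominated S a b]].

Definition rstep P S S' := exists2 a, removable P S a & S' = S :\ a.

Inductive reach P S : {set T} -> Prop :=
| reach_refl : reach P S S
| reach_step S1 S2 : rstep P S S1 -> reach P S1 S2 -> reach P S S2.

Definition normal P S := forall a, ~~ removable P S a.

(** The permutation acts on all strategies, which makes composites and inverses available, but
    payoffs have to agree only on [S]. *)
Definition iso P S S' := ex2
  (fun s : {perm T} => [/\ forall p, p \in P -> s p = p, forall a, side (s a) = side a & S' = s @: S])
  (fun s : {perm T} => forall a b, a \in S -> b \in S -> u (s a) (s b) = u a b).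

Lemma dominatedP S a b : reflect [/\ b \in S, b != a, side b = side a & forall y, y \in S -> u a y <= u b y] (dominated S a b).
Proof. by apply: (iffP and4P) => -[? ? /eqP ? /forall_inP ?]. Qed.

Lemma dom_sub S S' a b : S' \subset S -> b \in S' -> dominated S a b -> dominated S' a b.
Proof.
move=> /subsetP SS' bS' /dominatedP[bS ba sab le]; apply/dominatedP; split=> // y /SS'; exact: le.
Qed.

Lemma dom_trans S a b c : a != c -> dominated S a b -> dominated S b c -> dominated S a c.
Proof.
move=> ac /dominatedP[bS ba sab le1] /dominatedP[cS cb sbc le2]; apply/dominatedP; split=> //.
- by rewrite eq_sym.
- by rewrite sbc.
- by move=> y yS; apply: le_trans (le1 _ yS) (le2 _ yS).
Qed.

Lemma reach_trans P S1 S2 S3 : reach P S1 S2 -> reach P S2 S3 -> reach P S1 S3.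
Proof. by move=> r; elim: r S3 => [//|S S' S'' st _ IH] S3 /IH; apply: reach_step. Qed.

Lemma reach_sub P S S' : reach P S S' -> S' \subset S.
Proof.
elim=> {S S'} [S|S S1 S2 [a _ ->] _ IH] //.
by apply: subset_trans IH _; apply: subD1set.
Qed.

Lemma reach_protected P S S' p : p \in P -> p \in S -> reach P S S' -> p \in S'.
Proof.
move=> pP + r; elim: r => {S S'} // S S1 S2 [a /and3P[_ aP _] ->] _ IH pS.
by apply: IH; rewrite !inE pS andbT; apply: contraNneq aP => <-.
Qed.

Lemma rstep_card P S S' : rstep P S S' -> (#|S'| < #|S|)%N.
Proof. by move=> [a /and3P[aS _ _] ->]; rewrite (cardsD1 a S) aS. Qed.

Lemma normalize P S : exists2 S', reach P S S' & normal P S'.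
Proof.
elim: {S}#|S| {-2}S (leqnn #|S|) => [|n IH] S Sn;
  (have [/existsP[a aR]|/existsPn nS] := boolP [exists a, removable P S a];
   last by exists S => //; apply: reach_refl).
- by move: Sn aR; rewrite leqn0 cards_eq0 => /eqP->; rewrite /removable inE.
- have st : rstep P S (S :\ a) by exists a.
  have [|S' r nf] := IH (S :\ a); first by have := rstep_card st; lia.
  by exists S' => //; apply: reach_step r.
Qed.

Lemma iso_refl P S : iso P S S.
Proof.
exists 1%g; first by split=> [p _|a|]; rewrite ?perm1 // -[LHS]imset_id; apply: eq_imset => x; rewrite perm1.
by move=> a b _ _; rewrite !perm1.
Qed.

Lemma iso_sym P S S' : iso P S S' -> iso P S' S.
Proof.
move=> [s [sP ss SE] su]; exists (s^-1)%g; first split.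
- by move=> p pP; rewrite -{1}(sP p pP) permK.
- by move=> a; rewrite -{2}(permKV s a) ss.
- by rewrite SE -imset_comp -[LHS]imset_id; apply: eq_imset => x /=; rewrite permK.
- by move=> a b; rewrite SE => /imsetP[a' aS ->] /imsetP[b' bS ->]; rewrite !permK su.
Qed.

Lemma iso_trans P S1 S2 S3 : iso P S1 S2 -> iso P S2 S3 -> iso P S1 S3.
Proof.
move=> [s [sP ss SE] su] [t [tP ts TE] tu]; exists (s * t)%g; first split.
- by move=> p pP; rewrite permM sP // tP.
- by move=> a; rewrite permM ts ss.
- by rewrite TE SE -imset_comp; apply: eq_imset => x /=; rewrite permM.
- by move=> a b aS bS; rewrite !permM tu ?su // SE imset_f.
Qed.

Lemma iso_dom P S S' (s : {perm T}) a b :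
  (forall a, side (s a) = side a) -> S' = s @: S ->
  (forall a b, a \in S -> b \in S -> u (s a) (s b) = u a b) ->
  a \in S -> dominated S a b -> dominated S' (s a) (s b).
Proof.
move=> ss -> su aS /dominatedP[bS ba sab le]; apply/dominatedP; split.
- exact: imset_f.
- by rewrite (inj_eq perm_inj).
- by rewrite !ss.
- by move=> _ /imsetP[y yS ->]; rewrite !su // le.
Qed.

Lemma iso_rstep P S S1 S' : iso P S S' -> rstep P S S1 ->
  exists2 S1', rstep P S' S1' & iso P S1 S1'.
Proof.
move=> [s [sP ss SE] su] [a /and3P[aS aP /existsP[b ab]] ->].
exists (S' :\ s a).
  exists (s a) => //; apply/and3P; split; first by rewrite SE imset_f.
    apply: contra aP => saP; have := sP _ saP => /perm_inj E; by rewrite -E.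
  by apply/existsP; exists (s b); apply: (iso_dom P ss SE su aS ab).
exists s; last by move=> x y /setD1P[_ xS] /setD1P[_ yS]; apply: su.
split=> //; rewrite SE; apply/setP => y; apply/setD1P/imsetP.
  move=> [ya /imsetP[x xS yE]]; exists x => //; apply/setD1P; split=> //.
  by apply: contraNneq ya => <-; rewrite yE.
by move=> [x /setD1P[xa xS] ->]; rewrite (inj_eq perm_inj) imset_f.
Qed.

Lemma iso_reach P S S1 S' : reach P S S1 -> iso P S S' ->
  exists2 S1', reach P S' S1' & iso P S1 S1'.
Proof.
move=> r; elim: r S' => {S S1} [S|S S1 S2 st _ IH] S' SS'.
  by exists S' => //; apply: reach_refl.
have [S1' st' i1] := iso_rstep SS' st; have [S2' r2 i2] := IH _ i1.
by exists S2' => //; apply: reach_step st' r2.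
Qed.

Lemma iso_normal P S S' : iso P S S' -> normal P S -> normal P S'.
Proof.
move=> /iso_sym i nS a; apply/negP => aR.
have [S1 [b bR _] _] := iso_rstep i (ex_intro2 _ _ a aR (erefl _)).
by have := nS b; rewrite bR.
Qed.

(** If [a] was dominated by the removed [y], the dominator [y0] of [y] takes over by transitivity.
    This breaks down only when [y0] is [a], the mutual dominance treated by [iso_swap]. *)
Lemma dom_removable P S a x0 y y0 : removable P S y -> removable P S a ->
  dominated S a x0 -> dominated S y y0 -> a != y -> ~~ ((x0 == y) && (y0 == a)) ->
  removable P (S :\ y) a.
Proof.
move=> /and3P[yS yP _] /and3P[aS aP _] d1 d2 ay nE; apply/and3P; split=> //.
  by rewrite !inE ay.
apply/existsP; have [E|x0y] := eqVneq x0 y.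
  rewrite E eqxx /= in nE; exists y0; have [y0S y0y _ _] := dominatedP _ _ _ d2.
  apply: (dom_sub (subD1set S y)); first by rewrite !inE y0y.
  by apply: dom_trans d2; rewrite 1?eq_sym // -E.
exists x0; have [x0S _ _ _] := dominatedP _ _ _ d1.
by apply: (dom_sub (subD1set S y)) => //; rewrite !inE x0y.
Qed.

(** The transposition works because [x] and [y] have equal payoffs as first argument of [u], by
    mutual dominance, and as second argument, by [u_anti]. *)
Lemma iso_swap P S x y : x \notin P -> y \notin P -> x \in S -> y \in S ->
  dominated S x y -> dominated S y x -> iso P (S :\ x) (S :\ y).
Proof.
move=> xP yP xS yS /dominatedP[_ yx sxy le1] /dominatedP[_ _ _ le2].
have E z : z \in S -> u x z = u y z.
  by move=> zS; apply/le_anti; rewrite le1 // le2.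
have E' z : z \in S -> u z x = u z y.
  by move=> zS; rewrite u_anti E // -u_anti.
exists (tperm x y); first split.
- by move=> p pP; rewrite tpermD //; [apply: contraNneq xP => ->|apply: contraNneq yP => ->].
- by move=> a; case: tpermP => [->|->|].
- apply/setP => z; apply/setD1P/imsetP.
    move=> [zy zS]; have [->|zx] := eqVneq z x.
      by exists y; rewrite ?tpermR // !inE yx.
    by exists z; rewrite ?tpermD // 1?eq_sym // !inE zx.
  move=> [a /setD1P[ax aS] ->]; case: tpermP => [aE|_|_ /eqP ay].
  - by rewrite aE eqxx in ax.
  - by split=> //; rewrite eq_sym.
  - by split.
- move=> a b /setD1P[ax aS] /setD1P[bx bS].
  case: (tpermP x y a) ax aS => [->|->|_ _] ax aS; rewrite ?eqxx // in ax *;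
  case: (tpermP x y b) bx bS => [->|->|_ _] bx bS; rewrite ?eqxx // in bx *.
  + by rewrite E // E'.
  + exact: E.
  + exact: E'.
Qed.

Theorem confluence P S N1 N2 : reach P S N1 -> reach P S N2 ->
  normal P N1 -> normal P N2 -> iso P N1 N2.
Proof.
elim: {S}#|S| {-2}S (leqnn #|S|) N1 N2 => [|n IH] S Sn N1 N2 r1 r2 n1 n2.
  have S0 : S = set0 by apply/eqP; rewrite -cards_eq0 -leqn0.
  have := reach_sub r1; have := reach_sub r2; rewrite S0 !subset0 => /eqP-> /eqP->.
  exact: iso_refl.
case: r1 n1 => {N1} [|S1 N1 [x xR ->] r1] n1.
  case: r2 n2 => {N2} [|S2 N2 [y yR _] r2] n2; first exact: iso_refl.
  by have := n1 y; rewrite yR.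
case: r2 n2 => {N2} [|S2 N2 [y yR ->] r2] n2; first by have := n2 x; rewrite xR.
have cx : (#|S :\ x| <= n)%N by have := @rstep_card P S (S :\ x) (ex_intro2 _ _ x xR (erefl _)); lia.
have cy : (#|S :\ y| <= n)%N by have := @rstep_card P S (S :\ y) (ex_intro2 _ _ y yR (erefl _)); lia.
have [xy|xy] := eqVneq x y; first by rewrite -xy in r2; apply: IH cx _ _ r1 r2 n1 n2.
have [xS xP /existsP[x0 dx]] := and3P xR; have [yS yP /existsP[y0 dy]] := and3P yR.
(* If the chosen dominators of [x] and [y] are each other, the two results are isomorphic, and [r2]
   is transported to a reduction of [S :\ x]. *)
have [/andP[/eqP x0E /eqP y0E]|nE] := boolP ((x0 == y) && (y0 == x)).
  rewrite {}x0E in dx; rewrite {}y0E in dy.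
  have [N2' r2' i2] := iso_reach r2 (iso_sym (iso_swap xP yP xS yS dx dy)).
  apply: iso_trans (iso_sym i2); apply: IH cx _ _ r1 r2' n1 _.
  exact: iso_normal i2 n2.
(* Otherwise both removals can be made in either order, and a maximal reduction of [S :\ x :\ y]
   links [N1] and [N2]. *)
have [N3 r3 n3] := normalize P (S :\ x :\ y).
have i1 : iso P N1 N3.
  apply: IH cx _ _ r1 _ n1 n3; apply: reach_step r3; exists y => //.
  by apply: (dom_removable xR yR dy dx); [rewrite eq_sym|rewrite andbC].
have i2 : iso P N2 N3.
  apply: IH cy _ _ r2 _ n2 n3; apply: (@reach_step _ _ (S :\ x :\ y)) r3.
  exists x; first exact: (dom_removable yR xR dx dy).
  by apply/setP => z; rewrite !inE andbCA.
exact: iso_trans i1 (iso_sym i2).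
Qed.

(** Stop just before [i] is removed and let [k] be the dominator used there: it is still present, so
    no earlier step removed it. *)
Lemma reach_eliminated (S S' : {set T}) i : reach set0 S S' -> i \in S -> i \notin S' ->
  exists S0 k, [/\ reach [set i; k] S S0, i \in S0 & dominated S0 i k].
Proof.
elim=> {S S'} [S -> //|S S1 S2 [a aR ->] r IH] iS iS2.
have [aS _ /existsP[b ab]] := and3P aR.
have [ai|ai] := eqVneq a i.
  by exists S, b; rewrite -ai; split=> //; apply: reach_refl.
have iS1 : i \in S :\ a by rewrite !inE eq_sym ai.
have [S0 [k [r0 iS0 ik]]] := IH iS1 iS2.
have [kS0 _ _ _] := dominatedP _ _ _ ik; have kS1 := subsetP (reach_sub r0) _ kS0.
exists S0, k; split=> //; apply: reach_step r0; exists a => //.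
apply/and3P; split=> //; last by apply/existsP; exists b.
rewrite !inE negb_or ai /=; apply/eqP => ak.
by move: kS1; rewrite -ak !inE eqxx.
Qed.

Lemma reach_unprotected P S S' : reach P S S' -> reach set0 S S'.
Proof.
elim=> {S S'} [S|S S1 S2 [a /and3P[aS aP ae] ->] _ IH]; first exact: reach_refl.
by apply: reach_step IH; exists a => //; apply/and3P; split=> //; rewrite inE.
Qed.

(* Which rows survive depends on the order of elimination only through
   duplicates, so for a fixed pair [i], [k] of protected strategies any maximal
   reduction [G k] tells whether [k] can ever come to dominate [i]. *)
Theorem eliminableP i (G : T -> {set T}) :
  (forall k, reach [set i; k] setT (G k)) -> (forall k, normal [set i; k] (G k)) ->
  (exists2 S, reach set0 setT S & i \notin S) <-> (exists k, dominated (G k) i k).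
Proof.
move=> Gr Gn; split.
  move=> [S r iS]; have [|S0 [k [r0 iS0 ik]]] := reach_eliminated r _ iS; first by rewrite inE.
  have [kS0 ki sik le] := dominatedP _ _ _ ik.
  (* The reduction is continued from [S0] to a maximal one. There [i] and [k] survive and [k] still
     dominates [i]; the isomorphism fixing both carries this to [G k]. *)
  have [N1 r1 n1] := normalize [set i; k] S0.
  have [s [sP ss SE] su] := confluence (reach_trans r0 r1) (Gr k) n1 (Gn k).
  have si : s i = i by apply: sP; rewrite !inE eqxx.
  have sk : s k = k by apply: sP; rewrite !inE eqxx orbT.
  have iN : i \in N1 by apply: reach_protected r1; rewrite ?inE ?eqxx.
  have kN : k \in N1 by apply: reach_protected r1; rewrite ?inE ?eqxx ?orbT.
  exists k; rewrite -si -{2}sk; apply: (iso_dom [set i; k] ss SE su iN).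
  exact: dom_sub (reach_sub r1) kN ik.
move=> [k ik]; exists (G k :\ i); last by rewrite !inE eqxx.
apply: reach_trans (reach_unprotected (Gr k)) _.
apply: reach_step (@reach_refl _ _); exists i => //; apply/and3P; split; rewrite ?inE //.
  by apply: reach_protected (Gr k); rewrite ?inE ?eqxx.
by apply/existsP; exists k.
Qed.

(** Taking the removable strategy of least index makes the step deterministic and its result
    testable strategy by strategy, as a term requires. On a normal set it idles, so surplus rounds
    do no harm. *)
Definition gstep P S := [set a in S | ~~ (removable P S a && [forall b : T, (b < a)%N ==> ~~ removable P S b])].

Definition greedy P t := iter t (gstep P) setT.

Lemma gstepP P S : normal P S /\ gstep P S = S \/ rstep P S (gstep P S).
Proof.
have [/existsP[a aR]|/existsPn nS] := boolP [exists a, removable P S a]; last first.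
  by left; split=> //; apply/setP => a; rewrite !inE (negPf (nS a)) andbT.
right; case: (arg_minnP (fun a : T => a : nat) aR) => b bR bmin; exists b => //.
apply/setP => c; rewrite !inE [RHS]andbC; congr (_ && ~~ _).
apply/andP/eqP => [[cR /forallP cmin]|->].
  apply/val_inj/eqP; rewrite eqn_leq (bmin _ cR) andbT leqNgt.
  by apply/negP => bc; have := implyP (cmin b) bc; rewrite bR.
split=> //; apply/forallP => d; apply/implyP => db.
by apply/negP => /bmin; rewrite leqNgt db.
Qed.

Lemma greedy_reach P t : reach P setT (greedy P t).
Proof.
elim: t => [|t IH]; first exact: reach_refl.
apply: reach_trans IH _; rewrite /greedy iterS; have [[_ ->]|st] := gstepP P (greedy P t).
  exact: reach_refl.
exact: reach_step st (reach_refl _ _).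
Qed.

Lemma greedy_normal P t : (M <= t)%N -> normal P (greedy P t).
Proof.
suff H s : normal P (greedy P s) \/ (#|greedy P s| + s <= M)%N.
  move=> Mt; have [//|le] := H t => a; apply/negP => /and3P[aS _ _].
  by have : (0 < #|greedy P t|)%N; [apply/card_gt0P; exists a|lia].
elim: s => [|s [nf|IH]]; first by right; rewrite cardsT card_ord addn0.
  by left; rewrite /greedy iterS; have [[_ ->//]|[a]] := gstepP P (greedy P s); rewrite (negPf (nf a)).
have [[nf E]|/rstep_card lt] := gstepP P (greedy P s); first by left; rewrite /greedy iterS E.
by right; rewrite /greedy iterS; move: lt; rewrite -/(greedy P s); lia.
Qed.

End Reduction.

(** * Zero-sum matrix games as antisymmetric games *)

Section MatrixGame.
Local Open Scope ring_scope.
Variables (R : realType) (n m : nat) (A : 'M[R]_(n, m)).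
Local Notation T := 'I_(n + m).

Definition is_row (x : T) := (x < n)%N.

(** The block matrix with [A] and minus its transpose off the diagonal; rows come first in
    ['I_(n + m)]. *)
Definition payoff (x y : T) : R :=
  match split x, split y with
  | inl i, inr j => A i j
  | inr j, inl i => - A i j
  | _, _ => 0
  end.

Lemma payoff_anti x y : payoff x y = - payoff y x.
Proof. by rewrite /payoff; case: split => a; case: split => b; rewrite ?oppr0 ?opprK. Qed.

Lemma splitl i : split (lshift m i : T) = inl i.
Proof. exact: (unsplitK (inl i)). Qed.

Lemma splitr j : split (rshift n j : T) = inr j.
Proof. exact: (unsplitK (inr j)). Qed.

Lemma shiftP (x : T) : (exists i, x = lshift m i) \/ (exists j, x = rshift n j).
Proof. by rewrite -(splitK x); case: (split x) => y; [left|right]; exists y. Qed.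

Lemma is_rowl i : is_row (lshift m i). Proof. exact: (ltn_ord i). Qed.
Lemma is_rowr j : is_row (rshift n j) = false.
Proof. by rewrite /is_row /= ltnNge leq_addr. Qed.

Local Notation gdom := (dominated is_row payoff).

Lemma dom_rowP (S : {set T}) i k : reflect
  [/\ lshift m k \in S, k != i & forall j, rshift n j \in S -> A i j <= A k j]
  (gdom S (lshift m i) (lshift m k)).
Proof.
have H := dominatedP is_row payoff S (lshift m i) (lshift m k); apply: (iffP H) => [[kS ki _ le]|[kS ki le]].
  split=> // j jS.
  by have := le _ jS; rewrite /payoff !splitl splitr.
split=> //; rewrite ?is_rowl ?(inj_eq (@lshift_inj n m)) // => y yS.
have [[i' E]|[j E]] := shiftP y; rewrite E /payoff !splitl ?splitr ?splitl //.
by apply: le; rewrite -E.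
Qed.

Lemma dom_colP (S : {set T}) j l : reflect
  [/\ rshift n l \in S, l != j & forall i, lshift m i \in S -> A i l <= A i j]
  (gdom S (rshift n j) (rshift n l)).
Proof.
apply: (iffP (dominatedP is_row payoff S _ _)) => [[kS ki _ le]|[kS ki le]].
  rewrite (inj_eq (@rshift_inj n m)) in ki; split=> // i iS.
  by have := le _ iS; rewrite /payoff !splitr splitl lerN2.
split=> //; rewrite ?is_rowr ?(inj_eq (@rshift_inj n m)) // => y yS.
have [[i E]|[j' E]] := shiftP y; rewrite E /payoff !splitr ?splitl ?splitr //.
by rewrite lerN2; apply: le; rewrite -E.
Qed.

Lemma dom_row (S : {set T}) i b : gdom S (lshift m i) b -> exists k, b = lshift m k.
Proof.
move=> /dominatedP[_ _ sb _]; have [[k ->]|[j bE]] := shiftP b; first by exists k.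
by move: sb; rewrite bE is_rowl is_rowr.
Qed.

Lemma dom_col (S : {set T}) j b : gdom S (rshift n j) b -> exists l, b = rshift n l.
Proof.
move=> /dominatedP[_ _ sb _]; have [[k bE]|[l ->]] := shiftP b; last by exists l.
by move: sb; rewrite bE is_rowl is_rowr.
Qed.

Definition strategies (s : subgame n m) : {set T} :=
  [set x | match split x with inl i => i \in s.1 | inr j => j \in s.2 end].

Lemma strategiesl s i : (lshift m i \in strategies s) = (i \in s.1).
Proof. by rewrite inE splitl. Qed.

Lemma strategiesr s j : (rshift n j \in strategies s) = (j \in s.2).
Proof. by rewrite inE splitr. Qed.

Lemma strategies_row s i : strategies (s.1 :\ i, s.2) = strategies s :\ lshift m i.
Proof.
apply/setP => x; rewrite [RHS]in_setD1; have [[k ->]|[j ->]] := shiftP x.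
  by rewrite !strategiesl in_setD1 (inj_eq (@lshift_inj n m)).
by rewrite !strategiesr eq_rlshift.
Qed.

Lemma strategies_col s j : strategies (s.1, s.2 :\ j) = strategies s :\ rshift n j.
Proof.
apply/setP => x; rewrite [RHS]in_setD1; have [[k ->]|[l ->]] := shiftP x.
  by rewrite !strategiesl eq_lrshift.
by rewrite !strategiesr in_setD1 (inj_eq (@rshift_inj n m)).
Qed.

Lemma weak_step_reach s t : weak_step A (- A) s t ->
  reach is_row payoff set0 (strategies s) (strategies t).
Proof.
case/orP => /existsP[x /andP[/eqP-> /exists_inP[x0]]].
  rewrite in_setD1 strategies_row => /andP[x0x x0s] /forall_inP le.
  (* [weak_step] does not ask that the removed strategy be present; if it is absent, nothing
     changes. *)
  have [xs|xs] := boolP (lshift m x \in strategies s); last first.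
    rewrite (_ : _ :\ _ = strategies s); first exact: reach_refl.
    by apply/setP => y; rewrite in_setD1; case: eqP => // ->; rewrite (negPf xs).
  apply: reach_step (reach_refl _ _ _ _); exists (lshift m x) => //; apply/and3P; split; [exact: xs|by rewrite in_set0|].
  apply/existsP; exists (lshift m x0); apply/dom_rowP; rewrite strategiesl; split=> // j.
  by rewrite strategiesr; apply: le.
rewrite in_setD1 strategies_col => /andP[x0x x0s] /forall_inP le.
have [xs|xs] := boolP (rshift n x \in strategies s); last first.
  rewrite (_ : _ :\ _ = strategies s); first exact: reach_refl.
  by apply/setP => y; rewrite in_setD1; case: eqP => // ->; rewrite (negPf xs).
apply: reach_step (reach_refl _ _ _ _); exists (rshift n x) => //; apply/and3P; split; [exact: xs|by rewrite in_set0|].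
apply/existsP; exists (rshift n x0); apply/dom_colP; rewrite strategiesr; split=> // i.
by rewrite strategiesl => /le; rewrite !mxE lerN2.
Qed.

Lemma rstep_weak_step s S : rstep is_row payoff set0 (strategies s) S ->
  exists2 t, weak_step A (- A) s t & S = strategies t.
Proof.
move=> [a /and3P[aS _ /existsP[b ab]] ->].
have [[i aE]|[j aE]] := shiftP a; rewrite aE in ab aS *.
  have [k bE] := dom_row ab; rewrite bE in ab; have /dom_rowP[kS ki le] := ab.
  exists (s.1 :\ i, s.2); last by rewrite strategies_row.
  apply/orP; left; apply/existsP; exists i; rewrite eqxx /=; apply/exists_inP; exists k.
    by rewrite in_setD1 ki -strategiesl.
  by apply/forall_inP => j js; apply: le; rewrite strategiesr.
have [l bE] := dom_col ab; rewrite bE in ab; have /dom_colP[lS lj le] := ab.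
exists (s.1, s.2 :\ j); last by rewrite strategies_col.
apply/orP; right; apply/existsP; exists j; rewrite eqxx /=; apply/exists_inP; exists l.
  by rewrite in_setD1 lj -strategiesr.
by apply/forall_inP => i is_; rewrite !mxE lerN2; apply: le; rewrite strategiesl.
Qed.

Lemma weakly_eliminableE i : weakly_eliminable A (- A) i <->
  exists2 S, reach is_row payoff set0 setT S & lshift m i \notin S.
Proof.
have E : strategies ([set: 'I_n], [set: 'I_m]) = setT.
  by apply/setP => x; rewrite !inE; case: split => y; rewrite inE.
rewrite -E; split.
  move=> [I [J [/connectP[p pp pl] iI]]]; exists (strategies (I, J)); last by rewrite strategiesl.
  rewrite {}pl {iI I J E}; move: ([set: 'I_n], [set: 'I_m]) pp => s.
  elim: p s => [|t p IH] s /=; first by move=> _; apply: reach_refl.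
  by move=> /andP[/weak_step_reach st /IH]; apply: reach_trans.
move=> [S r iS].
suff [t [st SE]] : exists t, connect (weak_step A (- A)) ([set: 'I_n], [set: 'I_m]) t /\ S = strategies t.
  by exists t.1, t.2; rewrite -surjective_pairing; split=> //; rewrite -strategiesl -SE.
move: r {iS E}; move: (_, _) => s; move E : (strategies s) => S0 r.
elim: r s E => {S0 S} [S s <-|S S1 S2 st _ IH s E]; first by exists s.
rewrite -E in st; have [t st' tE] := rstep_weak_step st.
have [t' [tt' S2E]] := IH t (esym tE).
by exists t'; split=> //; apply: connect_trans tt'; apply: connect1.
Qed.

Definition greedy_pair i k := greedy is_row payoff [set lshift m i; lshift m k].

Theorem weakly_eliminable_greedy i t : (n + m <= t)%N ->
  weakly_eliminable A (- A) i <->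
  exists k, k != i /\ forall j, rshift n j \in greedy_pair i k t -> A i j <= A k j.
Proof.
move=> nmt; rewrite weakly_eliminableE.
rewrite (eliminableP payoff_anti (G := fun k => greedy is_row payoff [set lshift m i; k] t)).
- split=> [[b ib]|[k [ki le]]].
    have [k bE] := dom_row ib; rewrite bE in ib; have /dom_rowP[_ ki le] := ib.
    by exists k.
  exists (lshift m k); apply/dom_rowP; split=> //.
  by apply: reach_protected (greedy_reach _ _ _ _); rewrite !inE ?eqxx ?orbT.
- by move=> k; apply: greedy_reach.
- by move=> k; apply: greedy_normal.
Qed.

End MatrixGame.

(** * The term deciding the problem *)

Definition located (w : seq symbol) e x := exists u v,
  [/\ w = u ++ encode_fraction x ++ Comma :: v, key u = e & ends_with_sep u].

Section LocatedPairs.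
Variable w : seq symbol.
Local Notation N := (size w).

(** By [key_located] the key determines the stretch of the word, so entries with different keys do
    not overlap and their four numerals fit in the word side by side. *)
Lemma located_disjoint e1 x1 e2 x2 : located w e1 x1 -> located w e2 x2 -> e1 != e2 ->
  size (numerator x1) + size (denominator x1) + size (numerator x2) + size (denominator x2) <= N.
Proof.
move=> [u1 [v1 [w1 k1 s1]]] [u2 [v2 [w2 k2 s2]]] e12.
have N1 := size_located w1; have N2 := size_located w2.
have S1 := size_encode_fraction x1; have S2 := size_encode_fraction x2.
have l1 : size u1 < N by lia.
have l2 : size u2 < N by lia.
have K12 := key_located w1 k1 s1 l2; have K22 := key_located w2 k2 s2 l2.
have K11 := key_located w1 k1 s1 l1; have K21 := key_located w2 k2 s2 l1.
rewrite leqnn leq_addr in K22; rewrite leqnn leq_addr in K11.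
rewrite (eqP K22) eq_sym (negPf e12) in K12; rewrite (eqP K11) (negPf e12) in K21.
lia.
Qed.

Lemma located_size e x : located w e x -> size (numerator x) + size (denominator x) <= N.
Proof. by move=> [u [v [wE _ _]]]; rewrite (size_located wE); lia. Qed.

Lemma located_minus e x : located w e x -> minus_word w e = negative x.
Proof. by move=> [u [v [wE ke us]]]; apply: minus_located wE ke us. Qed.

Lemma prod_word_located e1 x1 e2 x2 t : located w e1 x1 -> located w e2 x2 ->
  prod_word w e1 e2 t = conv (numerator x1) (denominator x2) t.
Proof.
move=> [u1 [v1 [w1 k1 s1]]] [u2 [v2 [w2 k2 s2]]].
have N1 := size_located w1; have N2 := size_located w2.
rewrite /prod_word /conv; set q1 := size u1 + _ in N1; set q2 := size u2 + _ + _ + 1 in N2.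
transitivity (\sum_(0 <= x < N) ((q1 <= x) && nth false (numerator x1) (x - q1)) *
  \sum_(0 <= j < size (denominator x2)) (nth false (denominator x2) j && (exps (take x w) + j == t))).
  rewrite !big_nat; apply: eq_bigr => x /andP[_ xN].
  rewrite -(num_bit_located w1 k1 s1 xN); case: num_bit; last by rewrite big1.
  rewrite mul1n; transitivity (\sum_(0 <= y < N) ((q2 <= y) && nth false (denominator x2) (y - q2)) *
      (exps (take x w) + exps (take y w) == t)).
    by rewrite !big_nat; apply: eq_bigr => y /andP[_ yN]; rewrite (den_bit_located w2 k2 s2 yN) andTb -mulnb.
  rewrite sum_shift; last by lia.
  rewrite !big_nat; apply: eq_bigr => j /andP[_ jn].
  by rewrite (exps_den w2) ?mulnb // ltnW.
rewrite sum_shift; last by lia.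
rewrite !big_nat; apply: eq_bigr => i /andP[_ ib].
rewrite big_distrr /=; apply: eq_bigr => j _.
by rewrite (exps_num w1 s1) ?mulnb // ltnW.
Qed.

Lemma le_word_located (R : realType) e1 x1 f1 e2 x2 f2 :
  located w e1 x1 -> located w e2 x2 -> e1 != e2 ->
  le_word w e1 f1 e2 f2 =
  ((-1) ^+ f1 * fraction_val R x1 <= (-1) ^+ f2 * fraction_val R x2)%R.
Proof.
move=> L1 L2 e12; have D := located_disjoint L1 L2 e12.
have N1 := located_size L1; have N2 := located_size L2.
have p12 t := prod_word_located t L1 L2; have p21 t := prod_word_located t L2 L1.
have b12 t := conv_sizel (numerator x1) (denominator x2) t.
have b12' t := conv_sizer (numerator x1) (denominator x2) t.
have b21 t := conv_sizel (numerator x2) (denominator x1) t.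
have b21' t := conv_sizer (numerator x2) (denominator x1) t.
rewrite le_wordE; first last.
(* Each column is at most the shorter of its two numerals, and a sum of two such minima is at most
   half the total length of the four. *)
- move=> t; rewrite /minus_digit p12 p21; have := b12 t; have := b12' t; have := b21 t; have := b21' t.
  by case: ifP; case: ifP; lia.
- move=> t; rewrite /plus_digit p12 p21; have := b12 t; have := b12' t; have := b21 t; have := b21' t.
  by case: ifP; case: ifP; lia.
- by case: L1 => [u1 [v1 [-> _ _]]]; rewrite !size_cat /=; lia.
rewrite /minus_digit /plus_digit (located_minus L1) (located_minus L2) /fraction_val !mulrA -!signr_addb.
under eq_bigr do rewrite p12 p21; under [X in _ <= X]eq_bigr do rewrite p12 p21.
rewrite [f1 (+) _]addbC [f2 (+) _]addbC.
set n1 := nat_of_bits (numerator x1); set d1 := nat_of_bits (denominator x1).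
set n2 := nat_of_bits (numerator x2); set d2 := nat_of_bits (denominator x2).
have S12 : \sum_(0 <= t < N) 2 ^ t * conv (numerator x1) (denominator x2) t = n1 * d2.
  by apply: sum_conv; lia.
have S21 : \sum_(0 <= t < N) 2 ^ t * conv (numerator x2) (denominator x1) t = n2 * d1.
  by apply: sum_conv; lia.
have d1p : (0 < d1%:R :> R)%R by rewrite ltr0n denominator_gt0.
have d2p : (0 < d2%:R :> R)%R by rewrite ltr0n denominator_gt0.
set s1 := negative x1 (+) f1; set s2 := negative x2 (+) f2.
rewrite ler_pdivrMr // mulrAC ler_pdivlMr // -!mulrA -!natrM.
(* Equal signs leave one product on each side; opposite signs put both on the same side. *)
case: s1; case: s2; rewrite ?expr0 ?expr1 ?mul1r ?mulN1r;
  [under eq_bigr do rewrite addn0; under [X in _ <= X]eq_bigr do rewrite add0n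
  |under eq_bigr do rewrite addn0 muln0; rewrite big1_eq
  |under [X in _ <= X]eq_bigr do rewrite addn0 muln0; rewrite [X in _ <= X]big1_eq;
   under eq_bigr do rewrite mulnDr; rewrite big_split /=
  |under eq_bigr do rewrite add0n; under [X in _ <= X]eq_bigr do rewrite addn0];
  rewrite ?S12 ?S21.
- by rewrite lerN2 ler_nat.
- by rewrite leq0n; apply/esym; apply: (@le_trans _ _ 0%R); rewrite ?oppr_le0 ler0n.
(* A nonnegative value is compared with a nonpositive one, so both products must vanish; this does
   occur, as a zero may carry a minus sign. *)
- apply/idP/idP => H; last first.
    have : ((n1 * d2)%:R <= 0 :> R)%R by apply: le_trans H _; rewrite oppr_le0 ler0n.
    have : ((n2 * d1)%:R <= 0 :> R)%R by rewrite -oppr_ge0; apply: le_trans H; rewrite ler0n.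
    by rewrite !lern0 => /eqP-> /eqP->.
  have -> : n1 * d2 = 0 by lia.
  have -> : n2 * d1 = 0 by lia.
  by rewrite oppr0.
- by rewrite ler_nat.
Qed.

End LocatedPairs.

(* [Var 0], [Var 1], [Var 2], [Var 3] are the number of rows, the number of
   columns, the row to be eliminated and the row protected with it; row [r] has
   code [r] and column [c] has code [n + c] in the set of removed strategies. *)
Definition allowed_tm x d : formula :=
  let b := cnt_tm is_bar xpred0 x d in
  let l := feq (cnt_tm xpredT is_sep x d) (Cst 0) in
  let s := cnt_tm is_slash is_sep x d in
  fdisj (fand (feq b (Cst 0)) (fdisj (Sym is_one x)
    (fand (Sym is_bar x) (feq (cnt_tm xpredT is_sep x d) (Var 2)))))
  (fand (fand (flt (Cst 0) b) (flt b (Cst 3)))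
    (fdisj (Sym is_bit x)
    (fdisj (fand (Sym is_minus x) l)
    (fdisj (fand (Sym is_slash x) (feq s (Cst 0)))
    (fdisj (fand (Sym is_comma x) (fand (flt (Cst 0) s) (flt (Cst 0) (cnt_tm is_one is_part_end x d))))
    (fdisj (fand (Sym is_semi x) (fand l (feq (cnt_tm is_comma is_row_end x d) (Var 1))))
      (fand (Sym is_bar x) (fand l (fand (feq (cnt_tm is_comma is_row_end x d) (Cst 0))
        (feq (cnt_tm is_semi is_bar x d) (Var 0))))))))))).

Definition valid_tm : formula :=
  fand (fall (allowed_tm 3 4)) (feq (Sum (Sym is_bar 3)) (Cst 3)).

(** Equality of [A] and [- B] as two inequalities: a number has several encodings, so values have to
    be compared. The flag [true] negates the entry of the second matrix. *)
Definition zero_sum_tm : formula :=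
  fall (fall (fimp (fand (flt (Var 3) (Var 0)) (flt (Var 4) (Var 1)))
    (fand (le_tm 1 3 4 false 2 3 4 true 5 0) (le_tm 2 3 4 true 1 3 4 false 5 0)))).

Definition alive v : formula := fnot (Elem 0 v).

(** [Elem] takes only variables, so the code of the column is bound as a position of its own; this
    works because [n + m] is below the word length. *)
Definition row_dom v u d : formula :=
  fall (fall (fimp (fand (fand (flt (Var d) (Var 1)) (feq (Var d.+1) (Add (Var 0) (Var d)))) (alive d.+1))
    (le_tm 1 v d false 1 u d false d.+2 1))).

(** The codes [v] and [u] are first turned into column numbers. The inequality is reversed because
    the column player receives [- A]. *)
Definition col_dom v u d : formula :=
  Sum (Sum (fand (fand (feq (Var v) (Add (Var 0) (Var d))) (feq (Var u) (Add (Var 0) (Var d.+1))))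
    (fall (fimp (fand (flt (Var d.+2) (Var 0)) (alive d.+2))
      (le_tm 1 d.+2 d.+1 false 1 d.+2 d false d.+3 1))))).

Definition removable_tm v d : formula :=
  fand (flt (Var v) (Add (Var 0) (Var 1))) (fand (fnot (feq (Var v) (Var 2)))
  (fand (fnot (feq (Var v) (Var 3))) (fand (alive v)
  (Sum (fand (flt (Var d) (Add (Var 0) (Var 1))) (fand (fnot (feq (Var d) (Var v))) (fand (alive d)
    (fdisj (fand (fand (flt (Var v) (Var 0)) (flt (Var d) (Var 0))) (row_dom v d d.+1))
           (col_dom v d d.+1))))))))).

(** The iterated set holds the removed strategies, the complement of the greedy reduction, because
    [Iter] starts from the empty set. [Var 4] is the round and [Var 5] the candidate. *)
Definition step_tm : formula :=
  fdisj (Elem 0 5) (fand (removable_tm 5 6)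
    (fall (fimp (flt (Var 6) (Var 5)) (fnot (removable_tm 6 7))))).

Definition eliminable_tm : formula :=
  Sum (fand (fand (flt (Var 3) (Var 0)) (fnot (feq (Var 3) (Var 2)))) (Iter step_tm (row_dom 2 3 4))).

(** The dimensions and the row are found by trying all positions, [Sum] acting as an existential
    quantifier; all three numbers are below the word length. *)
Definition z_weak_tm : formula :=
  Sum (Sum (Sum (fand (fand valid_tm (flt (Var 2) (Var 0))) (fand zero_sum_tm eliminable_tm)))).

(** [60] tapes of each kind accommodate the nesting of binders and scratch counters. *)
Lemma fits_z_weak_tm : fits 60 z_weak_tm 0 0 0.
Proof. by vm_compute. Qed.

Lemma holds_allowed w x d rho sigma : size rho = d -> x < d ->
  holds w (allowed_tm x d) rho sigma =
  allowed (nth 0 rho 0) (nth 0 rho 1) (nth 0 rho 2) (take (nth 0 rho x) w) (nth Bar w (nth 0 rho x)).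
Proof.
move=> rd xd; rewrite /allowed_tm /allowed.
by rewrite !(holds_or, holds_and, holds_eq, holds_lt, holds_sym) !cnt_tmE //= orbF.
Qed.

Lemma holds_valid w n m i : holds w valid_tm [:: n; m; i] [::] =
  allowed_from n m i [::] w && (bars w == 3).
Proof.
rewrite holds_and holds_all holds_eq den_sum.
have -> : \sum_(0 <= x < size w) den Bar w (Sym is_bar 3) (rcons [:: n; m; i] x) [::] = bars w.
  rewrite /bars cnt_count ?has_pred0 //.
  by rewrite -[RHS]sum1_count [RHS]big_mkcond [RHS](big_nth Bar) /=; apply: eq_bigr => x _; case: is_bar.
congr andb; apply/allP/allowed_fromP => [H x xw|H x].
  by have := H x; rewrite mem_iota holds_allowed //= => /(_ xw).
by rewrite mem_iota holds_allowed //=; apply: H.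
Qed.

Definition rows_of n m (X : 'M[fraction]_(n, m)) := [seq [seq X r c | c <- enum 'I_m] | r <- enum 'I_n].

Lemma encode_instanceE n m (X Y : 'M[fraction]_(n, m)) (i : 'I_n) :
  encode_instance X Y i = encode_lists i (rows_of X) (rows_of Y).
Proof.
have E (Z : 'M[fraction]_(n, m)) : encode_matrix Z = encode_rows (rows_of Z).
  rewrite /encode_matrix /encode_rows /rows_of -map_comp; congr (rcons (flatten _) _).
  by apply: eq_map => r /=; rewrite /encode_row -map_comp.
by rewrite /encode_instance /encode_lists cat_rcons !E.
Qed.

Lemma size_rows_of n m (X : 'M[fraction]_(n, m)) : size (rows_of X) = n.
Proof. by rewrite size_map size_enum_ord. Qed.

Lemma all_rows_of n m (X : 'M[fraction]_(n, m)) : all (fun l => size l == m) (rows_of X).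
Proof. by rewrite all_map; apply/allP => r _ /=; rewrite size_map size_enum_ord. Qed.

Lemma nth_rows_of n m (X : 'M[fraction]_(n, m)) x0 (r : 'I_n) (c : 'I_m) :
  nth x0 (nth [::] (rows_of X) r) c = X r c.
Proof.
rewrite (nth_map r) ?size_enum_ord // (nth_map c) ?size_enum_ord //.
by rewrite !nth_ord_enum.
Qed.

Lemma rows_of_surj n m L : size L = n -> all (fun l => size l == m) L ->
  exists X : 'M[fraction]_(n, m), L = rows_of X.
Proof.
move=> Ln Lm; pose x0 := @Fraction false [::] [:: true] isT.
exists (\matrix_(r < n, c < m) nth x0 (nth [::] L r) c)%R.
rewrite -{1}(mkseq_nth [::] L) Ln /mkseq -val_enum_ord -map_comp; apply: eq_map => r /=.
have lm : size (nth [::] L r) = m by apply/eqP/(all_nthP [::] Lm); rewrite Ln.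
rewrite -{1}(mkseq_nth x0 (nth [::] L r)) lm /mkseq -val_enum_ord -map_comp; apply: eq_map => c /=.
by rewrite mxE.
Qed.

(** Each row contributes at least [m] commas and a semicolon. Without rows the number of columns
    would leave no trace in the word, hence [0 < n]. *)
Lemma size_encode_lists n m i L1 L2 : size L1 = n -> all (fun l => size l == m) L1 -> 0 < n ->
  n + m < size (encode_lists i L1 L2).
Proof.
move=> <- Lm L0; rewrite /encode_lists !size_cat !size_rcons.
have Hl l : size l < size (encode_row l).
  rewrite size_rcons ltnS; elim: l => //= x l IH.
  by rewrite size_cat size_rcons; lia.
have : size L1 * m.+1 <= size (flatten [seq encode_row l | l <- L1]).
  elim: (L1) Lm => [//|l L IH] /= /andP[/eqP lm /IH].
  by rewrite size_cat mulSn; have := Hl l; rewrite lm; lia.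
by nia.
Qed.

(** * Meaning of the term on an encoded instance *)

Section Instance.
Variables (R : realType) (n m : nat) (X Y : 'M[fraction]_(n, m)) (i : 'I_n).
Local Notation w := (encode_instance X Y i).
Local Notation N := (size w).
Local Notation A := (map_mx (@fraction_val R) X).
Local Notation B := (map_mx (@fraction_val R) Y).
Local Notation holds := (holds w).

Lemma instance_size : n + m < N.
Proof.
rewrite encode_instanceE; apply: size_encode_lists; rewrite ?size_rows_of ?all_rows_of //.
by case: n i => [[]|].
Qed.

Lemma located1 (r : 'I_n) (c : 'I_m) : located w (1, val r, val c) (X r c).
Proof.
rewrite encode_instanceE /encode_lists.
have [_ e0 k0] := @allowed_prefix n m i.
have [u' [v [E k e]]] := locate_entry (X r c) (isT : 0 < 1 < 3) e0 k0
  (all_rows_of X) (size_rows_of X) (ltn_ord r) (ltn_ord c).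
exists u', (v ++ encode_rows (rows_of Y)); split=> //.
by rewrite catA E nth_rows_of -!catA.
Qed.

Lemma located2 (r : 'I_n) (c : 'I_m) : located w (2, val r, val c) (Y r c).
Proof.
rewrite encode_instanceE /encode_lists catA.
have [_ e0 k0] := @allowed_prefix n m i.
have [_ e1 k1] := @allowed_rows n m i _ _ 1 isT e0 k0 (all_rows_of X) (size_rows_of X).
have [u' [v [E k e]]] := locate_entry (Y r c) (isT : 0 < 2 < 3) e1 k1
  (all_rows_of Y) (size_rows_of Y) (ltn_ord r) (ltn_ord c).
by exists u', v; split=> //; rewrite E nth_rows_of.
Qed.

(** The entries must be distinct because the carry bound rests on their disjointness; dominance
    compares distinct strategies only, so this suffices. *)
Lemma le_entries (r r' : 'I_n) (c c' : 'I_m) : (r != r') || (c != c') ->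
  le_word w (1, val r, val c) false (1, val r', val c') false = (A r c <= A r' c')%R.
Proof.
move=> rc; rewrite (le_word_located R _ _ (located1 r c) (located1 r' c')).
  by rewrite !expr0 !mul1r !mxE.
by rewrite !xpair_eqE /= -negb_and in rc *.
Qed.

Lemma holds_row_dom rho P v u d (r r' : 'I_n) : size rho = d -> 1 < d -> v < d -> u < d ->
  nth 0 rho 0 = n -> nth 0 rho 1 = m -> nth 0 rho v = r -> nth 0 rho u = r' -> r != r' ->
  holds (row_dom v u d) rho [:: P] <->
  (forall j : 'I_m, ~~ P (n + j) -> (A r j <= A r' j)%R).
Proof.
move=> rd d1 vd ud r0 r1 rv ru rr'.
have sz x y : size (rcons (rcons rho x) y) = d.+2 by rewrite !size_rcons rd.
have E x y : holds (fimp (fand (fand (flt (Var d) (Var 1)) (feq (Var d.+1) (Add (Var 0) (Var d)))) (alive d.+1))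
    (le_tm 1 v d false 1 u d false d.+2 1)) (rcons (rcons rho x) y) [:: P] =
  ([&& x < m, y == n + x & ~~ P y] ==> le_word w (1, val r, x) false (1, val r', x) false).
  rewrite holds_imp le_tmE ?sz //; try lia.
  rewrite 2!holds_and holds_lt holds_eq holds_not holds_elem /=; nthr.
  by rewrite r0 r1 rv ru andbA.
rewrite holds_all; split=> [/allP H j Pj|H].
  have Nj := instance_size; have jm := ltn_ord j.
  have := H j; rewrite mem_iota holds_all => /(_ ltac:(by lia)) /allP /(_ (n + j)).
  rewrite mem_iota E jm eqxx Pj /= le_entries ?rr' //; apply; lia.
apply/allP => x _; rewrite holds_all; apply/allP => y _; rewrite E; apply/implyP.
move=> /and3P[xm /eqP-> Px]; rewrite -[x]/(val (Ordinal xm)) le_entries ?rr' //; exact: H.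
Qed.

Lemma holds_col_dom rho P v u d (c c' : 'I_m) : size rho = d -> 1 < d -> v < d -> u < d ->
  nth 0 rho 0 = n -> nth 0 rho v = n + c -> nth 0 rho u = n + c' -> c != c' ->
  holds (col_dom v u d) rho [:: P] <->
  (forall r : 'I_n, ~~ P r -> (A r c' <= A r c)%R).
Proof.
move=> rd d1 vd ud r0 rv ru cc'.
have sz x y z : size (rcons (rcons (rcons rho x) y) z) = d.+3 by rewrite !size_rcons rd.
have E x y : holds (fand (fand (feq (Var v) (Add (Var 0) (Var d))) (feq (Var u) (Add (Var 0) (Var d.+1))))
    (fall (fimp (fand (flt (Var d.+2) (Var 0)) (alive d.+2))
      (le_tm 1 d.+2 d.+1 false 1 d.+2 d false d.+3 1)))) (rcons (rcons rho x) y) [:: P] =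
  [&& x == c, y == c' & all (fun z => (z < n) && ~~ P z ==>
      le_word w (1, z, y) false (1, z, x) false) (iota 0 N)].
  rewrite 2!holds_and !holds_eq holds_all /=; nthr; rewrite r0 rv ru !eqn_add2l -andbA.
  rewrite [val c == _]eq_sym [val c' == _]eq_sym; congr [&& _, _ & _].
  apply: eq_all => z; rewrite holds_imp le_tmE ?sz //; try lia.
  by rewrite holds_and holds_lt holds_not holds_elem /=; nthr; rewrite r0.
have Nn := instance_size; have cm := ltn_ord c; have cm' := ltn_ord c'.
rewrite holds_sum; split=> [/hasP[x _]|H].
  rewrite holds_sum => /hasP[y _]; rewrite E => /and3P[/eqP-> /eqP-> /allP H] r Pr.
  have rn := ltn_ord r; rewrite -le_entries 1?eq_sym ?cc' ?orbT //.
  by have := H r; rewrite mem_iota rn Pr /=; apply; lia.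
apply/hasP; exists (val c); first by rewrite mem_iota /=; lia.
rewrite holds_sum; apply/hasP; exists (val c'); first by rewrite mem_iota /=; lia.
rewrite E !eqxx /=; apply/allP => z _; apply/implyP => /andP[zn Pz].
by rewrite -[z]/(val (Ordinal zn)) le_entries 1?eq_sym ?cc' ?orbT //; apply: H.
Qed.

Section Protected.
Variable k : 'I_n.
Local Notation protected := [set lshift m i; lshift m k].

Lemma holds_removable rho (P : pred nat) (S : {set 'I_(n + m)}) v d (a : 'I_(n + m)) :
  size rho = d -> 3 < d -> v < d ->
  nth 0 rho 0 = n -> nth 0 rho 1 = m -> nth 0 rho 2 = i -> nth 0 rho 3 = k -> nth 0 rho v = a ->
  (forall b : 'I_(n + m), (b \in S) = ~~ P b) ->
  holds (removable_tm v d) rho [:: P] = removable (@is_row n m) (payoff A) protected S a.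
Proof.
move=> rd d3 vd r0 r1 r2 r3 rv SP; have Nn := instance_size.
rewrite 4!holds_and !holds_not !holds_eq holds_lt holds_elem holds_sum /removable !inE negb_or.
rewrite /= r0 r1 r2 r3 rv ltn_ord /= SP.
rewrite -!(inj_eq val_inj) /=; case: (nat_of_ord a == i); case: (nat_of_ord a == k); case: (P a) => //=.
have sz y : size (rcons rho y) = d.+1 by rewrite size_rcons rd.
have E y : holds (fand (flt (Var d) (Add (Var 0) (Var 1))) (fand (fnot (feq (Var d) (Var v))) (fand (alive d)
    (fdisj (fand (fand (flt (Var v) (Var 0)) (flt (Var d) (Var 0))) (row_dom v d d.+1))
           (col_dom v d d.+1))))) (rcons rho y) [:: P] =
  [&& y < n + m, y != a, ~~ P y & (a < n) && (y < n) && holds (row_dom v d d.+1) (rcons rho y) [:: P]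
     || holds (col_dom v d d.+1) (rcons rho y) [:: P]].
  rewrite 3!holds_and holds_or 2!holds_and !holds_lt !holds_not holds_eq holds_elem /=; nthr.
  by rewrite r0 r1 rv.
have V z y : z < d -> nth 0 (rcons rho y) z = nth 0 rho z by move=> zd; nthr.
have VD y : nth 0 (rcons rho y) d = y by nthr.
(* A code below [n] is not of the form [n + c], so [col_dom] fails for a row. *)
have colF y : (a < n) -> holds (col_dom v d d.+1) (rcons rho y) [:: P] = false.
  move=> an; apply/negP; rewrite holds_sum => /hasP[c _]; rewrite holds_sum => /hasP[c' _].
  rewrite 2!holds_and holds_eq /=; nthr; rewrite r0 rv => /andP[/andP[/eqP aE _] _].
  by lia.
apply/hasP/existsP => [[y _]|[b ab]].
  rewrite E => /and4P[ynm ya Py H]; pose b := Ordinal ynm; exists b.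
  have bS : b \in S by rewrite SP.
  have ba : b != a by rewrite -(inj_eq val_inj).
  have [[r aE]|[c aE]] := shiftP a.
    have an : a < n by rewrite aE /= ltn_ord.
    move: H; rewrite colF // orbF an /= => /andP[yn H].
    have bE : b = lshift m (Ordinal yn) by apply: val_inj.
    rewrite bE aE in bS ba *; apply/dom_rowP; split=> // j jS.
    have rr : r != Ordinal yn by apply: contraNneq ba => ->.
    apply: (iffLR (@holds_row_dom (rcons rho y) P v d d.+1 r (Ordinal yn) (sz y) _ _ _ _ _ _ _ rr) H);
      rewrite ?VD ?V ?rv ?aE //; try lia.
    by rewrite SP in jS.
  have an : (a < n) = false by rewrite aE /= ltnNge leq_addr.
  move: H; rewrite an /= => H.
  have [[r bE]|[c' bE]] := shiftP b.
    move: H; rewrite holds_sum => /hasP[c1 _]; rewrite holds_sum => /hasP[c2 _].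
    rewrite 2!holds_and !holds_eq /=; nthr; rewrite r0 => /andP[/andP[_ /eqP yE] _].
    by have := congr1 val bE; have := ltn_ord r; rewrite /= yE; lia.
  rewrite bE aE in bS ba *; apply/dom_colP; split=> // [|r rS].
    by rewrite -(inj_eq (@rshift_inj n m)).
  have cc : c != c' by apply: contraNneq ba => ->.
  have yE : y = n + c' by have := congr1 val bE.
  apply: (iffLR (@holds_col_dom (rcons rho y) P v d d.+1 c c' (sz y) _ _ _ _ _ _ cc) H);
    rewrite ?VD ?V ?rv ?aE //; try lia.
  by rewrite SP in rS.
exists (val b); first by rewrite mem_iota /=; have := ltn_ord b; lia.
have /dominatedP[bS ba _ _] := ab.
rewrite E ltn_ord (inj_eq val_inj) ba -SP bS /=.
have [[r aE]|[c aE]] := shiftP a; rewrite aE in ab.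
  have [r' bE] := dom_row ab; rewrite bE in ab; have /dom_rowP[_ rr le] := ab.
  apply/orP; left; apply/andP; split; first by rewrite aE bE /= !ltn_ord.
  apply: (iffRL (@holds_row_dom (rcons rho b) P v d d.+1 r r' (sz b) _ _ _ _ _ _ _ _));
    rewrite ?VD ?V ?rv ?aE ?bE //; try lia; first by rewrite eq_sym.
  by move=> j Pj; apply: le; rewrite SP.
have [c' bE] := dom_col ab; rewrite bE in ab; have /dom_colP[_ cc le] := ab.
apply/orP; right.
apply: (iffRL (@holds_col_dom (rcons rho b) P v d d.+1 c c' (sz b) _ _ _ _ _ _ _));
  rewrite ?VD ?V ?rv ?aE ?bE //; try lia; first by rewrite eq_sym.
by move=> r Pr; apply: le; rewrite SP.
Qed.

Definition removed t : pred nat := iteri t (fun t P x =>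
  (x < N) && holds step_tm (rcons (rcons [:: n; m; val i; val k] t) x) (rcons [::] P)) xpred0.

Lemma removed_greedy t (a : 'I_(n + m)) : (a \in greedy_pair A i k t) = ~~ removed t a.
Proof.
elim: t a => [|t IH] a; first by rewrite inE.
have Nn := instance_size; have anm := ltn_ord a.
rewrite /greedy_pair /greedy iterS -/(greedy _ _ _ t) -/(greedy_pair A i k t).
rewrite /removed iteriS -/(removed t) (_ : a < N); last by lia.
set rho := rcons (rcons _ _) _.
have remE q (b : 'I_(n + m)) : q = val b ->
  holds (removable_tm 6 7) (rcons rho q) [:: removed t] =
  removable (@is_row n m) (payoff A) protected (greedy_pair A i k t) b.
  by move=> qb; apply: holds_removable.
rewrite inE andTb holds_or holds_elem holds_and negb_or IH /=; congr (_ && ~~ (_ && _)).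
  by apply/esym; apply: holds_removable.
rewrite holds_all; apply/forallP/allP => [H q|H b].
  rewrite mem_iota => /= qN; rewrite holds_imp holds_lt holds_not; apply/implyP => /= qa.
  have qnm : q < n + m by lia.
  by rewrite (remE q (Ordinal qnm)) //; apply: (implyP (H (Ordinal qnm))).
have bnm := ltn_ord b; apply/implyP => ba; have := H (val b).
rewrite mem_iota holds_imp holds_lt holds_not (remE _ b) //= ba; apply; lia.
Qed.

End Protected.

Lemma holds_eliminable : holds eliminable_tm [:: n; m; val i] [::] <-> weakly_eliminable A (- A) i.
Proof.
have Nn := instance_size; rewrite (weakly_eliminable_greedy A i (ltnW Nn)) holds_sum.
have E (k : 'I_n) : k != i -> holds (Iter step_tm (row_dom 2 3 4)) [:: n; m; val i; val k] [::] <->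
    (forall j, rshift n j \in greedy_pair A i k N -> (A i j <= A k j)%R).
  move=> ki; rewrite -[holds (Iter _ _) _ _]/(holds (row_dom 2 3 4) [:: n; m; val i; val k] [:: removed k N]).
  rewrite (@holds_row_dom _ _ 2 3 4 i k) // 1?eq_sym //.
  by split=> H j Pj; apply: H; move: Pj; rewrite removed_greedy.
split=> [/hasP[k _]|[k [ki H]]].
  rewrite 2!holds_and holds_lt holds_not holds_eq /= => /andP[/andP[kn ki] H].
  exists (Ordinal kn); split; first by rewrite -(inj_eq val_inj).
  by apply/E; rewrite // -(inj_eq val_inj).
apply/hasP; exists (val k); first by rewrite mem_iota /=; have := ltn_ord k; lia.
rewrite 2!holds_and holds_lt holds_not holds_eq /= ltn_ord (inj_eq val_inj) ki /=.
exact/E.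
Qed.

Lemma holds_zero_sum : holds zero_sum_tm [:: n; m; val i] [::] <-> zero_sum A B.
Proof.
have Nn := instance_size.
have E r c : holds (fimp (fand (flt (Var 3) (Var 0)) (flt (Var 4) (Var 1)))
    (fand (le_tm 1 3 4 false 2 3 4 true 5 0) (le_tm 2 3 4 true 1 3 4 false 5 0)))
    [:: n; m; val i; r; c] [::] =
  ((r < n) && (c < m) ==> le_word w (1, r, c) false (2, r, c) true && le_word w (2, r, c) true (1, r, c) false).
  by rewrite holds_imp !holds_and !holds_lt !le_tmE.
have L (r : 'I_n) (c : 'I_m) : le_word w (1, val r, val c) false (2, val r, val c) true &&
    le_word w (2, val r, val c) true (1, val r, val c) false = ((A + B) r c == 0)%R.
  rewrite (le_word_located R _ _ (located1 r c) (located2 r c)) //.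
  rewrite (le_word_located R _ _ (located2 r c) (located1 r c)) //.
  by rewrite -eq_le expr0 expr1 mul1r mulN1r !mxE addr_eq0.
rewrite holds_all; split=> [/allP H|AB].
  apply/matrixP => r c; rewrite [RHS]mxE; apply/eqP; rewrite -L.
  have := H r; rewrite mem_iota holds_all => /(_ ltac:(by have := ltn_ord r; lia)) /allP /(_ (val c)).
  by rewrite mem_iota E /= !ltn_ord add0n; apply; have := ltn_ord c; move: Nn; clear; lia.
apply/allP => r _; rewrite holds_all; apply/allP => c _; rewrite E; apply/implyP => /andP[rn cm].
by rewrite (L (Ordinal rn) (Ordinal cm)) AB mxE.
Qed.

End Instance.

Lemma z_weak_tmP (R : realType) w : 0 < den Bar w z_weak_tm [::] [::] <-> Z_Weak R w.
Proof.
rewrite -/(holds w z_weak_tm [::] [::]); split.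
  rewrite holds_sum => /hasP[n _]; rewrite holds_sum => /hasP[m _]; rewrite holds_sum => /hasP[i0 _].
  rewrite 3!holds_and holds_valid holds_lt => /andP[/andP[/andP[ok /eqP b3] i0n] /andP[zs el]].
  have [L1 [L2 [wE L1m L2m L1n L2n]]] := parse_lists ok b3.
  have [X XE] := rows_of_surj L1n L1m; have [Y YE] := rows_of_surj L2n L2m.
  pose i : 'I_n := Ordinal i0n.
  have wI : w = encode_instance X Y i by rewrite encode_instanceE -XE -YE.
  have zsI := (holds_zero_sum R X Y i).1; have elI := (holds_eliminable R X Y i).1.
  rewrite -wI in zsI elI; exists n, m, X, Y, i; have ZS := zsI zs.
  (* [zero_sum] turns [B] into [- A], the form in which eliminability is characterised. *)
  by split=> //; rewrite -(addr0_eq ZS); apply: elI.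
move=> [n [m [X [Y [i [wE zs el]]]]]].
have Nn := instance_size X Y i; rewrite -wE in Nn; have in_ := ltn_ord i.
rewrite holds_sum; apply/hasP; exists n; first by rewrite mem_iota /=; lia.
rewrite holds_sum; apply/hasP; exists m; first by rewrite mem_iota /=; lia.
rewrite holds_sum; apply/hasP; exists (val i); first by rewrite mem_iota /=; lia.
rewrite -(addr0_eq zs) in el.
rewrite 3!holds_and holds_valid holds_lt /= in_ andbT wE.
rewrite (holds_zero_sum R X Y i).2 // (holds_eliminable R X Y i).2 // !andbT encode_instanceE.
have [-> ->] := allowed_encode i (all_rows_of X) (all_rows_of Y) (size_rows_of X) (size_rows_of Y).
by [].
Qed.

Theorem theorem6p3 (R : realType) : in_P (Z_Weak R).
Proof.
exact: (in_P_of_term (isT : 0 < 60) fits_z_weak_tm (@z_weak_tmP R)).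
Qed.
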